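(* Let $k_1,l_1,k_2,l_2\ge 0$ be integers with $\alpha=\frac{k_1-l_1}{2}\ge 0$ and $\beta=\frac{k_2-l_2}{2}\ge 0$. Let $w_{l_1+l_2}(\cdot\,;\alpha,\beta):\mathbb{C}_+\to\Omega_{l_1+l_2}(\alpha,\beta)$ be the normalized conformal mapping with associated constant $C_{l_1+l_2}(\alpha,\beta)$, let $\xi_j=w_{l_1+l_2}^{-1}(\infty_j;\alpha,\beta)$, $1\le j\le l_1+l_2$, and factorize $\tilde{\mathcal J}_{l_1+l_2}(t;\alpha,\beta):=\prod_{j=1}^{l_1+l_2}(t-\xi_j) = \tilde{\mathcal J}_{l_1}^{(1)}(t)\,\tilde{\mathcal J}_{l_2}^{(2)}(t)$ in polynomials of degrees $l_1$ and $l_2$ respectively in the following way: $$\tilde{\mathcal J}_{l_1}^{(1)}(t)=(t-\xi_1)\cdots(t-\xi_{l_1}),\qquad \tilde{\mathcal J}_{l_2}^{(2)}(t)=(t-\xi_{l_1+1})\cdots(t-\xi_{l_1+l_2}).$$ Then $$T_{k_1,l_1,k_2,l_2}(z_1,z_2)=e^{C_{l_1+l_2}(\alpha,\beta)}\,z_1^{k_1-l_1}z_2^{k_2-l_2}\,\tilde{\mathcal J}_{l_1}^{(1)}(|z_1|^2)\,(-1)^{l_2}\,\tilde{\mathcal J}_{l_2}^{(2)}(1-|z_2|^2)$$ is a normalized polynomial of least deviation from zero on the unit ball $\mathbb{B}\subset\mathbb{C}^2$ for the monomial $z_1^{k_1}\bar z_1^{l_1}z_2^{k_2}\bar z_2^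{l_2}$.
   Context: Least deviation on the ball. Let $\mathbb{B}=\{(z_1,z_2)\in\mathbb{C}^2: |z_1|^2+|z_2|^2\le 1\}$ and $\|P\|=\sup_{(z_1,z_2)\in\mathbb{B}}|P(z_1,z_2)|$. Polynomials here are (non analytic) polynomials in $z_1,\bar z_1,z_2,\bar z_2$ with complex coefficients, i.e. complex linear combinations of monomials $z_1^{a}\bar z_1^{b}z_2^{c}\bar z_2^{d}$ ($a,b,c,d\ge 0$ integers), of total degree $a+b+c+d$; $\Pi_m$ is the set of such polynomials of total degree at most $m$. For $N=k_1+l_1+k_2+l_2$, a polynomial of least deviation from zero on $\mathbb{B}$ is a polynomial $\tilde T=z_1^{k_1}\bar z_1^{l_1}z_2^{k_2}\bar z_2^{l_2}-P$ with $P\in\Pi_{N-1}$ whose norm equals $$L_{k_1,l_1,k_2,l_2}:=\inf_{P\in \Pi_{N-1}}\|z_1^{k_1}\bar z_1^{l_1}z_2^{k_2}\bar z_2^{l_2}-P(z_1,z_2)\|$$ (it is not unique). A normalized polynomial of least deviation from zero is $T_{k_1,l_1,k_2,l_2}=\tilde T/\|\tilde T\|$ for such a $\tilde T$; thus $T_{k_1,l_1,k_2,l_2}=\Lambda_{k_1,l_1,k_2,l_2}z_1^{k_1}\bar z_1^{l_1}z_2^{k_2}\bar z_2^{l_2}+\dots$ with $\Lambda_{k_1,l_1,k_2,l_2}=1/L_{k_1,l_1,k_2,l_2}$. Conformal map. For nonnegative real numbers $\alpha,\beta$ and an integer $n\ge 0$, let $$\Omega_n(\alpha,\beta) = \{ w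 = u+iv : - \beta < \tfrac v \pi < \alpha + n \}\setminus \bigcup_{j=0}^{n} \{ w = u+iv : \tfrac v\pi= j,\ u \le 0 \}.$$ The boundary of the domain contains $n+3$ infinite points: $\infty_0=-\infty+iv$, $n<\frac v\pi<n+\alpha$; $\infty_j=-\infty+iv$, $n-j<\frac v\pi<n-j+1$ ($1\le j\le n$); $\infty_{n+1}=-\infty+iv$, $-\beta<\frac v\pi<0$; $\infty_{n+2}=+\infty+iv$, $-\beta<\frac v\pi<\alpha+n$. Let $w=w_n(\cdot\,;\alpha,\beta)$ be the conformal mapping of the upper half-plane $\mathbb{C}_+$ onto $\Omega_n(\alpha,\beta)$ with the normalization $w(0)=\infty_0$, $w(1)=\infty_{n+1}$, $w(\infty)=\infty_{n+2}$. The real constant $C_n(\alpha,\beta)$ is uniquely defined by the domain through the asymptotics $$w_n(z;\alpha,\beta)=(\alpha+\beta+n)\ln z+C_n(\alpha,\beta)-\beta\pi i+ O(1/z),\qquad z\to\infty.$$ The points $\xi_j=w_n^{-1}(\infty_j;\alpha,\beta)$, $1\le j\le n$, are the preimages of $\infty_j$ under the boundary correspondence; they satisfy $\xi_j<\xi_{j+1}$. *)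

(* Defs.v *)
(* Stdlib reals and Coquelicot complex numbers. *)
From Stdlib Require Import Reals ZArith List.
From Coquelicot Require Export Coquelicot.
Open Scope R_scope.

(** ** Non-analytic polynomials on C^2 and least deviation on the ball *)

Definition unit_ball (z1 z2 : C) : Prop := Cmod z1 ^ 2 + Cmod z2 ^ 2 <= 1.

Definition monomial (k1 l1 k2 l2 : nat) (z1 z2 : C) : C :=
  (z1 ^ k1 * Cconj z1 ^ l1 * z2 ^ k2 * Cconj z2 ^ l2)%C.

Record monomial_term := MonomialTerm { coef : C; ez1 : nat; ez1b : nat; ez2 : nat; ez2b : nat }.

Definition term_degree (t : monomial_term) : nat := (ez1 t + ez1b t + ez2 t + ez2b t)%nat.

Definition term_eval (t : monomial_term) (z1 z2 : C) : C :=
  (coef t * monomial (ez1 t) (ez1b t) (ez2 t) (ez2b t) z1 z2)%C.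

Definition lin_comb (s : list monomial_term) (z1 z2 : C) : C :=
  fold_right (fun t acc => (term_eval t z1 z2 + acc)%C) (RtoC 0) s.

(* Polynomials are identified with the functions they define on C^2 (a
   polynomial in z1, conj z1, z2, conj z2 is determined by its values).
   The bound m is an integer so that poly_degree_le (-1) contains only the zero function. *)
Definition poly_degree_le (m : Z) (P : C -> C -> C) : Prop :=
  exists s : list monomial_term,
    List.Forall (fun t => (Z.of_nat (term_degree t) <= m)%Z) s /\
    forall z1 z2, P z1 z2 = lin_comb s z1 z2.

Definition ball_norm (P : C -> C -> C) : R :=
  real (Lub_Rbar (fun r => exists z1 z2, unit_ball z1 z2 /\ r = Cmod (P z1 z2))).

Definition monomial_minus (k1 l1 k2 l2 : nat) (P : C -> C -> C) (z1 z2 : C) : C :=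
  (monomial k1 l1 k2 l2 z1 z2 - P z1 z2)%C.

Definition lower_polynomial (k1 l1 k2 l2 : nat) (P : C -> C -> C) : Prop :=
  poly_degree_le (Z.of_nat (k1 + l1 + k2 + l2) - 1) P.

Definition least_deviation (k1 l1 k2 l2 : nat) : R :=
  real (Glb_Rbar (fun r => exists P, lower_polynomial k1 l1 k2 l2 P /\
                                     r = ball_norm (monomial_minus k1 l1 k2 l2 P))).

Definition is_least_deviation_poly (k1 l1 k2 l2 : nat) (T : C -> C -> C) : Prop :=
  exists P, lower_polynomial k1 l1 k2 l2 P /\
    (forall z1 z2, T z1 z2 = monomial_minus k1 l1 k2 l2 P z1 z2) /\
    ball_norm T = least_deviation k1 l1 k2 l2.

Definition is_normalized_least_deviation_poly (k1 l1 k2 l2 : nat)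
    (T : C -> C -> C) : Prop :=
  exists T', is_least_deviation_poly k1 l1 k2 l2 T' /\
    forall z1 z2, T z1 z2 = (T' z1 z2 / RtoC (ball_norm T'))%C.

(** ** Comb domains and their normalized conformal maps *)

Definition upper_half_plane (z : C) : Prop := 0 < Im z.

Definition comb_domain (n : nat) (alpha beta : R) (w : C) : Prop :=
  - beta < Im w / PI < alpha + INR n /\
  ~ (exists j : nat, (j <= n)%nat /\ Im w / PI = INR j /\ Re w <= 0).

(* The filters z -> x (x real) and z -> infinity inside the upper half-plane. *)
Definition to_real_point (x : R) : (C -> Prop) -> Prop :=
  within upper_half_plane (locally (T := C_UniformSpace) (RtoC x)).

Definition to_infinity : (C -> Prop) -> Prop :=
  fun A => exists M : R, forall z, upper_half_plane z -> M < Cmod z -> A z.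

(* Convergence to the infinite boundary point -oo + iv (resp. +oo + iv),
   a < v / PI < b. *)
Definition left_end (a b : R) : (C -> Prop) -> Prop :=
  fun A => exists M : R, forall w, a < Im w / PI < b -> Re w < M -> A w.

Definition right_end (a b : R) : (C -> Prop) -> Prop :=
  fun A => exists M : R, forall w, a < Im w / PI < b -> M < Re w -> A w.

Definition to_point (w0 : C) : (C -> Prop) -> Prop := locally (T := C_UniformSpace) w0.

(* [infinite_point n alpha beta j] is the boundary point infty_j, 0 <= j <= n+2.
   If alpha = 0, the channel defining infty_0 is empty: as alpha -> 0 it closes
   up at the tip i n PI of the slit v = n PI, which is then a boundary point of
   the domain and takes the place of infty_0.  Likewise, if beta = 0, infty_(n+1)
   is replaced by the tip 0 of the slit v = 0. *)
Definition infinite_point (n : nat) (alpha beta : R) (j : nat) : (C -> Prop) -> Prop :=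
  if Nat.eq_dec j 0 then
    if Rlt_dec 0 alpha then left_end (INR n) (INR n + alpha)
    else to_point (0, INR n * PI)
  else if le_dec j n then left_end (INR n - INR j) (INR n - INR j + 1)
  else if Nat.eq_dec j (n + 1) then
    if Rlt_dec 0 beta then left_end (- beta) 0
    else to_point (0, 0)
  else right_end (- beta) (alpha + INR n).

Definition conformal_onto (w : C -> C) (D E : C -> Prop) : Prop :=
  (forall z, D z -> ex_derive (K := C_AbsRing) (V := C_NormedModule) w z) /\
  (forall z, D z -> E (w z)) /\
  (forall z z', D z -> D z' -> w z = w z' -> z = z') /\
  (forall y, E y -> exists z, D z /\ w z = y).

Definition is_comb_map (n : nat) (alpha beta : R) (w : C -> C) : Prop :=
  conformal_onto w upper_half_plane (comb_domain n alpha beta) /\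
  filterlim w (to_real_point 0) (infinite_point n alpha beta 0) /\
  filterlim w (to_real_point 1) (infinite_point n alpha beta (n + 1)) /\
  filterlim w to_infinity (infinite_point n alpha beta (n + 2)).

(* Principal branch, with argument in [0, PI] for Im z >= 0. *)
Definition Carg (z : C) : R :=
  if Rle_dec 0 (Im z) then acos (Re z / Cmod z) else - acos (Re z / Cmod z).

Definition Cln (z : C) : C := (ln (Cmod z), Carg z).

(* c is the constant C_n(alpha, beta):
   w(z) = (alpha + beta + n) ln z + c - beta PI i + O(1/z) as z -> infinity. *)
Definition is_comb_constant (n : nat) (alpha beta : R) (w : C -> C) (c : R) : Prop :=
  exists K : R, to_infinity (fun z =>
    Cmod (w z - (RtoC (alpha + beta + INR n) * Cln z + RtoC c - RtoC (beta * PI) * Ci))%C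
      <= K * Cmod (/ z)%C).

(* x = w^{-1}(infty_j) under the boundary correspondence. *)
Definition is_preimage (n : nat) (alpha beta : R) (w : C -> C) (j : nat) (x : R) : Prop :=
  filterlim w (to_real_point x) (infinite_point n alpha beta j).

(* (t - xi_(m+1)) ... (t - xi_(m+l)) *)
Definition root_product (xi : nat -> R) (m l : nat) (t : R) : R :=
  fold_right Rmult 1 (map (fun j => t - xi j) (seq (S m) l)).

(* Main.v *)
(* Let n = l1 + l2.  The comb map is w = alpha ln z + sum ln (z - xi_j) + beta ln (z - 1) + C - beta pi i,
   so that exp (Re w) = exp C t^alpha (1 - t)^beta prod |t - xi_j| on [0, 1], and the slit tips are its
   n + 1 local maxima, all equal to 1.

   To see this, choose xi minimizing the maximum of t^(2 alpha) (1 - t)^(2 beta) prod (t - xi_j)^2 on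
   [0, 1]: moving one root, or two adjacent roots apart, shows that all local maxima are equal.  The
   corresponding sum of logarithms has a derivative with negative imaginary part in the upper half-plane,
   hence is injective there, and its level lines Im = const are graphs over the y-axis, which gives
   its range.  Its inverse composed with the given w is an automorphism of the half-plane, a Moebius map
   by the Schwarz lemma, and it is the identity because the limits at 0, 1 and infinity agree.

   Upper bound on the ball: with s = |z1|^2 <= t = 1 - |z2|^2 the square of |T| is F(s) G(t), where
   F increases to the right of xi_l1, G decreases to the left of xi_(l1+1), and F G <= 1 on the diagonal,
   with equality between these two roots.

   Lower bound: averaging over the tori |z1| = r1, |z2| = r2 and restricting to the sphere reduces to a
   weighted monic polynomial of degree n on [0, 1], for which the n + 1 equal local maxima alternate. *)

Require Import Defs.
From Stdlib Require Import Reals ZArith Arith List Permutation Sorted Lra Lia.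
From Stdlib Require Import Classical ClassicalEpsilon Ranalysis5.
From Coquelicot Require Import Coquelicot.
Import ListNotations.
Open Scope R_scope.

(** * Complex differentiability *)

(** Holomorphy is given only as differentiability at each point of the half-plane. Everything
    analytic is therefore drawn from Goursat's theorem on rectangles, through the mean value
    property and the maximum principle; removable singularities are avoided by keeping a factor z -
    p.

    The boundary hypotheses on [w] are limits of [w] at 0, 1 and infinity, whereas explicit limits
    are available for the model [cw]. They are joined by the inverse automorphism [eta], with
    [w (eta z) = cw z]: a limit of [eta] at a boundary point becomes a limit of [cw] there, and the
    point can be recognized from it.

    The delicate cases are alpha = 0 and beta = 0. The node 0 or 1 then has weight zero and is no
    singularity of the logarithmic sum, its channel closes up to a slit tip, and the outermost local
    maximum sits at the end point itself. For this reason most statements on the nodes speak of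
    those of positive weight only.

    The two halves of the theorem meet in one number, the minimal maximum H of the squared weighted
    polynomial: the constant of the conformal map is - ln H / 2, and sqrt H is the norm on the ball
    of the extremal polynomial with leading coefficient 1. *)

Lemma functional_choice {A B : Type} (P : A -> B -> Prop) :
  (forall a, exists b, P a b) -> exists f : A -> B, forall a, P a (f a).
Proof.
  intros H. exists (fun a => proj1_sig (constructive_indefinite_description _ (H a))).
  intro a. exact (proj2_sig (constructive_indefinite_description _ (H a))).
Qed.

(** Continuity is measured with [Cmod]; the balls of [C_UniformSpace] are squares and enter only
    where the filters of the statement are unfolded. *)
Definition ccont (f : C -> C) (z : C) : Prop :=
  forall eps, 0 < eps -> exists del, 0 < del /\
    forall h, Cmod (h - z) < del -> Cmod (f h - f z) < eps.

(* Caratheodory's form of complex differentiability: products, compositions and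
   inverse functions then only need the continuity of the slope [q]. *)
Definition cderiv (f : C -> C) (z d : C) : Prop :=
  exists (q : C -> C) (r : R), 0 < r /\ ccont q z /\ q z = d /\
    forall h, Cmod (h - z) < r -> f h = (f z + q h * (h - z))%C.

Lemma Cmod_sub_comm (z z' : C) : Cmod (z - z') = Cmod (z' - z).
Proof. rewrite <- Cmod_opp. f_equal. ring. Qed.

Lemma Cmod_triangle_rev (z z' : C) : Cmod z - Cmod z' <= Cmod (z - z').
Proof.
  assert (H := Cmod_triangle (z - z') z').
  replace (z - z' + z')%C with z in H by ring. lra.
Qed.

Lemma Cmod_self_sub (z : C) : Cmod (z - z) = 0.
Proof. replace (z - z)%C with (RtoC 0) by ring. apply Cmod_0. Qed.

Lemma Csub_neq_0 (z z' : C) : z <> z' -> (z - z')%C <> 0%C.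
Proof. intros N E. apply N. replace z with (z - z' + z')%C by ring. rewrite E. ring. Qed.

Lemma Cmod_le_components (x y : R) : Cmod (x, y) <= Rabs x + Rabs y.
Proof.
  replace (x, y) with (RtoC x + RtoC y * Ci)%C
    by (unfold RtoC, Ci, Cplus, Cmult; simpl; f_equal; ring).
  eapply Rle_trans; [apply Cmod_triangle|].
  rewrite Cmod_mult, Cmod_Ci, !Cmod_R. lra.
Qed.

Lemma Rabs_re_le_Cmod (z : C) : Rabs (fst z) <= Cmod z.
Proof. eapply Rle_trans; [apply Rmax_l|apply Rmax_Cmod]. Qed.

Lemma Rabs_im_le_Cmod (z : C) : Rabs (snd z) <= Cmod z.
Proof. eapply Rle_trans; [apply Rmax_r|apply Rmax_Cmod]. Qed.

Lemma ccont_const (c z : C) : ccont (fun _ => c) z.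
Proof. intros e He. exists 1. split; [lra|]. intros. now rewrite Cmod_self_sub. Qed.

Lemma ccont_id (z : C) : ccont (fun h => h) z.
Proof. intros e He. exists e. auto. Qed.

Lemma ccont_plus (f g : C -> C) (z : C) :
  ccont f z -> ccont g z -> ccont (fun h => f h + g h)%C z.
Proof.
  intros Hf Hg e He.
  destruct (Hf (e / 2)) as [d1 [? H1]]; [lra|].
  destruct (Hg (e / 2)) as [d2 [? H2]]; [lra|].
  exists (Rmin d1 d2). split; [apply Rmin_pos; auto|].
  intros h Hh.
  replace (f h + g h - (f z + g z))%C with ((f h - f z) + (g h - g z))%C by ring.
  eapply Rle_lt_trans; [apply Cmod_triangle|].
  assert (Cmod (f h - f z) < e / 2) by (apply H1; eapply Rlt_le_trans; [exact Hh|apply Rmin_l]).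
  assert (Cmod (g h - g z) < e / 2) by (apply H2; eapply Rlt_le_trans; [exact Hh|apply Rmin_r]).
  lra.
Qed.

Lemma ccont_comp (f g : C -> C) (z : C) :
  ccont g z -> ccont f (g z) -> ccont (fun h => f (g h)) z.
Proof.
  intros Hg Hf e He. destruct (Hf e He) as [d [Hd H1]].
  destruct (Hg d Hd) as [d' [Hd' H2]]. exists d'. auto.
Qed.

Lemma ccont_mult (f g : C -> C) (z : C) :
  ccont f z -> ccont g z -> ccont (fun h => f h * g h)%C z.
Proof.
  intros Hf Hg e He.
  set (A := Cmod (f z)). set (B := Cmod (g z)).
  assert (HA : 0 <= A) by apply Cmod_ge_0. assert (HB : 0 <= B) by apply Cmod_ge_0.
  set (m := Rmin 1 (e / (A + B + 1))).
  assert (Hm : 0 < m) by (apply Rmin_pos; [lra|apply Rdiv_lt_0_compat; lra]).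
  assert (Hm1 : m <= 1) by apply Rmin_l.
  assert (Hm2 : m * (A + B + 1) <= e).
  { apply Rle_trans with (e / (A + B + 1) * (A + B + 1)).
    - apply Rmult_le_compat_r; [lra|apply Rmin_r].
    - right. field. lra. }
  destruct (Hf m Hm) as [d1 [? H1]]. destruct (Hg m Hm) as [d2 [? H2]].
  exists (Rmin d1 d2). split; [apply Rmin_pos; auto|].
  intros h Hh.
  assert (a1 : Cmod (f h - f z) < m) by (apply H1; eapply Rlt_le_trans; [exact Hh|apply Rmin_l]).
  assert (a2 : Cmod (g h - g z) < m) by (apply H2; eapply Rlt_le_trans; [exact Hh|apply Rmin_r]).
  replace (f h * g h - f z * g z)%C
    with ((f h - f z) * (g h - g z) + (f z * (g h - g z) + g z * (f h - f z)))%C by ring.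
  eapply Rle_lt_trans; [apply Cmod_triangle|].
  eapply Rle_lt_trans; [apply Rplus_le_compat_l, Cmod_triangle|].
  rewrite !Cmod_mult. fold A B.
  pose proof (Cmod_ge_0 (f h - f z)). pose proof (Cmod_ge_0 (g h - g z)). nra.
Qed.

Lemma ccont_inv (f : C -> C) (z : C) :
  ccont f z -> f z <> 0%C -> ccont (fun h => / f h)%C z.
Proof.
  intros Hf Hz e He.
  set (A := Cmod (f z)). assert (HA : 0 < A) by (apply Cmod_gt_0; auto).
  set (m := Rmin (A / 2) (e * (A * A) / 2)).
  assert (Hm : 0 < m) by (apply Rmin_pos; [lra|assert (0 < A * A) by nra; nra]).
  destruct (Hf m Hm) as [d [Hd H1]]. exists d. split; auto. intros h Hh.
  specialize (H1 h Hh).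
  assert (m <= A / 2) by apply Rmin_l. assert (m <= e * (A * A) / 2) by apply Rmin_r.
  assert (HB : A / 2 < Cmod (f h)).
  { assert (T := Cmod_triangle_rev (f z) (f h)). rewrite Cmod_sub_comm in T. fold A in T. lra. }
  assert (Hh0 : f h <> 0%C) by (intro E; rewrite E, Cmod_0 in HB; lra).
  replace (/ f h - / f z)%C with ((f z - f h) * / (f h * f z))%C by (field; auto).
  rewrite Cmod_mult, Cmod_inv, Cmod_mult, Cmod_sub_comm by (apply Cmult_neq_0; auto).
  fold A. set (B := Cmod (f h)) in *.
  assert (0 < B * A) by nra.
  apply (Rmult_lt_reg_r (B * A)); auto.
  rewrite Rmult_assoc, Rinv_l, Rmult_1_r by lra.
  assert (e * (A * A) / 2 <= e * (B * A)) by nra. lra.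
Qed.

Lemma ccont_ext_loc (f g : C -> C) (z : C) (r : R) :
  0 < r -> (forall h, Cmod (h - z) < r -> f h = g h) -> ccont f z -> ccont g z.
Proof.
  intros Hr E Hf e He. destruct (Hf e He) as [d [Hd H1]].
  exists (Rmin d r). split; [apply Rmin_pos; auto|]. intros h Hh.
  rewrite <- !E.
  - apply H1. eapply Rlt_le_trans; [exact Hh|apply Rmin_l].
  - rewrite Cmod_self_sub; auto.
  - eapply Rlt_le_trans; [exact Hh|apply Rmin_r].
Qed.

Lemma ccont_neq_0 (f : C -> C) (z : C) :
  ccont f z -> f z <> 0%C -> exists r, 0 < r /\ forall h, Cmod (h - z) < r -> f h <> 0%C.
Proof.
  intros Hf Hz. apply Cmod_gt_0 in Hz. destruct (Hf _ Hz) as [r [Hr H]].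
  exists r. split; auto. intros h Hh E. specialize (H h Hh). rewrite E in H.
  replace (0 - f z)%C with (- f z)%C in H by ring. rewrite Cmod_opp in H. lra.
Qed.

Lemma ccont_pow (f : C -> C) (z : C) (n : nat) :
  ccont f z -> ccont (fun h => f h ^ n)%C z.
Proof.
  intros Hf. induction n; simpl.
  - apply ccont_const.
  - now apply ccont_mult.
Qed.

Lemma ccont_Cmod (f : C -> C) (z : C) :
  ccont f z -> forall eps, 0 < eps -> exists del, 0 < del /\
    forall h, Cmod (h - z) < del -> Rabs (Cmod (f h) - Cmod (f z)) < eps.
Proof.
  intros Hf e He. destruct (Hf e He) as [d [Hd H]]. exists d. split; auto.
  intros h Hh. specialize (H h Hh).
  assert (A := Cmod_triangle_rev (f h) (f z)).
  assert (B := Cmod_triangle_rev (f z) (f h)). rewrite Cmod_sub_comm in B.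
  apply Rabs_def1; lra.
Qed.

Lemma cderiv_ccont (f : C -> C) (z d : C) : cderiv f z d -> ccont f z.
Proof.
  intros (q & r & Hr & Hq & _ & E).
  apply (ccont_ext_loc (fun h => f z + q h * (h - z))%C f z r Hr).
  - intros h Hh. symmetry. auto.
  - apply ccont_plus; [apply ccont_const|]. apply ccont_mult; auto.
    apply ccont_plus; [apply ccont_id|apply ccont_const].
Qed.

Lemma cderiv_const (c z : C) : cderiv (fun _ => c) z 0.
Proof.
  exists (fun _ => RtoC 0), 1. repeat split; try lra; [apply ccont_const|]. intros; ring.
Qed.

Lemma cderiv_id (z : C) : cderiv (fun h => h) z 1.
Proof.
  exists (fun _ => RtoC 1), 1. repeat split; try lra; [apply ccont_const|]. intros; ring.
Qed.

Lemma cderiv_plus (f g : C -> C) (z d e : C) :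
  cderiv f z d -> cderiv g z e -> cderiv (fun h => f h + g h)%C z (d + e).
Proof.
  intros (q & r & Hr & Hq & <- & E) (q' & r' & Hr' & Hq' & <- & E').
  exists (fun h => q h + q' h)%C, (Rmin r r'). repeat split.
  - apply Rmin_pos; auto.
  - now apply ccont_plus.
  - intros h Hh. rewrite (E h), (E' h); [ring| |];
    eapply Rlt_le_trans; eauto; [apply Rmin_r|apply Rmin_l].
Qed.

Lemma cderiv_mult (f g : C -> C) (z d e : C) :
  cderiv f z d -> cderiv g z e ->
  cderiv (fun h => f h * g h)%C z (d * g z + f z * e).
Proof.
  intros Hf Hg. assert (Cg := cderiv_ccont _ _ _ Hg). revert Hf Hg.
  intros (q & r & Hr & Hq & <- & E) (q' & r' & Hr' & Hq' & <- & E').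
  exists (fun h => q h * g h + f z * q' h)%C, (Rmin r r'). repeat split.
  - apply Rmin_pos; auto.
  - apply ccont_plus; apply ccont_mult; auto. apply ccont_const.
  - intros h Hh. rewrite (E h), (E' h); [ring| |];
    eapply Rlt_le_trans; eauto; [apply Rmin_r|apply Rmin_l].
Qed.

Lemma cderiv_comp (f g : C -> C) (z d e : C) :
  cderiv g z e -> cderiv f (g z) d -> cderiv (fun h => f (g h)) z (d * e).
Proof.
  intros Hg. assert (Cg := cderiv_ccont _ _ _ Hg). revert Hg.
  intros (q' & r' & Hr' & Hq' & <- & E') (q & r & Hr & Hq & <- & E).
  destruct (Cg r Hr) as [r2 [Hr2 H2]].
  exists (fun h => q (g h) * q' h)%C, (Rmin r' r2). repeat split.
  - apply Rmin_pos; auto.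
  - apply ccont_mult; auto. now apply ccont_comp.
  - intros h Hh. assert (Cmod (h - z) < r') by (eapply Rlt_le_trans; [exact Hh|apply Rmin_l]).
    rewrite (E (g h)).
    + replace (g h - g z)%C with (q' h * (h - z))%C by (rewrite (E' h); auto; ring). ring.
    + apply H2. eapply Rlt_le_trans; [exact Hh|apply Rmin_r].
Qed.

Lemma cderiv_inv_id (z : C) : z <> 0%C -> cderiv (fun h => / h)%C z (- / (z * z))%C.
Proof.
  intros Hz. assert (HA : 0 < Cmod z) by (apply Cmod_gt_0; auto).
  exists (fun h => - / (h * z))%C, (Cmod z). repeat split; auto.
  - apply (ccont_ext_loc (fun h => (- (1)) * / (h * z))%C _ _ 1); [lra|intros; ring|].
    apply ccont_mult; [apply ccont_const|]. apply ccont_inv; [|now apply Cmult_neq_0].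
    apply ccont_mult; [apply ccont_id|apply ccont_const].
  - intros h Hh. assert (h <> 0%C).
    { intros ->. rewrite Cmod_sub_comm in Hh.
      replace (z - 0)%C with z in Hh by ring. lra. }
    field. auto.
Qed.

Lemma cderiv_inv (f : C -> C) (z d : C) :
  cderiv f z d -> f z <> 0%C -> cderiv (fun h => / f h)%C z (- / (f z * f z) * d)%C.
Proof. intros Hf Hz. apply (cderiv_comp (fun h => / h)%C f); auto. now apply cderiv_inv_id. Qed.

Lemma cderiv_pow (f : C -> C) (z d : C) (n : nat) :
  cderiv f z d -> exists e, cderiv (fun h => f h ^ n)%C z e.
Proof.
  intros Hf. induction n as [|n [e He]]; simpl.
  - exists (RtoC 0). apply cderiv_const.
  - eexists. apply cderiv_mult; eauto.
Qed.

Lemma cderiv_ext_loc (f g : C -> C) (z d : C) (r : R) :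
  0 < r -> (forall h, Cmod (h - z) < r -> f h = g h) -> cderiv f z d -> cderiv g z d.
Proof.
  intros Hr E (q & r' & Hr' & Hq & <- & E').
  exists q, (Rmin r r'). repeat split; auto; [apply Rmin_pos; auto|].
  intros h Hh. rewrite <- !E.
  - apply E'. eapply Rlt_le_trans; [exact Hh|apply Rmin_r].
  - rewrite Cmod_self_sub; auto.
  - eapply Rlt_le_trans; [exact Hh|apply Rmin_l].
Qed.

(** The slope of g o f is the slope of g at [f h] times that of f, so the latter is a quotient;
    continuity of f, assumed separately, makes the denominator continuous and nonzero near z. This
    differentiates the inverse of one conformal map composed with another. *)
Lemma cderiv_lift (g f : C -> C) (z d e : C) :
  d <> 0%C -> cderiv g (f z) d -> ccont f z -> cderiv (fun h => g (f h)) z e ->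
  exists l, cderiv f z l.
Proof.
  intros Nd (q & r & Hr & Hq & Eq & Fq) Cf (q' & r' & Hr' & Hq' & Eq' & Fq').
  assert (Nq : q (f z) <> 0%C) by now rewrite Eq.
  assert (Cq : ccont (fun h => q (f h)) z) by now apply ccont_comp.
  destruct (ccont_neq_0 _ _ Cq Nq) as [r1 [Hr1 N1]].
  destruct (Cf r Hr) as [r2 [Hr2 N2]].
  eexists. exists (fun h => q' h * / q (f h))%C, (Rmin r' (Rmin r1 r2)).
  split; [repeat apply Rmin_pos; auto|]. split.
  { apply ccont_mult; auto. now apply (ccont_inv (fun h => q (f h))). }
  split; [reflexivity|]. intros h Hh.
  assert (L1 := Rmin_l r' (Rmin r1 r2)). assert (L2 := Rmin_r r' (Rmin r1 r2)).
  assert (L3 := Rmin_l r1 r2). assert (L4 := Rmin_r r1 r2).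
  assert (E1 := Fq (f h) (N2 h ltac:(lra))). assert (E2 := Fq' h ltac:(lra)).
  cbv beta in E2. rewrite E1 in E2. specialize (N1 h ltac:(lra)).
  assert (E3 : (q (f h) * (f h - f z) = q' h * (h - z))%C).
  { transitivity (g (f z) + q (f h) * (f h - f z) - g (f z))%C; [ring|]. rewrite E2. ring. }
  transitivity (f z + (q (f h) * (f h - f z)) * / q (f h))%C; [field; auto|].
  rewrite E3. field. auto.
Qed.

Lemma cderiv_eps (f : C -> C) (z d : C) :
  cderiv f z d <->
  forall eps, 0 < eps -> exists del, 0 < del /\ forall h, Cmod (h - z) < del ->
    Cmod (f h - f z - d * (h - z)) <= eps * Cmod (h - z).
Proof.
  split.
  - intros (q & r & Hr & Hq & <- & E) e He. destruct (Hq e He) as [d [Hd H]].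
    exists (Rmin d r). split; [apply Rmin_pos; auto|]. intros h Hh.
    rewrite (E h) by (eapply Rlt_le_trans; [exact Hh|apply Rmin_r]).
    replace (f z + q h * (h - z) - f z - q z * (h - z))%C with ((q h - q z) * (h - z))%C by ring.
    rewrite Cmod_mult. apply Rmult_le_compat_r; [apply Cmod_ge_0|]. left. apply H.
    eapply Rlt_le_trans; [exact Hh|apply Rmin_l].
  - intros H.
    exists (fun h => if excluded_middle_informative (h = z) then d else ((f h - f z) / (h - z))%C), 1.
    split; [lra|]. split.
    + intros e He. destruct (H (e / 2)) as [del [Hd H1]]; [lra|].
      exists del. split; auto. intros h Hh.
      destruct (excluded_middle_informative (z = z)) as [_|n]; [|now elim n].
      destruct (excluded_middle_informative (h = z)) as [->|n].
      * rewrite Cmod_self_sub. lra.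
      * assert (N : (h - z)%C <> 0%C).
        { intro E. apply n. replace h with (h - z + z)%C by ring. rewrite E. ring. }
        assert (0 < Cmod (h - z)) by (apply Cmod_gt_0; auto).
        replace ((f h - f z) / (h - z) - d)%C
          with ((f h - f z - d * (h - z)) / (h - z))%C by (field; auto).
        rewrite Cmod_div by auto. apply Rle_lt_trans with (e / 2); [|lra].
        apply Rle_div_l; auto.
    + split.
      * destruct (excluded_middle_informative (z = z)) as [_|n]; [auto|now elim n].
      * intros h _. destruct (excluded_middle_informative (h = z)) as [->|n].
        -- ring.
        -- field. intro E. apply n. replace h with (h - z + z)%C by ring. rewrite E. ring.
Qed.

Lemma is_derive_cderiv (f : C -> C) (z : C) :
  ex_derive (K := C_AbsRing) (V := C_NormedModule) f z -> exists d, cderiv f z d.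
Proof.
  intros [d [_ Hd]]. exists d. apply cderiv_eps. intros e He.
  specialize (Hd z (fun P H => H) (mkposreal e He)). simpl in Hd.
  destruct Hd as [r Hr].
  exists r. split; [apply cond_pos|]. intros h Hh.
  assert (B : ball (M := AbsRing_UniformSpace C_AbsRing) z r h) by exact Hh.
  specialize (Hr h B). simpl in Hr.
  change (Cmod (f h - f z - (h - z) * d) <= e * Cmod (h - z)) in Hr.
  now rewrite (Cmult_comm d).
Qed.

Lemma cderiv_cauchy_riemann (u v : R -> R -> R) (x y a b : R) :
  differentiable_pt_lim u x y a (- b) -> differentiable_pt_lim v x y b a ->
  cderiv (fun z => (u (fst z) (snd z), v (fst z) (snd z))) (x, y) (a, b).
Proof.
  intros Hu Hv. apply cderiv_eps. intros e He.
  assert (He2 : 0 < e / 2) by lra.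
  destruct (Hu (mkposreal _ He2)) as [d1 H1]. destruct (Hv (mkposreal _ He2)) as [d2 H2].
  exists (Rmin d1 d2). split; [apply Rmin_pos; apply cond_pos|].
  intros [p q] Hh.
  assert (R1 : Rabs (p - x) <= Cmod ((p, q) - (x, y))) by apply (Rabs_re_le_Cmod ((p, q) - (x, y))).
  assert (R2 : Rabs (q - y) <= Cmod ((p, q) - (x, y))) by apply (Rabs_im_le_Cmod ((p, q) - (x, y))).
  assert (Cmod ((p, q) - (x, y)) < d1) by (eapply Rlt_le_trans; [exact Hh|apply Rmin_l]).
  assert (Cmod ((p, q) - (x, y)) < d2) by (eapply Rlt_le_trans; [exact Hh|apply Rmin_r]).
  specialize (H1 p q ltac:(lra) ltac:(lra)). specialize (H2 p q ltac:(lra) ltac:(lra)).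
  simpl in H1, H2. simpl fst. simpl snd.
  set (m := Cmod ((p, q) - (x, y))) in *.
  assert (M : Rmax (Rabs (p - x)) (Rabs (q - y)) <= m) by (apply Rmax_lub; auto).
  match goal with |- Cmod ?X <= _ => replace X with
    (u p q - u x y - (a * (p - x) + - b * (q - y)), v p q - v x y - (b * (p - x) + a * (q - y))) end.
  2:{ unfold Cminus, Cplus, Copp, Cmult; simpl; f_equal; ring. }
  eapply Rle_trans; [apply Cmod_le_components|]. nra.
Qed.

(** The free factor k lets one statement serve several real functionals: k = 1 and k = - i give the
    real and imaginary parts, k = - i conj h the function [secant], and k = conj (q z) the
    first-order change of |q|. *)
Lemma cderiv_line (f : C -> C) (p h k d : C) (s : R) :
  cderiv f (p + RtoC s * h)%C d ->
  derivable_pt_lim (fun t => fst (k * f (p + RtoC t * h))%C) s (fst (k * d * h)%C).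
Proof.
  intros Hf.
  rewrite cderiv_eps in Hf. intros e He.
  set (A := Cmod k * (Cmod h * (Cmod h + 1)) + 1).
  assert (Hk := Cmod_ge_0 k). assert (Hh := Cmod_ge_0 h).
  assert (HA : 0 < A) by (unfold A; nra).
  destruct (Hf (e / (2 * (Cmod k * Cmod h + 1)))) as [r [Hr H]].
  { apply Rdiv_lt_0_compat; nra. }
  assert (Hr' : 0 < r / (Cmod h + 1)) by (apply Rdiv_lt_0_compat; lra).
  exists (mkposreal _ Hr'). intros t Ht0 Ht. simpl in Ht.
  assert (E : (p + RtoC (s + t) * h - (p + RtoC s * h) = RtoC t * h)%C).
  { rewrite RtoC_plus. ring. }
  specialize (H (p + RtoC (s + t) * h)%C). rewrite E in H.
  rewrite Cmod_mult, Cmod_R in H.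
  assert (T : Rabs t * Cmod h < r).
  { apply Rle_lt_trans with (Rabs t * (Cmod h + 1)).
    - apply Rmult_le_compat_l; [apply Rabs_pos|lra].
    - apply Rlt_div_r in Ht; lra. }
  specialize (H T).
  set (F := (f (p + RtoC (s + t) * h) - f (p + RtoC s * h) - d * (RtoC t * h))%C) in *.
  replace ((fst (k * f (p + RtoC (s + t) * h)%C)%C - fst (k * f (p + RtoC s * h)%C)%C) / t
    - fst (k * d * h)%C) with (fst (k * F)%C / t).
  2:{ unfold F. destruct (f (p + RtoC (s + t) * h)%C), (f (p + RtoC s * h)%C), k, d, h. simpl. field. auto. }
  unfold Rdiv. rewrite Rabs_mult, Rabs_inv. assert (0 < Rabs t) by now apply Rabs_pos_lt.
  apply Rlt_div_l; [lra|].
  eapply Rle_lt_trans; [apply Rabs_re_le_Cmod|]. rewrite Cmod_mult.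
  apply Rle_lt_trans with (Cmod k * (e / (2 * (Cmod k * Cmod h + 1)) * (Rabs t * Cmod h))).
  - apply Rmult_le_compat_l; auto.
  - replace (Cmod k * (e / (2 * (Cmod k * Cmod h + 1)) * (Rabs t * Cmod h)))
      with (e * Rabs t * ((Cmod k * Cmod h) / (2 * (Cmod k * Cmod h + 1)))) by (field; nra).
    assert ((Cmod k * Cmod h) / (2 * (Cmod k * Cmod h + 1)) < 1).
    { apply Rlt_div_l; nra. }
    assert (0 < e * Rabs t) by nra. nra.
Qed.

(** * Goursat's theorem and the maximum principle *)

Lemma bisection_limit (x : nat -> R) (h : R) :
  0 <= h -> (forall n, x n <= x (S n) <= x n + h / 2 ^ S n) ->
  exists X, forall n, x n <= X <= x n + h / 2 ^ n.
Proof.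
  intros Hh Hx.
  assert (P2 : forall n, 0 < 2 ^ n) by (intros; apply pow_lt; lra).
  assert (Hdec : forall n m, (n <= m)%nat -> x n <= x m /\ x m + h / 2 ^ m <= x n + h / 2 ^ n).
  { intros n m L. induction L as [|m L [I1 I2]]; [lra|].
    destruct (Hx m) as [H1 H2].
    assert (h / 2 ^ m = h / 2 ^ S m + h / 2 ^ S m).
    { simpl. field. specialize (P2 m); lra. }
    lra. }
  assert (P3 : forall n, 0 <= h / 2 ^ n) by (intros; apply Rdiv_le_0_compat; auto).
  destruct (completeness (fun r => exists n, r = x n)) as [X [HX1 HX2]].
  - exists (x 0%nat + h / 2 ^ 0). intros r [n ->].
    destruct (Hdec 0%nat n) as [_ H]; [lia|]. specialize (P3 n). lra.
  - exists (x 0%nat). now exists 0%nat.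
  - exists X. intros n. split.
    + apply HX1. now exists n.
    + apply HX2. intros r [m ->].
      destruct (Nat.le_ge_cases n m) as [L|L].
      * destruct (Hdec n m L). specialize (P3 m). lra.
      * destruct (Hdec m n L). specialize (P3 n). lra.
Qed.

(** A covering principle by bisection. If the property failed on the whole rectangle, it would fail
    on some quarter at every stage, and the nested quarters shrink to a point (X, Y) around which it
    holds on all small rectangles. *)
Lemma rectangle_subdivision (P : R -> R -> R -> R -> Prop) (a c h k : R) :
  0 <= h -> 0 <= k ->
  (forall x y h k, 0 <= h -> 0 <= k ->
     P x y (h / 2) (k / 2) -> P (x + h / 2) y (h / 2) (k / 2) ->
     P x (y + k / 2) (h / 2) (k / 2) -> P (x + h / 2) (y + k / 2) (h / 2) (k / 2) ->
     P x y h k) ->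
  (forall X Y, a <= X <= a + h -> c <= Y <= c + k ->
     exists del, 0 < del /\ forall x y h' k', 0 <= h' < del -> 0 <= k' < del ->
       x <= X <= x + h' -> y <= Y <= y + k' -> P x y h' k') ->
  P a c h k.
Proof.
  intros Hh Hk Hsub Hloc. apply NNPP. intro Hn.
  (* [next] takes the first quarter on which P fails; when the other three satisfy P, the last one
     must fail by [Hsub]. *)
  set (next := fun (n : nat) (p : R * R) =>
    let h' := h / 2 ^ S n in let k' := k / 2 ^ S n in let (x, y) := p in
    if excluded_middle_informative (P x y h' k')
    then if excluded_middle_informative (P (x + h') y h' k')
    then if excluded_middle_informative (P x (y + k') h' k')
    then (x + h', y + k') else (x, y + k') else (x + h', y) else (x, y)).
  set (s := fix s n := match n with O => (a, c) | S n => next n (s n) end).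
  assert (P2 : forall n, 0 < 2 ^ n) by (intros; apply pow_lt; lra).
  assert (Ph : forall n, 0 <= h / 2 ^ n) by (intros; apply Rdiv_le_0_compat; auto).
  assert (Pk : forall n, 0 <= k / 2 ^ n) by (intros; apply Rdiv_le_0_compat; auto).
  assert (Hs : forall n, ~ P (fst (s n)) (snd (s n)) (h / 2 ^ n) (k / 2 ^ n)).
  { induction n as [|n IH].
    - simpl. unfold Rdiv. now rewrite Rinv_1, !Rmult_1_r.
    - simpl s. destruct (s n) as [x y]. simpl in IH. unfold next.
      assert (Eh : h / 2 ^ S n = h / 2 ^ n / 2) by (simpl; field; specialize (P2 n); lra).
      assert (Ek : k / 2 ^ S n = k / 2 ^ n / 2) by (simpl; field; specialize (P2 n); lra).
      assert (D := Hsub x y (h / 2 ^ n) (k / 2 ^ n) (Ph n) (Pk n)).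
      rewrite <- Eh, <- Ek in D.
      repeat (destruct excluded_middle_informative); simpl fst; simpl snd; auto. }
  assert (Hx : forall n, fst (s n) <= fst (s (S n)) <= fst (s n) + h / 2 ^ S n).
  { intro n. change (s (S n)) with (next n (s n)). destruct (s n) as [x y].
    specialize (Ph (S n)). unfold next.
    set (hn := h / 2 ^ S n) in *. set (kn := k / 2 ^ S n) in *.
    repeat (destruct excluded_middle_informative); simpl fst; lra. }
  assert (Hy : forall n, snd (s n) <= snd (s (S n)) <= snd (s n) + k / 2 ^ S n).
  { intro n. change (s (S n)) with (next n (s n)). destruct (s n) as [x y].
    specialize (Pk (S n)). unfold next.
    set (hn := h / 2 ^ S n) in *. set (kn := k / 2 ^ S n) in *.
    repeat (destruct excluded_middle_informative); simpl snd; lra. }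
  destruct (bisection_limit (fun n => fst (s n)) h Hh Hx) as [X HX].
  destruct (bisection_limit (fun n => snd (s n)) k Hk Hy) as [Y HY].
  destruct (Hloc X Y) as [del [Hdel HP]].
  { specialize (HX 0%nat). simpl in HX. lra. }
  { specialize (HY 0%nat). simpl in HY. lra. }
  assert (Hsmall : exists n, h / 2 ^ n < del /\ k / 2 ^ n < del).
  { destruct (pow_lt_1_zero (/ 2) ltac:(rewrite Rabs_pos_eq; lra) (del / (h + k + 1))) as [N HN].
    { apply Rdiv_lt_0_compat; lra. }
    exists N. specialize (HN N (le_n N)).
    rewrite pow_inv, Rabs_pos_eq in HN by (left; apply Rinv_0_lt_compat; auto).
    apply Rlt_div_r in HN; [|lra].
    assert (0 < / 2 ^ N) by (apply Rinv_0_lt_compat; auto).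
    unfold Rdiv. split; nra. }
  destruct Hsmall as [n [S1 S2]].
  apply (Hs n), HP; auto.
Qed.

(* The imaginary part of the integral of [f] along the boundary of
   [a, b] x [c, d]; the real part is that of [- i f]. *)
Definition im_contour (f : C -> C) (a b c d : R) : R :=
  RInt (fun x => snd (f (x, c))) a b - RInt (fun x => snd (f (x, d))) a b
  + (RInt (fun y => fst (f (b, y))) c d - RInt (fun y => fst (f (a, y))) c d).

Lemma ccont_horizontal (f : C -> C) (x y : R) :
  ccont f (x, y) ->
  continuous (fun t => fst (f (t, y))) x /\ continuous (fun t => snd (f (t, y))) x.
Proof.
  intros Hf. split; apply continuity_pt_filterlim; intros e He;
    destruct (Hf e He) as [d [Hd H]]; exists d; split; auto;
    intros t [_ Ht]; simpl; unfold Rdist;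
    (eapply Rle_lt_trans; [|apply (H (t, y))]).
  - apply (Rabs_re_le_Cmod (f (t, y) - f (x, y))).
  - replace ((t, y) - (x, y))%C with (RtoC (t - x)).
    + rewrite Cmod_R. exact Ht.
    + unfold Cminus, Cplus, Copp, RtoC; simpl; f_equal; ring.
  - apply (Rabs_im_le_Cmod (f (t, y) - f (x, y))).
  - replace ((t, y) - (x, y))%C with (RtoC (t - x)).
    + rewrite Cmod_R. exact Ht.
    + unfold Cminus, Cplus, Copp, RtoC; simpl; f_equal; ring.
Qed.

Lemma ccont_vertical (f : C -> C) (x y : R) :
  ccont f (x, y) ->
  continuous (fun t => fst (f (x, t))) y /\ continuous (fun t => snd (f (x, t))) y.
Proof.
  intros Hf.
  assert (E : forall t, Cmod ((x, t) - (x, y)) = Rabs (t - y)).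
  { intro t. replace ((x, t) - (x, y))%C with (RtoC (t - y) * Ci)%C.
    + now rewrite Cmod_mult, Cmod_Ci, Cmod_R, Rmult_1_r.
    + unfold Cminus, Cplus, Copp, RtoC, Cmult, Ci; simpl; f_equal; ring. }
  split; apply continuity_pt_filterlim; intros e He;
    destruct (Hf e He) as [d [Hd H]]; exists d; split; auto;
    intros t [_ Ht]; simpl; unfold Rdist;
    (eapply Rle_lt_trans; [|apply (H (x, t)); rewrite E; exact Ht]).
  - apply (Rabs_re_le_Cmod (f (x, t) - f (x, y))).
  - apply (Rabs_im_le_Cmod (f (x, t) - f (x, y))).
Qed.

Section Goursat.

Variables (f : C -> C) (a b c d : R).
Hypothesis Hab : a <= b.
Hypothesis Hcd : c <= d.
Hypothesis Hf : forall x y, a <= x <= b -> c <= y <= d -> exists e, cderiv f (x, y) e.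

Lemma contour_ex_RInt_horizontal (x x' y : R) :
  a <= x -> x <= x' -> x' <= b -> c <= y <= d ->
  ex_RInt (fun t => snd (f (t, y))) x x'.
Proof.
  intros. apply (ex_RInt_continuous (V := R_CompleteNormedModule)). intros t Ht.
  rewrite Rmin_left, Rmax_right in Ht by auto.
  destruct (Hf t y) as [e He]; [lra|auto|].
  apply cderiv_ccont in He. now apply ccont_horizontal.
Qed.

Lemma contour_ex_RInt_vertical (x y y' : R) :
  c <= y -> y <= y' -> y' <= d -> a <= x <= b ->
  ex_RInt (fun t => fst (f (x, t))) y y'.
Proof.
  intros. apply (ex_RInt_continuous (V := R_CompleteNormedModule)). intros t Ht.
  rewrite Rmin_left, Rmax_right in Ht by auto.
  destruct (Hf x t) as [e He]; [auto|lra|].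
  apply cderiv_ccont in He. now apply ccont_vertical.
Qed.

(** Integrates the information that g - g' is close to a constant m. For opposite sides of a
    rectangle, m is the increment of the affine part of f; for the mean value property, g' = 0 and m
    = Re f (z0). *)
Lemma RInt_minus_near (g g' : R -> R) (p q m e : R) :
  p <= q -> ex_RInt g p q -> ex_RInt g' p q ->
  (forall t, p <= t <= q -> Rabs (g t - g' t - m) <= e) ->
  Rabs (RInt g p q - RInt g' p q - m * (q - p)) <= e * (q - p).
Proof.
  intros Hpq Hg Hg' H.
  assert (E : RInt (fun t => minus (g t) (g' t)) p q = RInt g p q - RInt g' p q).
  { apply (RInt_minus (V := R_CompleteNormedModule)); auto. }
  assert (X : ex_RInt (fun t => minus (g t) (g' t)) p q)
    by (apply (ex_RInt_minus (V := R_NormedModule)); auto).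
  rewrite <- E.
  assert (C1 : RInt (fun t => minus (g t) (g' t)) p q <= RInt (fun _ => m + e) p q).
  { apply RInt_le; auto. apply (ex_RInt_const (V := R_NormedModule)).
    intros t Ht. specialize (H t ltac:(lra)). apply Rabs_le_between in H.
    change (g t - g' t <= m + e). lra. }
  assert (C2 : RInt (fun _ => m - e) p q <= RInt (fun t => minus (g t) (g' t)) p q).
  { apply RInt_le; auto. apply (ex_RInt_const (V := R_NormedModule)).
    intros t Ht. specialize (H t ltac:(lra)). apply Rabs_le_between in H.
    change (m - e <= g t - g' t). lra. }
  rewrite RInt_const in C1, C2.
  change ((q - p) * (m - e) <= RInt (fun t => minus (g t) (g' t)) p q) in C2.
  change (RInt (fun t => minus (g t) (g' t)) p q <= (q - p) * (m + e)) in C1.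
  apply Rabs_le. split; lra.
Qed.

Lemma goursat : im_contour f a b c d = 0.
Proof.
  apply NNPP. intro Hne.
  set (h := b - a). set (k := d - c).
  assert (Hpos : 0 < Rabs (im_contour f a b c d)) by now apply Rabs_pos_lt.
  (* With this eta the bound eta (h + k)^2 is less than half of the supposedly nonzero contour
     integral; the added 1 keeps the quotient meaningful on degenerate rectangles. *)
  set (eta := Rabs (im_contour f a b c d) / (2 * ((h + k) * (h + k) + 1))).
  assert (Hden : 0 < (h + k) * (h + k) + 1) by (assert (Hsq := Rle_0_sqr (h + k)); unfold Rsqr in Hsq; lra).
  assert (Heta : 0 < eta) by (apply Rdiv_lt_0_compat; lra).
  set (inside := fun x y h k => a <= x /\ x + h <= b /\ c <= y /\ y + k <= d).
  assert (HP : inside a c h k ->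
    Rabs (im_contour f a (a + h) c (c + k)) <= eta * ((h + k) * (h + k))).
  { apply (rectangle_subdivision (fun x y h k => inside x y h k ->
      Rabs (im_contour f x (x + h) y (y + k)) <= eta * ((h + k) * (h + k))));
      [unfold h; lra|unfold k; lra| |].
    - intros x y h' k' Hh' Hk' H1 H2 H3 H4 (I1 & I2 & I3 & I4).
      specialize (H1 ltac:(unfold inside; lra)). specialize (H2 ltac:(unfold inside; lra)).
      specialize (H3 ltac:(unfold inside; lra)). specialize (H4 ltac:(unfold inside; lra)).
      replace (x + h' / 2 + h' / 2) with (x + h') in H2, H4 by field.
      replace (y + k' / 2 + k' / 2) with (y + k') in H3, H4 by field.
      assert (CH : forall t, c <= t <= d ->
        RInt (fun x => snd (f (x, t))) x (x + h') =
        RInt (fun x => snd (f (x, t))) x (x + h' / 2)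
        + RInt (fun x => snd (f (x, t))) (x + h' / 2) (x + h')).
      { intros t Ht. symmetry. apply (RInt_Chasles (V := R_CompleteNormedModule));
        apply contour_ex_RInt_horizontal; auto; lra. }
      assert (CV : forall t, a <= t <= b ->
        RInt (fun y => fst (f (t, y))) y (y + k') =
        RInt (fun y => fst (f (t, y))) y (y + k' / 2)
        + RInt (fun y => fst (f (t, y))) (y + k' / 2) (y + k')).
      { intros t Ht. symmetry. apply (RInt_Chasles (V := R_CompleteNormedModule));
        apply contour_ex_RInt_vertical; auto; lra. }
      assert (E : im_contour f x (x + h') y (y + k') =
        im_contour f x (x + h' / 2) y (y + k' / 2)
        + im_contour f (x + h' / 2) (x + h') y (y + k' / 2)
        + (im_contour f x (x + h' / 2) (y + k' / 2) (y + k')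
        + im_contour f (x + h' / 2) (x + h') (y + k' / 2) (y + k'))).
      { unfold im_contour. rewrite !CH, !CV by lra. ring. }
      rewrite E.
      eapply Rle_trans; [apply Rabs_triang|].
      eapply Rle_trans; [apply Rplus_le_compat; apply Rabs_triang|].
      replace (eta * ((h' + k') * (h' + k')))
        with (4 * (eta * ((h' / 2 + k' / 2) * (h' / 2 + k' / 2)))) by field.
      lra.
    - intros X Y HX HY.
      destruct (Hf X Y) as [e He]; [unfold h in HX; lra|unfold k in HY; lra|].
      rewrite cderiv_eps in He. destruct (He (eta / 2)) as [del [Hdel He']]; [lra|].
      exists (del / 2). split; [lra|]. intros x y h' k' Hh' Hk' HxX HyY (I1 & I2 & I3 & I4).
      (* The error of the affine approximation at (X, Y). The affine part contributes - h' k' Re e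
         on the horizontal sides and h' k' Re e on the vertical ones, so only r is left to
         estimate. *)
      set (r := fun p q => (f (p, q) - f (X, Y) - e * ((p, q) - (X, Y)))%C).
      assert (Hr : forall p q, x <= p <= x + h' -> y <= q <= y + k' ->
        Cmod (r p q) <= eta / 2 * (h' + k')).
      { intros p q Hp Hq.
        assert (Cmod ((p, q) - (X, Y)) <= h' + k').
        { change ((p, q) - (X, Y))%C with (p - X, q - Y).
          eapply Rle_trans; [apply Cmod_le_components|].
          apply Rplus_le_compat; apply Rabs_le; lra. }
        unfold r. eapply Rle_trans; [apply He'; lra|].
        apply Rmult_le_compat_l; lra. }
      assert (B1 : Rabs (RInt (fun t => snd (f (t, y))) x (x + h')
        - RInt (fun t => snd (f (t, y + k'))) x (x + h') - (- k' * fst e) * (x + h' - x))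
        <= eta * (h' + k') * (x + h' - x)).
      { apply RInt_minus_near; [lra|apply contour_ex_RInt_horizontal; lra
          |apply contour_ex_RInt_horizontal; lra|].
        intros t Ht.
        replace (snd (f (t, y)) - snd (f (t, y + k')) - - k' * fst e)
          with (snd (r t y - r t (y + k')%R)%C).
        2:{ unfold r. destruct (f (t, y)), (f (t, y + k')), (f (X, Y)), e. simpl. ring. }
        eapply Rle_trans; [apply Rabs_im_le_Cmod|].
        unfold Cminus. eapply Rle_trans; [apply Cmod_triangle|]. rewrite Cmod_opp.
        assert (A1 := Hr t y ltac:(lra) ltac:(lra)).
        assert (A2 := Hr t (y + k') ltac:(lra) ltac:(lra)). lra. }
      assert (B2 : Rabs (RInt (fun t => fst (f (x + h', t))) y (y + k')
        - RInt (fun t => fst (f (x, t))) y (y + k') - (h' * fst e) * (y + k' - y))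
        <= eta * (h' + k') * (y + k' - y)).
      { apply RInt_minus_near; [lra|apply contour_ex_RInt_vertical; lra
          |apply contour_ex_RInt_vertical; lra|].
        intros t Ht.
        replace (fst (f (x + h', t)) - fst (f (x, t)) - h' * fst e)
          with (fst (r (x + h')%R t - r x t)%C).
        2:{ unfold r. destruct (f (x + h', t)), (f (x, t)), (f (X, Y)), e. simpl. ring. }
        eapply Rle_trans; [apply Rabs_re_le_Cmod|].
        unfold Cminus. eapply Rle_trans; [apply Cmod_triangle|]. rewrite Cmod_opp.
        assert (A1 := Hr (x + h') t ltac:(lra) ltac:(lra)).
        assert (A2 := Hr x t ltac:(lra) ltac:(lra)). lra. }
      unfold im_contour.
      apply Rabs_le_between in B1. apply Rabs_le_between in B2. apply Rabs_le. lra. }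
  assert (Hin : inside a c h k) by (unfold inside, h, k; lra).
  specialize (HP Hin).
  replace (a + h) with b in HP by (unfold h; ring).
  replace (c + k) with d in HP by (unfold k; ring).
  unfold eta in HP.
  apply (Rmult_le_compat_r (2 * ((h + k) * (h + k) + 1))) in HP; [|lra].
  replace (Rabs (im_contour f a b c d) / (2 * ((h + k) * (h + k) + 1)) * ((h + k) * (h + k)) *
     (2 * ((h + k) * (h + k) + 1)))
    with (Rabs (im_contour f a b c d) * ((h + k) * (h + k))) in HP by (field; lra).
  nra.
Qed.

End Goursat.

Lemma differentiable_pt_lim_of_partials (f fx : R -> R -> R) (x y fy r : R) :
  0 < r ->
  (forall p q, Rabs (p - x) < r -> Rabs (q - y) < r ->
     is_derive (fun t => f t q) p (fx p q)) ->
  is_derive (fun t => f x t) y fy ->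
  continuous (fun u : R * R => fx (fst u) (snd u)) (x, y) ->
  differentiable_pt_lim f x y (fx x y) fy.
Proof.
  intros Hr Hx Hy Hc. apply filterdiff_differentiable_pt_lim.
  apply (is_derive_filterdiff f x y fx fy); auto.
  exists (mkposreal r Hr). intros [p q] [B1 B2]. apply Hx; [exact B1|exact B2].
Qed.

(** * The exponential map and the mean value property *)

Definition cexp (z : C) : C := (exp (fst z) * cos (snd z), exp (fst z) * sin (snd z)).

Lemma Cmod_cis (r t : R) : 0 <= r -> Cmod (r * cos t, r * sin t) = r.
Proof.
  intros Hr. unfold Cmod. cbn [fst snd].
  replace ((r * cos t) ^ 2 + (r * sin t) ^ 2) with (Rsqr r).
  - now apply sqrt_Rsqr.
  - assert (H := sin2_cos2 t). unfold Rsqr in *. simpl. nra.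
Qed.

Lemma Cmod_cexp (z : C) : Cmod (cexp z) = exp (fst z).
Proof. apply Cmod_cis. left; apply exp_pos. Qed.

Lemma cderiv_cexp (z : C) : cderiv cexp z (cexp z).
Proof.
  destruct z as [x y].
  apply (cderiv_cauchy_riemann (fun x y => exp x * cos y) (fun x y => exp x * sin y)); simpl.
  - apply (differentiable_pt_lim_of_partials _ (fun x y => exp x * cos y) x y _ 1); [lra| | |].
    + intros. auto_derive; auto. ring.
    + auto_derive; auto. ring.
    + apply (continuous_mult (fun u : R * R => exp (fst u)) (fun u : R * R => cos (snd u))).
      * apply continuous_comp; [apply continuous_fst|apply continuous_exp].
      * apply continuous_comp; [apply continuous_snd|apply continuous_cos].
  - apply (differentiable_pt_lim_of_partials _ (fun x y => exp x * sin y) x y _ 1); [lra| | |].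
    + intros. auto_derive; auto. ring.
    + auto_derive; auto. ring.
    + apply (continuous_mult (fun u : R * R => exp (fst u)) (fun u : R * R => sin (snd u))).
      * apply continuous_comp; [apply continuous_fst|apply continuous_exp].
      * apply continuous_comp; [apply continuous_snd|apply continuous_sin].
Qed.

Definition circle (z0 : C) (r t : R) : C := (z0 + ((r * cos t)%R, (r * sin t)%R))%C.

(* Goursat's theorem for [f (z0 + exp zeta)] on [s, ln r] x [0, 2 PI], letting s -> - oo:
   by periodicity the horizontal sides cancel. *)
Lemma mean_value_re (f : C -> C) (z0 : C) (r : R) :
  0 < r -> (forall z, Cmod (z - z0) <= r -> exists d, cderiv f z d) ->
  is_RInt (fun t => fst (f (circle z0 r t))) 0 (2 * PI) (2 * PI * fst (f z0)).
Proof.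
  intros Hr Hf.
  assert (HPI := PI_RGT_0).
  set (F := fun zeta => f (z0 + cexp zeta)%C).
  assert (HF : forall x y, x <= ln r -> exists d, cderiv F (x, y) d).
  { intros x y Hx.
    destruct (Hf (z0 + cexp (x, y))%C) as [d Hd].
    - replace (z0 + cexp (x, y) - z0)%C with (cexp (x, y)) by ring.
      rewrite Cmod_cexp. simpl. rewrite <- (exp_ln r) by auto.
      destruct Hx as [Hx| ->]; [left; now apply exp_increasing|lra].
    - exists (d * (0 + cexp (x, y)))%C. apply (cderiv_comp f (fun zeta => z0 + cexp zeta)%C); auto.
      apply cderiv_plus; [apply cderiv_const|apply cderiv_cexp]. }
  assert (HR : forall x, x <= ln r -> ex_RInt (fun t => fst (F (x, t))) 0 (2 * PI)).
  { intros x Hx. apply (ex_RInt_continuous (V := R_CompleteNormedModule)). intros t _.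
    destruct (HF x t Hx) as [d Hd]. apply cderiv_ccont in Hd. now apply ccont_vertical. }
  set (I := fun x => RInt (fun t => fst (F (x, t))) 0 (2 * PI)).
  assert (Hconst : forall s, s < ln r -> I s = I (ln r)).
  { intros s Hs.
    assert (G := goursat F s (ln r) 0 (2 * PI) ltac:(lra) ltac:(lra)
      ltac:(intros; apply HF; lra)).
    unfold im_contour in G.
    assert (E : RInt (fun x => snd (F (x, 0))) s (ln r)
      = RInt (fun x => snd (F (x, 2 * PI))) s (ln r)).
    { apply (RInt_ext (V := R_CompleteNormedModule)). intros x _.
      unfold F, cexp. simpl. now rewrite cos_2PI, sin_2PI, cos_0, sin_0. }
    unfold I. lra. }
  assert (Hlim : forall eps, 0 < eps -> Rabs (I (ln r) - 2 * PI * fst (f z0)) <= eps * (2 * PI)).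
  { intros eps Heps.
    destruct (Hf z0) as [d Hd]; [rewrite Cmod_self_sub; lra|].
    apply cderiv_ccont in Hd. destruct (Hd eps Heps) as [del [Hdel H]].
    set (s := Rmin (ln r - 1) (ln (del / 2))).
    assert (Hs : s <= ln r - 1) by apply Rmin_l.
    assert (Hs2 : exp s <= del / 2).
    { rewrite <- (exp_ln (del / 2)) by lra.
      assert (L : s <= ln (del / 2)) by apply Rmin_r.
      destruct L as [L| ->]; [left; now apply exp_increasing|lra]. }
    rewrite <- (Hconst s) by lra.
    replace (eps * (2 * PI)) with (eps * (2 * PI - 0)) by ring.
    replace (I s - 2 * PI * fst (f z0))
      with (RInt (fun t => fst (F (s, t))) 0 (2 * PI)
            - RInt (fun _ => 0) 0 (2 * PI) - fst (f z0) * (2 * PI - 0)).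
    2:{ unfold I. rewrite RInt_const. change (scal (2 * PI - 0) 0) with ((2 * PI - 0) * 0). ring. }
    apply RInt_minus_near; [lra|apply HR; lra|apply (ex_RInt_const (V := R_NormedModule))|].
    intros t _.
    replace (fst (F (s, t)) - 0 - fst (f z0)) with (fst (f (z0 + cexp (s, t)) - f z0)%C)
      by (unfold F; simpl; ring).
    left. eapply Rle_lt_trans; [apply Rabs_re_le_Cmod|]. apply H.
    replace (z0 + cexp (s, t) - z0)%C with (cexp (s, t)) by ring.
    rewrite Cmod_cexp. simpl. lra. }
  assert (E : I (ln r) = 2 * PI * fst (f z0)).
  { apply Rminus_diag_uniq. apply NNPP. intro N. apply Rabs_pos_lt in N.
    specialize (Hlim (Rabs (I (ln r) - 2 * PI * fst (f z0)) / (4 * PI))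
      ltac:(apply Rdiv_lt_0_compat; lra)).
    set (A := Rabs _) in *.
    replace (A / (4 * PI) * (2 * PI)) with (A / 2) in Hlim by (field; lra). lra. }
  rewrite <- E. unfold I.
  apply (is_RInt_ext (fun t => fst (F (ln r, t)))).
  - intros t _. unfold F, circle, cexp. simpl. now rewrite exp_ln.
  - apply (RInt_correct (V := R_CompleteNormedModule)). apply HR. lra.
Qed.

(** * Compactness of rectangles and the maximum principle *)

Definition in_rectangle (a b c d x y : R) : Prop := a <= x <= b /\ c <= y <= d.

(** One number del is both the radius of the neighbourhood and the parameter of Q, which is monotone
    in it; compactness then provides a common del. It is applied to an upper bound 1 / del, to a gap
    del below a supremum, and to a lower bound del for a modulus. *)
Lemma rectangle_local_uniform (Q : R -> R -> R -> Prop) (a b c d : R) :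
  (forall x y del del', 0 < del' <= del -> Q x y del -> Q x y del') ->
  (forall u v, in_rectangle a b c d u v -> exists del, 0 < del /\
     forall x y, in_rectangle a b c d x y ->
       Rabs (x - u) < del -> Rabs (y - v) < del -> Q x y del) ->
  exists del, 0 < del /\ forall x y, in_rectangle a b c d x y -> Q x y del.
Proof.
  intros Hmono Hloc.
  assert (Hd : forall u v, exists del : posreal, in_rectangle a b c d u v ->
     forall x y, in_rectangle a b c d x y ->
       Rabs (x - u) < del -> Rabs (y - v) < del -> Q x y del).
  { intros u v. destruct (classic (in_rectangle a b c d u v)) as [I|I].
    - destruct (Hloc u v I) as [del [Hdel H]]. exists (mkposreal del Hdel). auto.
    - exists (mkposreal 1 Rlt_0_1). tauto. }
  set (delta := fun u v => proj1_sig (constructive_indefinite_description _ (Hd u v))).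
  destruct (compactness_value_2d a b c d delta) as [del Hdel].
  exists del. split; [apply cond_pos|]. intros x y [Ix Iy].
  apply NNPP. intro N. apply (Hdel x y Ix Iy). intros (u & v & Iu & Iv & D1 & D2 & D3).
  apply N. apply Hmono with (delta u v); [split; [apply cond_pos|auto]|].
  apply (proj2_sig (constructive_indefinite_description _ (Hd u v))); auto.
  - split; auto.
  - split; auto.
Qed.

Lemma rectangle_max (g : R -> R -> R) (a b c d : R) :
  a <= b -> c <= d ->
  (forall u v, in_rectangle a b c d u v -> forall eps, 0 < eps -> exists del, 0 < del /\
     forall x y, Rabs (x - u) < del -> Rabs (y - v) < del -> Rabs (g x y - g u v) < eps) ->
  exists u v, in_rectangle a b c d u v /\
    forall x y, in_rectangle a b c d x y -> g x y <= g u v.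
Proof.
  intros Hab Hcd Hg.
  destruct (rectangle_local_uniform (fun x y del => g x y <= / del) a b c d) as [B [HB HgB]].
  { intros x y del del' [H1 H2] H. eapply Rle_trans; eauto. apply Rinv_le_contravar; auto. }
  { intros u v I. destruct (Hg u v I 1 Rlt_0_1) as [del [Hdel H]].
    assert (P : 0 < / (Rabs (g u v) + 1)).
    { apply Rinv_0_lt_compat. assert (X := Rabs_pos (g u v)). lra. }
    exists (Rmin del (/ (Rabs (g u v) + 1))). split; [apply Rmin_pos; auto|].
    intros x y _ H1 H2.
    assert (H3 : Rabs (g x y - g u v) < 1).
    { apply H; eapply Rlt_le_trans; eauto; apply Rmin_l. }
    apply Rabs_def2 in H3. assert (X := Rle_abs (g u v)).
    apply Rle_trans with (/ / (Rabs (g u v) + 1)).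
    - rewrite Rinv_inv. lra.
    - apply Rinv_le_contravar; [apply Rmin_pos; auto|apply Rmin_r]. }
  destruct (completeness (fun r => exists x y, in_rectangle a b c d x y /\ r = g x y))
    as [M [HM1 HM2]].
  - exists (/ B). intros r (x & y & I & ->). auto.
  - exists (g a c), a, c. unfold in_rectangle. split; auto; lra.
  - apply NNPP. intro N.
    assert (Hlt : forall u v, in_rectangle a b c d u v -> g u v < M).
    { intros u v I. destruct (HM1 (g u v)) as [L|L]; auto.
      - now exists u, v.
      - exfalso. apply N. exists u, v. split; auto. intros x y I'. rewrite L.
        apply HM1. now exists x, y. }
    (* A supremum that is nowhere attained would be missed by a uniform gap m, and M - m would be a
       smaller upper bound. *)
    destruct (rectangle_local_uniform (fun x y del => g x y <= M - del) a b c d)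
      as [m [Hm Hgm]].
    { intros. lra. }
    { intros u v I. specialize (Hlt u v I).
      destruct (Hg u v I ((M - g u v) / 2)) as [del [Hdel H]]; [lra|].
      exists (Rmin del ((M - g u v) / 2)). split; [apply Rmin_pos; lra|].
      intros x y _ H1 H2.
      assert (H3 : Rabs (g x y - g u v) < (M - g u v) / 2).
      { apply H; eapply Rlt_le_trans; eauto; apply Rmin_l. }
      apply Rabs_def2 in H3. assert (X := Rmin_r del ((M - g u v) / 2)). lra. }
    assert (M <= M - m); [|lra].
    apply HM2. intros r (x & y & I & ->). auto.
Qed.

Definition rectangle_boundary (a b c d x y : R) : Prop :=
  in_rectangle a b c d x y /\ (x = a \/ x = b \/ y = c \/ y = d).

Lemma Cmod_sqr (z : C) : Cmod z ^ 2 = fst z ^ 2 + snd z ^ 2.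
Proof. apply Cmod2_alt. Qed.

(* The maximum of |f|^2 + eps |z - z0|^2 cannot be interior: |f|^2 satisfies the
   mean value inequality and |z - z0|^2 the strict one. *)
Lemma maximum_principle (f : C -> C) (a b c d M : R) :
  (forall x y, in_rectangle a b c d x y -> exists e, cderiv f (x, y) e) ->
  (forall x y, rectangle_boundary a b c d x y -> Cmod (f (x, y)) <= M) ->
  forall x y, in_rectangle a b c d x y -> Cmod (f (x, y)) <= M.
Proof.
  intros Hf Hbd x0 y0 I0. apply Rnot_lt_le. intro HM.
  assert (Hab : a <= b) by (unfold in_rectangle in I0; lra).
  assert (Hcd : c <= d) by (unfold in_rectangle in I0; lra).
  assert (HM0 : 0 <= M).
  { eapply Rle_trans; [apply Cmod_ge_0|apply (Hbd a c)].
    unfold rectangle_boundary, in_rectangle; auto with real. }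
  set (D := (b - a) ^ 2 + (d - c) ^ 2 + 1).
  assert (HD : 0 < D) by (unfold D; assert (H1 := pow2_ge_0 (b - a)); assert (H2 := pow2_ge_0 (d - c)); lra).
  set (m0 := Cmod (f (x0, y0))) in *.
  (* D bounds |z - z0|^2 on the rectangle, so with this eps the values of g on the boundary are at
     most M^2 + eps D < m0^2 = g (z0), and the maximum of g is interior. *)
  set (eps := (m0 ^ 2 - M ^ 2) / (2 * D)).
  assert (Hgap : 0 < m0 ^ 2 - M ^ 2) by nra.
  assert (Heps : 0 < eps) by (apply Rdiv_lt_0_compat; lra).
  assert (HepsD : M ^ 2 + eps * D < m0 ^ 2).
  { unfold eps. replace ((m0 ^ 2 - M ^ 2) / (2 * D) * D) with ((m0 ^ 2 - M ^ 2) / 2)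
      by (field; lra). lra. }
  set (g := fun x y => Cmod (f (x, y)) ^ 2 + eps * ((x - x0) ^ 2 + (y - y0) ^ 2)).
  destruct (rectangle_max g a b c d Hab Hcd) as (x1 & y1 & I1 & Hmax).
  { intros u v I e He. destruct (Hf u v I) as [e' He']. apply cderiv_ccont in He'.
    set (k := Cmod (f (u, v))). assert (Hk : 0 <= k) by apply Cmod_ge_0.
    assert (C1 : continuity_pt (fun t => t ^ 2) k) by reg.
    assert (C2 : continuity_pt (fun t => eps * (t - x0) ^ 2) u) by reg.
    assert (C3 : continuity_pt (fun t => eps * (t - y0) ^ 2) v) by reg.
    destruct (C1 (e / 3)) as [d1 [Hd1 K1]]; [lra|].
    destruct (C2 (e / 3)) as [d2 [Hd2 K2]]; [lra|].
    destruct (C3 (e / 3)) as [d3 [Hd3 K3]]; [lra|].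
    destruct (ccont_Cmod _ _ He' d1 Hd1) as [d4 [Hd4 K4]].
    exists (Rmin (d4 / 2) (Rmin d2 d3)).
    split; [repeat apply Rmin_pos; lra|]. intros x y Hx Hy.
    assert (A1 := Rmin_l (d4 / 2) (Rmin d2 d3)). assert (A2 := Rmin_r (d4 / 2) (Rmin d2 d3)).
    assert (A3 := Rmin_l d2 d3). assert (A4 := Rmin_r d2 d3).
    assert (B1 : Rabs (Cmod (f (x, y)) ^ 2 - k ^ 2) < e / 3).
    { destruct (Req_dec (Cmod (f (x, y))) k) as [->|N].
      - rewrite Rminus_diag, Rabs_R0. lra.
      - apply K1. split; [split; [exact Logic.I|auto]|]. unfold k. apply K4.
        change ((x, y) - (u, v))%C with (x - u, y - v).
        eapply Rle_lt_trans; [apply Cmod_le_components|]. lra. }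
    assert (B2 : Rabs (eps * (x - x0) ^ 2 - eps * (u - x0) ^ 2) < e / 3).
    { destruct (Req_dec x u) as [->|N].
      - rewrite Rminus_diag, Rabs_R0. lra.
      - apply K2. split; [split; [exact Logic.I|auto]|]. simpl; unfold Rdist; lra. }
    assert (B3 : Rabs (eps * (y - y0) ^ 2 - eps * (v - y0) ^ 2) < e / 3).
    { destruct (Req_dec y v) as [->|N].
      - rewrite Rminus_diag, Rabs_R0. lra.
      - apply K3. split; [split; [exact Logic.I|auto]|]. simpl; unfold Rdist; lra. }
    unfold g. fold k. apply Rabs_def2 in B1. apply Rabs_def2 in B2. apply Rabs_def2 in B3.
    apply Rabs_def1; lra. }
  set (m1 := Cmod (f (x1, y1))) in *.
  assert (Hm1 : 0 <= m1) by apply Cmod_ge_0.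
  assert (Hg0 : m0 ^ 2 <= m1 ^ 2 + eps * ((x1 - x0) ^ 2 + (y1 - y0) ^ 2)).
  { specialize (Hmax x0 y0 I0). unfold g in Hmax. fold m0 m1 in Hmax.
    replace ((x0 - x0) ^ 2 + (y0 - y0) ^ 2) with 0 in Hmax by ring. lra. }
  assert (HB : (x1 - x0) ^ 2 + (y1 - y0) ^ 2 <= D).
  { unfold D. unfold in_rectangle in I0, I1.
    assert ((x1 - x0) ^ 2 <= (b - a) ^ 2) by (apply pow_maj_Rabs; apply Rabs_le; lra).
    assert ((y1 - y0) ^ 2 <= (d - c) ^ 2) by (apply pow_maj_Rabs; apply Rabs_le; lra). lra. }
  assert (Hint : a < x1 < b /\ c < y1 < d).
  { apply NNPP. intro N.
    assert (Bd : rectangle_boundary a b c d x1 y1).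
    { split; auto. unfold in_rectangle in I1.
      apply NNPP. intro N'. apply N.
      assert (x1 <> a) by tauto. assert (x1 <> b) by tauto.
      assert (y1 <> c) by tauto. assert (y1 <> d) by tauto. lra. }
    specialize (Hbd _ _ Bd). fold m1 in Hbd. nra. }
  assert (Hm1pos : 0 < m1 ^ 2) by nra.
  set (r := Rmin (Rmin (x1 - a) (b - x1)) (Rmin (y1 - c) (d - y1))).
  assert (Hr : 0 < r) by (repeat apply Rmin_pos; lra).
  assert (Hrx : r <= x1 - a /\ r <= b - x1 /\ r <= y1 - c /\ r <= d - y1).
  { unfold r. repeat split;
      (eapply Rle_trans; [first [apply Rmin_l | apply Rmin_r]|]; first [apply Rmin_l | apply Rmin_r]) ||
      (eapply Rle_trans; [apply Rmin_r|]; first [apply Rmin_l | apply Rmin_r]) ||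
      (eapply Rle_trans; [apply Rmin_l|]; apply Rmin_r). }
  (* With k = conj (f (z1))^2 the function k f^2 takes the real value |f (z1)|^4 at z1 and has
     modulus |f (z1)|^2 |f|^2 elsewhere. The mean value property of its real part thus becomes the
     mean value inequality for |f|^2. *)
  set (k := (Cconj (f (x1, y1)) * Cconj (f (x1, y1)))%C).
  assert (MV := mean_value_re (fun z => k * (f z * f z))%C (x1, y1) r Hr).
  assert (Hd : forall z, Cmod (z - (x1, y1)) <= r ->
     exists d0, cderiv (fun z => k * (f z * f z))%C z d0).
  { intros [x y] Hz.
    assert (X1 := Rabs_re_le_Cmod ((x, y) - (x1, y1))). assert (X2 := Rabs_im_le_Cmod ((x, y) - (x1, y1))).
    change (fst ((x, y) - (x1, y1))%C) with (x - x1) in X1.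
    change (snd ((x, y) - (x1, y1))%C) with (y - y1) in X2.
    assert (Y1 : Rabs (x - x1) <= r) by lra. assert (Y2 : Rabs (y - y1) <= r) by lra.
    apply Rabs_le_between in Y1. apply Rabs_le_between in Y2.
    destruct (Hf x y) as [e He]; [unfold in_rectangle; lra|].
    eexists. apply cderiv_mult; [apply cderiv_const|apply cderiv_mult; eauto]. }
  specialize (MV Hd).
  assert (Hk : fst (k * (f (x1, y1) * f (x1, y1)))%C = m1 ^ 2 * m1 ^ 2).
  { unfold m1. rewrite !Cmod_sqr. unfold k. destruct (f (x1, y1)). simpl. ring. }
  cbv beta in MV. rewrite Hk in MV.
  set (B1 := x1 - x0) in *. set (B2 := y1 - y0) in *.
  (* The bound for m1^2 |f|^2 on the circle that follows from the maximality of g at z1. Its terms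
     in cos t and sin t integrate to zero, while - eps r^2 survives and brings the mean below
     m1^4. *)
  set (up := fun t => m1 ^ 2 * (m1 ^ 2 - eps * r ^ 2 - 2 * eps * r * (B1 * cos t + B2 * sin t))).
  assert (Hup : is_RInt up 0 (2 * PI) (2 * PI * (m1 ^ 2 * (m1 ^ 2 - eps * r ^ 2)))).
  { set (P := fun t => m1 ^ 2 * ((m1 ^ 2 - eps * r ^ 2) * t - 2 * eps * r * (B1 * sin t - B2 * cos t))).
    replace (2 * PI * (m1 ^ 2 * (m1 ^ 2 - eps * r ^ 2))) with (minus (P (2 * PI)) (P 0)).
    2:{ change (@eq R (P (2 * PI) - P 0) (2 * PI * (m1 ^ 2 * (m1 ^ 2 - eps * r ^ 2)))). unfold P.
        rewrite cos_2PI, sin_2PI, cos_0, sin_0. ring. }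
    apply (is_RInt_derive (V := R_CompleteNormedModule)).
    - intros t _. unfold P, up. auto_derive; auto. ring.
    - intros t _. apply continuity_pt_filterlim. unfold up. reg. }
  assert (Hle : 2 * PI * (m1 ^ 2 * m1 ^ 2) <= 2 * PI * (m1 ^ 2 * (m1 ^ 2 - eps * r ^ 2))).
  { refine (is_RInt_le _ up 0 (2 * PI) _ _ _ MV Hup _).
    - assert (X := PI_RGT_0). lra.
    - intros t _. unfold circle.
      set (x := x1 + r * cos t). set (y := y1 + r * sin t).
      change ((x1, y1) + ((r * cos t)%R, (r * sin t)%R))%C with (x, y).
      assert (Hcos := COS_bound t). assert (Hsin := SIN_bound t).
      assert (I : in_rectangle a b c d x y) by (unfold in_rectangle, x, y; nra).
      specialize (Hmax x y I). unfold g in Hmax. fold m1 in Hmax.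
      assert (Hsq : (x - x0) ^ 2 + (y - y0) ^ 2
        = B1 ^ 2 + B2 ^ 2 + r ^ 2 + 2 * r * (B1 * cos t + B2 * sin t)).
      { unfold x, y, B1, B2. assert (S := sin2_cos2 t). unfold Rsqr in S.
        replace (r ^ 2) with (r ^ 2 * (sin t * sin t + cos t * cos t)) by (rewrite S; ring). ring. }
      rewrite Hsq in Hmax. fold B1 B2 in Hmax.
      eapply Rle_trans; [apply Rle_abs|]. eapply Rle_trans; [apply Rabs_re_le_Cmod|].
      unfold k. rewrite !Cmod_mult, !Cmod_conj. fold m1.
      set (m := Cmod (f (x, y))) in *. unfold up.
      replace (m1 * m1 * (m * m)) with (m1 ^ 2 * m ^ 2) by ring.
      apply Rmult_le_compat_l; [lra|]. lra. }
  assert (X := PI_RGT_0).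
  assert (0 < eps * r ^ 2) by (apply Rmult_lt_0_compat; [auto|apply pow_lt; auto]).
  apply Rmult_le_reg_l in Hle; [|lra]. apply Rmult_le_reg_l in Hle; [|auto]. lra.
Qed.

(** * Automorphisms of the upper half-plane *)

(* (z - p) (G / H)^N has no singularity; let N tend to infinity in the maximum principle. *)
Lemma quotient_maximum_principle (G H : C -> C) (p dG dH : C) (a b c d M : R) :
  (forall x y, in_rectangle a b c d x y -> exists e, cderiv G (x, y) e) ->
  (forall x y, in_rectangle a b c d x y -> exists e, cderiv H (x, y) e) ->
  cderiv G p dG -> cderiv H p dH -> G p = 0%C -> H p = 0%C -> dH <> 0%C ->
  in_rectangle a b c d (fst p) (snd p) ->
  (forall x y, in_rectangle a b c d x y -> (x, y) <> p -> H (x, y) <> 0%C) ->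
  0 < M ->
  (forall x y, rectangle_boundary a b c d x y ->
     (x, y) <> p /\ Cmod (G (x, y)) <= M * Cmod (H (x, y))) ->
  forall x y, in_rectangle a b c d x y -> Cmod (G (x, y)) <= M * Cmod (H (x, y)).
Proof.
  intros DG DH Gp Hp G0 H0 dH0 Ip Hne HM Hbd x y I.
  destruct (classic ((x, y) = p)) as [->|Np].
  { rewrite G0, H0, Cmod_0. lra. }
  apply Rnot_lt_le. intro Lt.
  assert (Hz := Hne x y I Np). assert (Hz' := Hz). apply Cmod_gt_0 in Hz'.
  set (D := (b - a) + (d - c)).
  assert (HD : forall u v, in_rectangle a b c d u v -> Cmod ((u, v) - p) <= D).
  { intros u v [I1 I2]. destruct p as [p1 p2]. destruct Ip as [I3 I4]. simpl in I3, I4.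
    change ((u, v) - (p1, p2))%C with (u - p1, v - p2).
    eapply Rle_trans; [apply Cmod_le_components|]. unfold D.
    apply Rplus_le_compat; apply Rabs_le; lra. }
  assert (key : forall N,
    Cmod ((x, y) - p) * (Cmod (G (x, y)) / Cmod (H (x, y))) ^ N <= D * M ^ N).
  { intro N. set (F := fun z => ((z - p) * (G z * / H z) ^ N)%C).
    replace (Cmod ((x, y) - p) * (Cmod (G (x, y)) / Cmod (H (x, y))) ^ N) with (Cmod (F (x, y))).
    2:{ unfold F. rewrite Cmod_mult, Cmod_pow, Cmod_mult, Cmod_inv by auto. reflexivity. }
    apply (maximum_principle F a b c d); auto.
    - intros u v Iu. destruct (classic ((u, v) = p)) as [->|Nu].
      + destruct Gp as (qG & r & Hr & CG & EG & FG). destruct Hp as (qH & r' & Hr' & CH & EH & FH).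
        assert (NqH : qH p <> 0%C) by now rewrite EH.
        destruct (ccont_neq_0 qH p CH NqH) as [r2 [Hr2 NH]].
        (* The zeros of G and H at p cancel in their slopes. Because of the factor z - p, the
           function (qG / qH)^N is itself a slope of F at p, and a slope only has to be
           continuous. *)
        exists ((qG p * / qH p) ^ N)%C, (fun h => (qG h * / qH h) ^ N)%C, (Rmin r2 (Rmin r r')).
        split; [repeat apply Rmin_pos; auto|]. split.
        { apply ccont_pow, ccont_mult; auto. now apply ccont_inv. }
        split; [reflexivity|]. intros h Hh.
        assert (L1 := Rmin_l r2 (Rmin r r')). assert (L2 := Rmin_r r2 (Rmin r r')).
        assert (L3 := Rmin_l r r'). assert (L4 := Rmin_r r r').
        unfold F. destruct (classic (h = p)) as [->|Nh]; [ring|].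
        rewrite FG, FH, G0, H0 by lra.
        replace ((0 + qG h * (h - p)) * / (0 + qH h * (h - p)))%C with (qG h * / qH h)%C; [ring|].
        field. split; [now apply Csub_neq_0|apply NH; lra].
      + destruct (DG u v Iu) as [e1 E1]. destruct (DH u v Iu) as [e2 E2].
        assert (E3 := cderiv_inv _ _ _ E2 (Hne u v Iu Nu)).
        destruct (cderiv_pow _ _ _ N (cderiv_mult _ _ _ _ _ E1 E3)) as [e4 E4].
        eexists. apply cderiv_mult; [|exact E4].
        apply cderiv_plus; [apply cderiv_id|apply cderiv_const].
    - intros u v Hb. destruct (Hbd u v Hb) as [Nu Le]. destruct Hb as [Iu _].
      assert (Hu := Hne u v Iu Nu). assert (Hu' := Hu). apply Cmod_gt_0 in Hu'.
      unfold F. rewrite Cmod_mult, Cmod_pow, Cmod_mult, Cmod_inv by auto.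
      apply Rmult_le_compat; auto.
      + apply Cmod_ge_0.
      + apply pow_le. apply Rmult_le_pos; [apply Cmod_ge_0|left; now apply Rinv_0_lt_compat].
      + apply pow_incr. split.
        * apply Rmult_le_pos; [apply Cmod_ge_0|left; now apply Rinv_0_lt_compat].
        * apply Rle_div_l; auto. }
  set (q := Cmod (G (x, y)) / Cmod (H (x, y))) in *.
  assert (Hq : 1 < q / M).
  { apply Rlt_div_r; auto. rewrite Rmult_1_l. unfold q. apply Rlt_div_r; auto. }
  assert (Hpos : 0 < Cmod ((x, y) - p)) by (apply Cmod_gt_0; now apply Csub_neq_0).
  (* [key] bounds |z - p| (q / M)^N by D for every N, which is impossible when q / M > 1. *)
  destruct (Pow_x_infinity (q / M) ltac:(rewrite Rabs_pos_eq; lra)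
    (D / Cmod ((x, y) - p) + 1)) as [N HN].
  specialize (HN N (le_n N)). specialize (key N).
  rewrite Rabs_pos_eq in HN by (apply pow_le; lra).
  replace (q ^ N) with ((q / M) ^ N * M ^ N) in key.
  2:{ rewrite <- Rpow_mult_distr. f_equal. field. lra. }
  assert (HMN : 0 < M ^ N) by now apply pow_lt.
  rewrite <- Rmult_assoc in key. apply Rmult_le_reg_r in key; auto.
  assert (X : D < Cmod ((x, y) - p) * (q / M) ^ N); [|lra].
  apply Rlt_le_trans with (Cmod ((x, y) - p) * (D / Cmod ((x, y) - p) + 1)).
  - replace (Cmod ((x, y) - p) * (D / Cmod ((x, y) - p) + 1)) with (D + Cmod ((x, y) - p))
      by (field; lra). lra.
  - apply Rmult_le_compat_l; lra.
Qed.

(* If a value close to [f z0] were omitted on a small square around [z0], then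
   1 / (f - value) would contradict the maximum principle there. *)
Lemma injective_inverse_continuous (f : C -> C) (z0 : C) (eps : R) :
  (forall z, upper_half_plane z -> exists d, cderiv f z d) ->
  (forall z z', upper_half_plane z -> upper_half_plane z' -> f z = f z' -> z = z') ->
  upper_half_plane z0 -> 0 < eps ->
  exists del, 0 < del /\
    forall z, upper_half_plane z -> Cmod (f z - f z0) < del -> Cmod (z - z0) < eps.
Proof.
  intros Df Inj U0 Heps. destruct z0 as [x0 y0]. unfold upper_half_plane in U0. simpl in U0.
  set (s := Rmin (eps / 3) (y0 / 2)).
  assert (Hs : 0 < s) by (apply Rmin_pos; lra).
  assert (Hs1 : s <= eps / 3) by apply Rmin_l. assert (Hs2 : s <= y0 / 2) by apply Rmin_r.
  set (a := x0 - s). set (b := x0 + s). set (c := y0 - s). set (d := y0 + s).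
  assert (HU : forall x y, in_rectangle a b c d x y -> upper_half_plane (x, y)).
  { intros x y [_ I]. unfold upper_half_plane. simpl. unfold c in I. lra. }
  destruct (rectangle_local_uniform
    (fun x y m => rectangle_boundary a b c d x y -> m <= Cmod (f (x, y) - f (x0, y0))) a b c d)
    as [m [Hm Hmin]].
  { intros x y del del' Hd H Hb. specialize (H Hb). lra. }
  { intros u v I. destruct (classic ((u, v) = (x0, y0))) as [E|N].
    - injection E as -> ->. exists s. split; auto. intros x y _ H1 H2 [_ Hb].
      apply Rabs_def2 in H1. apply Rabs_def2 in H2. unfold a, b, c, d in Hb. lra.
    - assert (Nf : f (u, v) <> f (x0, y0)).
      { intro E. apply N. apply Inj; auto. }
      apply Csub_neq_0, Cmod_gt_0 in Nf. set (A := Cmod (f (u, v) - f (x0, y0))) in *.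
      destruct (Df (u, v) (HU u v I)) as [e He]. apply cderiv_ccont in He.
      destruct (He (A / 2)) as [r [Hr H]]; [lra|].
      exists (Rmin (r / 2) (A / 2)). split; [apply Rmin_pos; lra|].
      intros x y _ H1 H2 _.
      assert (L1 := Rmin_l (r / 2) (A / 2)). assert (L2 := Rmin_r (r / 2) (A / 2)).
      assert (Hc : Cmod ((x, y) - (u, v)) < r).
      { change ((x, y) - (u, v))%C with (x - u, y - v).
        eapply Rle_lt_trans; [apply Cmod_le_components|]. lra. }
      specialize (H (x, y) Hc).
      assert (T := Cmod_triangle_rev (f (u, v) - f (x0, y0)) (f (u, v) - f (x, y))).
      fold A in T. rewrite (Cmod_sub_comm (f (u, v)) (f (x, y))) in T.
      replace (f (u, v) - f (x0, y0) - (f (u, v) - f (x, y)))%C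
        with (f (x, y) - f (x0, y0))%C in T by ring. lra. }
  exists (m / 2). split; [lra|]. intros z Uz Hz.
  assert (Iz : in_rectangle a b c d (fst z) (snd z)).
  { apply NNPP. intro N.
    assert (I0 : in_rectangle a b c d x0 y0) by (unfold in_rectangle, a, b, c, d; lra).
    assert (Nz : forall x y, in_rectangle a b c d x y -> (f (x, y) - f z)%C <> 0%C).
    { intros x y I. apply Csub_neq_0. intro E. apply N.
      apply Inj in E; auto. now rewrite <- E. }
    assert (MP := maximum_principle (fun h => / (f h - f z))%C a b c d (2 / m)).
    cbv beta in MP.
    assert (Hle : Cmod (/ (f (x0, y0) - f z)) <= 2 / m).
    { apply MP; auto.
      - intros x y I. destruct (Df (x, y) (HU x y I)) as [e He].
        eexists. apply cderiv_inv; [|now apply Nz].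
        apply cderiv_plus; [exact He|apply cderiv_const].
      - intros x y Hb. assert (I := proj1 Hb). specialize (Hmin x y I Hb).
        rewrite Cmod_inv by now apply Nz.
        replace (2 / m) with (/ (m / 2)) by (field; lra).
        apply Rinv_le_contravar; [lra|].
        assert (T := Cmod_triangle_rev (f (x, y) - f (x0, y0)) (f z - f (x0, y0))).
        replace (f (x, y) - f (x0, y0) - (f z - f (x0, y0)))%C
          with (f (x, y) - f z)%C in T by ring. lra. }
    rewrite Cmod_inv in Hle by now apply Nz.
    assert (P : 0 < Cmod (f (x0, y0) - f z)) by (apply Cmod_gt_0; now apply Nz).
    rewrite Cmod_sub_comm in Hz.
    assert (Hm2 : 0 < m / 2) by lra.
    assert (Q := Rinv_lt_contravar _ _ (Rmult_lt_0_compat _ _ P Hm2) Hz).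
    replace (/ (m / 2)) with (2 / m) in Q by (field; lra). lra. }
  destruct z as [x y]. destruct Iz as [I1 I2]. simpl in I1, I2. unfold a, b, c, d in I1, I2.
  change ((x, y) - (x0, y0))%C with (x - x0, y - y0).
  eapply Rle_lt_trans; [apply Cmod_le_components|].
  assert (Rabs (x - x0) <= s) by (apply Rabs_le; lra).
  assert (Rabs (y - y0) <= s) by (apply Rabs_le; lra). lra.
Qed.

(** * Disc coordinates centred at a, the Schwarz lemma and automorphisms *)

Definition mobius (a z : C) : C := ((z - a) / (z - Cconj a))%C.

Lemma mobius_denominator (a z : C) :
  upper_half_plane a -> 0 <= Im z -> (z - Cconj a)%C <> 0%C.
Proof.
  destruct a as [a1 a2], z as [x y]. unfold upper_half_plane. simpl. intros Ha Hy E.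
  apply (f_equal snd) in E. simpl in E. lra.
Qed.

Lemma Cmod_mobius_sqr (a z : C) :
  upper_half_plane a -> 0 <= Im z ->
  Cmod (mobius a z) ^ 2 = 1 - 4 * Im a * Im z / Cmod (z - Cconj a) ^ 2.
Proof.
  intros Ha Hz. assert (N := mobius_denominator a z Ha Hz).
  unfold mobius. rewrite Cmod_div by auto.
  assert (P : 0 < Cmod (z - Cconj a)) by now apply Cmod_gt_0.
  assert (E : Cmod (z - a) ^ 2 = Cmod (z - Cconj a) ^ 2 - 4 * Im a * Im z).
  { rewrite !Cmod_sqr. destruct a, z. simpl. ring. }
  unfold Rdiv. rewrite Rpow_mult_distr, E, pow_inv. field. lra.
Qed.

Lemma Cmod_mobius_lt_1 (a z : C) :
  upper_half_plane a -> upper_half_plane z -> Cmod (mobius a z) < 1.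
Proof.
  unfold upper_half_plane. intros Ha Hz.
  assert (E := Cmod_mobius_sqr a z Ha ltac:(lra)).
  assert (P : 0 < Cmod (z - Cconj a)) by (apply Cmod_gt_0, mobius_denominator; auto; lra).
  assert (Q : 0 < 4 * Im a * Im z / Cmod (z - Cconj a) ^ 2).
  { apply Rdiv_lt_0_compat; [nra|nra]. }
  assert (X := Cmod_ge_0 (mobius a z)). nra.
Qed.

(** The complement of the open box |Re z| < R, 1 / R < Im z < R. These boxes exhaust the half-plane,
    so a large R means being close to the boundary, infinity included. *)
Definition outside_box (R : R) (z : C) : Prop :=
  R <= Rabs (Re z) \/ R <= Im z \/ Im z <= / R.

(** By [Cmod_mobius_sqr] it is enough that 4 Im a Im z / D^2 be small, where D = |z - conj a| >= Im
    z + Im a. Far away D itself is large and absorbs Im z; near the real axis Im z is small and D is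
    at least Im a. *)
Lemma mobius_near_boundary (a : C) (eps : R) :
  upper_half_plane a -> 0 < eps -> exists R, 0 < R /\ forall R', R <= R' ->
    forall z, upper_half_plane z -> outside_box R' z -> 1 - eps <= Cmod (mobius a z).
Proof.
  unfold upper_half_plane. intros Ha He.
  assert (A0 := Rabs_pos (Re a)).
  assert (P1 : 0 < 4 * Im a / eps) by (apply Rdiv_lt_0_compat; lra).
  assert (P2 : 0 < 4 / (Im a * eps)) by (apply Rdiv_lt_0_compat; nra).
  exists (Rabs (Re a) + 4 * Im a / eps + 4 / (Im a * eps)). split; [lra|].
  intros R' HR z Hz Hout.
  assert (E := Cmod_mobius_sqr a z Ha ltac:(lra)).
  set (m := Cmod (mobius a z)) in *. assert (Hm : 0 <= m) by apply Cmod_ge_0.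
  assert (Nz : (z - Cconj a)%C <> 0%C) by (apply mobius_denominator; auto; lra).
  set (D := Cmod (z - Cconj a)) in *.
  assert (HD : 0 < D) by now apply Cmod_gt_0.
  assert (HDy : Im z + Im a <= D).
  { assert (X := Rabs_im_le_Cmod (z - Cconj a)). fold D in X.
    replace (snd (z - Cconj a)%C) with (Im z + Im a) in X by (destruct z, a; simpl; ring).
    assert (Y := Rle_abs (Im z + Im a)). lra. }
  assert (HDx : Rabs (Re z) - Rabs (Re a) <= D).
  { assert (X := Rabs_re_le_Cmod (z - Cconj a)). fold D in X.
    replace (fst (z - Cconj a)%C) with (Re z - Re a) in X by (destruct z, a; simpl; ring).
    assert (Y := Rabs_triang_inv (Re z) (Re a)). lra. }
  assert (Hsmall : 4 * Im a * Im z / D ^ 2 <= eps).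
  { apply Rle_div_l; [nra|].
    assert (Hdist : 4 * Im a / eps <= D -> 4 * Im a * Im z <= eps * D ^ 2).
    { intro L. apply Rle_div_l in L; [|lra]. nra. }
    destruct Hout as [O|[O|O]].
    - apply Hdist. lra.
    - apply Hdist. lra.
    - assert (L : 4 / (Im a * eps) <= R') by lra.
      apply Rle_div_l in L; [|nra].
      assert (O' : Im z * R' <= 1).
      { apply Rle_trans with (/ R' * R'); [apply Rmult_le_compat_r; lra|]. rewrite Rinv_l; lra. }
      assert (4 * Im z <= Im a * eps).
      { apply Rle_trans with (R' * (Im a * eps) * Im z); nra. }
      assert (Hsq : Im a * Im a <= D ^ 2) by nra.
      apply Rle_trans with (Im a * Im a * eps).
      + replace (4 * Im a * Im z) with (Im a * (4 * Im z)) by ring.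
        rewrite Rmult_assoc. apply Rmult_le_compat_l; lra.
      + rewrite (Rmult_comm eps). apply Rmult_le_compat_r; lra. }
  apply Rnot_lt_le. intro L. nra.
Qed.

Lemma cderiv_mobius_comp (a : C) (f : C -> C) (z d : C) :
  upper_half_plane a -> 0 <= Im (f z) -> cderiv f z d ->
  exists e, cderiv (fun h => mobius a (f h)) z e /\
    (f z = a -> e = (d / (a - Cconj a))%C).
Proof.
  intros Ha Hz Hd. assert (N := mobius_denominator a (f z) Ha Hz).
  eexists. split.
  - unfold mobius, Cdiv. apply cderiv_mult.
    + apply cderiv_plus; [exact Hd|apply cderiv_const].
    + apply cderiv_inv; [|exact N]. apply cderiv_plus; [exact Hd|apply cderiv_const].
  - intros E. cbv beta. rewrite E in N |- *. field. exact N.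
Qed.

Lemma mobius_eq_0 (a z : C) :
  upper_half_plane a -> 0 <= Im z -> mobius a z = 0%C -> z = a.
Proof.
  intros Ha Hz E. assert (N := mobius_denominator a z Ha Hz). unfold mobius in E.
  assert (E' : (z - a = 0)%C).
  { replace (z - a)%C with ((z - a) / (z - Cconj a) * (z - Cconj a))%C by (field; exact N).
    rewrite E. ring. }
  replace z with (z - a + a)%C by ring. rewrite E'. ring.
Qed.

Lemma mobius_self (a : C) : mobius a a = 0%C.
Proof. unfold mobius, Cdiv. ring. Qed.

Lemma cderiv_zero_segment (f : C -> C) (p h : C) (s t : R) :
  s < t -> (forall u, s <= u <= t -> cderiv f (p + RtoC u * h)%C 0) ->
  f (p + RtoC s * h)%C = f (p + RtoC t * h)%C.
Proof.
  intros Hst H.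
  assert (E : forall k, fst (k * f (p + RtoC s * h)%C)%C = fst (k * f (p + RtoC t * h)%C)%C).
  { intro k.
    apply (eq_is_derive (fun u => fst (k * f (p + RtoC u * h)%C)%C) s t); auto.
    intros u Hu. apply is_derive_Reals. change zero with 0.
    replace 0 with (fst (k * 0 * h)%C) by (destruct k, h; simpl; ring).
    now apply cderiv_line, H. }
  assert (E1 := E 1%C). assert (E2 := E (- Ci)%C).
  destruct (f (p + RtoC s * h)%C), (f (p + RtoC t * h)%C). simpl in E1, E2.
  f_equal; lra.
Qed.

(** With k = conj (q z), the function Re (k q) is at most 1 near z and equals 1 at z, so its
    directional derivatives vanish there. In the direction conj (k d) this derivative is |d|^2. *)
Lemma cderiv_unimodular (q : C -> C) (z d : C) (r : R) :
  0 < r -> (forall h, Cmod (h - z) < r -> Cmod (q h) = 1) -> cderiv q z d -> d = 0%C.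
Proof.
  intros Hr Hq Hd.
  set (k := Cconj (q z)). set (h := Cconj (k * d)).
  assert (Hz : Cmod (q z) = 1) by (apply Hq; rewrite Cmod_self_sub; auto).
  assert (D : derivable_pt_lim (fun t => fst (k * q (z + RtoC t * h)%C)%C) 0 (fst (k * d * h)%C)).
  { apply cderiv_line. now replace (z + RtoC 0 * h)%C with z by ring. }
  assert (E : fst (k * d * h)%C = Cmod d ^ 2).
  { unfold h. rewrite <- Cmod2_conj, Cmod_mult. unfold k. rewrite Cmod_conj, Hz, Rmult_1_l.
    reflexivity. }
  rewrite E in D.
  set (r' := r / (Cmod h + 1)). assert (Hh := Cmod_ge_0 h).
  assert (Hr' : 0 < r') by (apply Rdiv_lt_0_compat; lra).
  assert (Z := deriv_maximum _ (- r') r' 0 (exist _ _ D) ltac:(lra) ltac:(lra)).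
  assert (Cmod d = 0).
  { assert (Z' : Cmod d ^ 2 = 0).
    { apply Z. intros t Ht1 Ht2.
      replace (z + RtoC 0 * h)%C with z by ring.
      unfold k at 2. replace (fst (Cconj (q z) * q z)%C) with (Cmod (q z) ^ 2)
        by (rewrite Cmod_sqr; destruct (q z); simpl; ring).
      rewrite Hz. replace (1 ^ 2) with (Cmod k * Cmod (q (z + RtoC t * h)%C)).
      - rewrite <- Cmod_mult. eapply Rle_trans; [apply Rle_abs|apply Rabs_re_le_Cmod].
      - unfold k. rewrite Cmod_conj, Hz, Hq; [ring|].
        replace (z + RtoC t * h - z)%C with (RtoC t * h)%C by ring.
        rewrite Cmod_mult, Cmod_R.
        assert (Rabs t < r') by (apply Rabs_def1; lra).
        unfold r' in H. apply Rlt_div_r in H; [|lra]. assert (X := Rabs_pos t). nra. }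
    nra. }
  now apply Cmod_eq_0.
Qed.

(** The Schwarz lemma with a comparison function H in place of the coordinate: H has a simple zero
    at a, no other zero, and modulus tending to 1 at the boundary. On the sides of a large box |G|
    <= |H| / (1 - eps), hence also inside. This form can be applied a second time with G and H
    exchanged. *)
Lemma half_plane_schwarz (G H : C -> C) (a dG dH : C) :
  upper_half_plane a ->
  (forall z, upper_half_plane z -> exists e, cderiv G z e) ->
  (forall z, upper_half_plane z -> exists e, cderiv H z e) ->
  cderiv G a dG -> cderiv H a dH -> G a = 0%C -> H a = 0%C -> dH <> 0%C ->
  (forall z, upper_half_plane z -> H z = 0%C -> z = a) ->
  (forall z, upper_half_plane z -> Cmod (G z) < 1) ->
  (forall eps, 0 < eps -> exists R, 0 < R /\ forall R', R <= R' ->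
     forall z, upper_half_plane z -> outside_box R' z -> 1 - eps <= Cmod (H z)) ->
  forall z, upper_half_plane z -> Cmod (G z) <= Cmod (H z).
Proof.
  intros Ua DG DH Ga Ha G0 H0 dH0 HH HG Hbd z Uz.
  apply Rnot_lt_le. intro Lt.
  assert (HGz := HG z Uz). assert (P := Cmod_ge_0 (H z)).
  set (eps := (Cmod (G z) - Cmod (H z)) / 2).
  assert (He : 0 < eps < 1) by (unfold eps; lra).
  destruct (Hbd eps ltac:(lra)) as [R0 [HR0 HB]].
  unfold upper_half_plane in Ua, Uz.
  (* Besides exceeding R0, this R places a and z strictly inside the box with sides -R, R and / R,
     R; the summands / Im a and / Im z take care of its lower side. *)
  set (R := R0 + (Rabs (Re a) + Im a + / Im a) + (Rabs (Re z) + Im z + / Im z)).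
  assert (Ia : 0 < / Im a) by now apply Rinv_0_lt_compat.
  assert (Iz : 0 < / Im z) by now apply Rinv_0_lt_compat.
  assert (Ra := Rabs_pos (Re a)). assert (Rz := Rabs_pos (Re z)).
  assert (HR : 0 < R) by (unfold R; lra).
  assert (IR : 0 < / R) by now apply Rinv_0_lt_compat.
  assert (Ia2 : / R < Im a).
  { rewrite <- (Rinv_inv (Im a)). apply Rinv_lt_contravar; [nra|unfold R; lra]. }
  assert (Iz2 : / R < Im z).
  { rewrite <- (Rinv_inv (Im z)). apply Rinv_lt_contravar; [nra|unfold R; lra]. }
  assert (HU : forall x y, in_rectangle (- R) R (/ R) R x y -> upper_half_plane (x, y)).
  { intros x y [_ I]. unfold upper_half_plane. simpl. lra. }
  assert (key : Cmod (G z) <= / (1 - eps) * Cmod (H z)).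
  { assert (Aa := Rabs_def2 (Re a) R ltac:(unfold R; lra)).
    assert (Az := Rabs_def2 (Re z) R ltac:(unfold R; lra)).
    assert (Hin : in_rectangle (- R) R (/ R) R (fst z) (snd z)).
    { change (fst z) with (Re z). change (snd z) with (Im z).
      unfold in_rectangle. split; [lra|]. split; [lra|unfold R; lra]. }
    replace z with (fst z, snd z) by (destruct z; reflexivity).
    apply (quotient_maximum_principle G H a dG dH (- R) R (/ R) R); auto.
    - change (fst a) with (Re a). change (snd a) with (Im a).
      unfold in_rectangle. split; [lra|]. split; [lra|unfold R; lra].
    - apply Rinv_0_lt_compat. lra.
    - intros x y [I B]. split.
      + intros E. subst a. simpl in *. unfold R in *. lra.
      + assert (O : outside_box R (x, y)).
        { unfold outside_box. simpl.
          destruct B as [E|[E|[E|E]]]; subst.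
          - left. rewrite Rabs_Ropp, Rabs_pos_eq; lra.
          - left. rewrite Rabs_pos_eq; lra.
          - right; right. lra.
          - right; left. lra. }
        assert (L := HB R ltac:(unfold R; lra) _ (HU x y I) O).
        assert (L2 := HG _ (HU x y I)).
        apply Rle_trans with 1; [lra|].
        apply (Rmult_le_reg_l (1 - eps)); [lra|].
        rewrite <- Rmult_assoc, Rinv_r, Rmult_1_l by lra. lra. }
  apply (Rmult_le_compat_l (1 - eps)) in key; [|lra].
  rewrite <- Rmult_assoc, Rinv_r, Rmult_1_l in key by lra.
  unfold eps in *. nra.
Qed.

Lemma half_plane_segment (a z : C) (t : R) :
  upper_half_plane a -> upper_half_plane z -> 0 <= t <= 1 ->
  upper_half_plane (a + RtoC t * (z - a))%C.
Proof.
  unfold upper_half_plane. destruct a as [a1 a2], z as [x y]. simpl. intros. nra.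
Qed.

Lemma half_plane_open (z h : C) : Cmod (h - z) < Im z -> upper_half_plane h.
Proof.
  intros H. unfold upper_half_plane.
  assert (X := Rabs_im_le_Cmod (h - z)). destruct h as [p q], z as [x y]. simpl in *.
  assert (Y : Rabs (q + - y) < y) by lra. apply Rabs_def2 in Y. lra.
Qed.

Section HalfPlaneAutomorphism.

Variables phi eta : C -> C.
Hypothesis phi_half_plane : forall z, upper_half_plane z -> upper_half_plane (phi z).
Hypothesis phi_cderiv : forall z, upper_half_plane z -> exists d, cderiv phi z d.
Hypothesis eta_half_plane : forall z, upper_half_plane z -> upper_half_plane (eta z).
Hypothesis eta_phi : forall z, upper_half_plane z -> eta (phi z) = z.
Hypothesis phi_eta : forall z, upper_half_plane z -> phi (eta z) = z.

(** The preimage of a compact box under phi is its image under eta, and eta is continuous because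
    phi is holomorphic and injective. So Re, Im and 1 / Im of eta are bounded on the box, which
    keeps the preimage away from the boundary. *)
Lemma automorphism_proper (R' : R) :
  exists R, 0 < R /\ forall R'', R <= R'' -> forall z, upper_half_plane z ->
    outside_box R'' z -> outside_box R' (phi z).
Proof.
  destruct (Rle_lt_dec R' 0) as [Neg|HR'].
  { exists 1. split; [lra|]. intros. left. eapply Rle_trans; [exact Neg|apply Rabs_pos]. }
  assert (IR' : 0 < / R') by now apply Rinv_0_lt_compat.
  assert (Inj : forall z z', upper_half_plane z -> upper_half_plane z' ->
    phi z = phi z' -> z = z').
  { intros z z' Uz Uz' E. now rewrite <- (eta_phi z), <- (eta_phi z'), E. }
  destruct (rectangle_local_uniform
    (fun x y del => Rabs (Re (eta (x, y))) <= / del /\ Im (eta (x, y)) <= / del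
       /\ del <= Im (eta (x, y))) (- R') R' (/ R') R') as [del [Hdel HQ]].
  { intros x y del del' [H1 H2] (Q1 & Q2 & Q3).
    assert (/ del <= / del') by (apply Rinv_le_contravar; lra). lra. }
  { intros u v [_ I].
    assert (U : upper_half_plane (u, v)) by (unfold upper_half_plane; simpl; lra).
    assert (Ue := eta_half_plane _ U). set (e := eta (u, v)) in *. unfold upper_half_plane in Ue.
    assert (He : 0 < Im e / 2) by lra.
    destruct (injective_inverse_continuous phi e (Im e / 2) phi_cderiv Inj Ue He)
      as [del [Hdel Hc]].
    set (B := Rabs (Re e) + 2 * Im e). assert (PB := Rabs_pos (Re e)).
    assert (HB : 0 < B) by (unfold B; lra).
    assert (HIB : 0 < / B) by now apply Rinv_0_lt_compat.
    exists (Rmin (del / 2) (Rmin (Im e / 2) (/ B))).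
    split; [repeat apply Rmin_pos; lra|].
    assert (L1 := Rmin_l (del / 2) (Rmin (Im e / 2) (/ B))).
    assert (L2 := Rmin_r (del / 2) (Rmin (Im e / 2) (/ B))).
    assert (L3 := Rmin_l (Im e / 2) (/ B)). assert (L4 := Rmin_r (Im e / 2) (/ B)).
    set (m := Rmin (del / 2) _) in *.
    assert (Hm : 0 < m) by (repeat apply Rmin_pos; lra).
    intros x y [_ I'] H1 H2.
    assert (U' : upper_half_plane (x, y)) by (unfold upper_half_plane; simpl; lra).
    assert (D : Cmod (eta (x, y) - e) < Im e / 2).
    { apply Hc; auto. unfold e. rewrite !phi_eta by auto.
      change ((x, y) - (u, v))%C with (x - u, y - v).
      eapply Rle_lt_trans; [apply Cmod_le_components|]. lra. }
    assert (X1 := Rabs_re_le_Cmod (eta (x, y) - e)).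
    assert (X2 := Rabs_im_le_Cmod (eta (x, y) - e)).
    replace (fst (eta (x, y) - e)%C) with (Re (eta (x, y)) - Re e) in X1
      by (destruct (eta (x, y)), e; simpl; ring).
    replace (snd (eta (x, y) - e)%C) with (Im (eta (x, y)) - Im e) in X2
      by (destruct (eta (x, y)), e; simpl; ring).
    assert (Y2 : Rabs (Im (eta (x, y)) - Im e) < Im e / 2) by lra. apply Rabs_def2 in Y2.
    assert (Y1 := Rabs_triang_inv (Re (eta (x, y))) (Re e)).
    assert (B <= / m).
    { rewrite <- (Rinv_inv B). apply Rinv_le_contravar; lra. }
    unfold B in *. lra. }
  assert (Hid : 0 < / del) by now apply Rinv_0_lt_compat.
  exists (/ del + 1). split; [lra|]. intros R'' HR'' z Uz Oz.
  apply NNPP. intro N. unfold outside_box in N.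
  assert (N1 : ~ R' <= Rabs (Re (phi z))) by tauto. assert (N2 : ~ R' <= Im (phi z)) by tauto.
  assert (N3 : ~ Im (phi z) <= / R') by tauto.
  apply Rnot_le_lt in N1, N2, N3. apply Rabs_def2 in N1.
  destruct (HQ (Re (phi z)) (Im (phi z))) as (Q1 & Q2 & Q3).
  { unfold in_rectangle. lra. }
  replace (Re (phi z), Im (phi z)) with (phi z) in * by (destruct (phi z); reflexivity).
  rewrite eta_phi in Q1, Q2, Q3 by auto.
  destruct Oz as [O|[O|O]]; try lra.
  assert (/ R'' < del); [|lra].
  rewrite <- (Rinv_inv del). apply Rinv_lt_contravar; [|lra]. nra.
Qed.

(** If the derivative vanished everywhere, phi would be constant on the segment from i to 2 i. The
    point found here becomes the base point of the Schwarz lemma. *)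
Lemma automorphism_nonzero_derivative :
  exists a d, upper_half_plane a /\ cderiv phi a d /\ d <> 0%C.
Proof.
  apply NNPP. intro N.
  assert (E : phi (Ci + RtoC 0 * Ci)%C = phi (Ci + RtoC 1 * Ci)%C).
  { apply cderiv_zero_segment; [lra|]. intros u Hu.
    assert (U : upper_half_plane (Ci + RtoC u * Ci)%C) by (unfold upper_half_plane; simpl; lra).
    destruct (phi_cderiv _ U) as [d Hd].
    destruct (classic (d = 0%C)) as [->|Nd]; auto. exfalso. apply N. eauto. }
  apply (f_equal eta) in E.
  rewrite !eta_phi in E by (unfold upper_half_plane; simpl; lra).
  apply (f_equal snd) in E. simpl in E. lra.
Qed.

(** In disc coordinates around phi a and a, the Schwarz lemma used in both directions gives |G| =
    |H|. The quotient G / H is then unimodular away from a, so its derivative vanishes there; it is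
    constant on each ray from a, and the constant is the limit rho at a, common to all rays. *)
Lemma automorphism_is_mobius :
  exists a rho, upper_half_plane a /\ Cmod rho = 1 /\
    forall z, upper_half_plane z -> mobius (phi a) (phi z) = (rho * mobius a z)%C.
Proof.
  destruct automorphism_nonzero_derivative as (a & d & Ua & Hd & Nd).
  set (b := phi a). assert (Ub : upper_half_plane b) by now apply phi_half_plane.
  set (G := fun z => mobius b (phi z)). set (H := mobius a).
  assert (Im_ge : forall z, upper_half_plane z -> 0 <= Im z)
    by (unfold upper_half_plane; intros; lra).
  assert (DG : forall z, upper_half_plane z -> exists e, cderiv G z e).
  { intros z Uz. destruct (phi_cderiv z Uz) as [e He].
    destruct (cderiv_mobius_comp b phi z e) as [e' [He' _]]; eauto. }
  assert (DH : forall z, upper_half_plane z -> exists e, cderiv H z e).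
  { intros z Uz. destruct (cderiv_mobius_comp a (fun h => h) z 1) as [e' [He' _]]; eauto.
    apply cderiv_id. }
  assert (denom : forall u, upper_half_plane u -> (u - Cconj u)%C <> 0%C)
    by (intros; apply mobius_denominator; auto).
  destruct (cderiv_mobius_comp b phi a d) as [dG [HdG EdG]]; auto.
  destruct (cderiv_mobius_comp a (fun h => h) a 1) as [dH [HdH EdH]]; auto.
  { apply cderiv_id. }
  specialize (EdG eq_refl). specialize (EdH eq_refl).
  assert (NdG : dG <> 0%C).
  { rewrite EdG. apply Cmult_neq_0; auto. intro E.
    assert (X : ((b - Cconj b) * / (b - Cconj b))%C = 1%C) by (field; auto).
    rewrite E in X. apply (f_equal fst) in X. simpl in X. lra. }
  assert (NdH : dH <> 0%C).
  { rewrite EdH. apply Cmult_neq_0; [intro E; apply (f_equal fst) in E; simpl in E; lra|]. intro E.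
    assert (X : ((a - Cconj a) * / (a - Cconj a))%C = 1%C) by (field; auto).
    rewrite E in X. apply (f_equal fst) in X. simpl in X. lra. }
  assert (G0 : G a = 0%C) by apply mobius_self. assert (H0 : H a = 0%C) by apply mobius_self.
  assert (GZ : forall z, upper_half_plane z -> G z = 0%C -> z = a).
  { intros z Uz E. apply mobius_eq_0 in E; auto.
    rewrite <- (eta_phi z), <- (eta_phi a), E by auto. reflexivity. }
  assert (HZ : forall z, upper_half_plane z -> H z = 0%C -> z = a).
  { intros z Uz E. apply mobius_eq_0 in E; auto. }
  assert (Eq : forall z, upper_half_plane z -> Cmod (G z) = Cmod (H z)).
  { intros z Uz. apply Rle_antisym.
    - apply (half_plane_schwarz G H a dG dH); auto.
      + intros h Uh. apply Cmod_mobius_lt_1; auto.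
      + intros eps He. now apply mobius_near_boundary.
    - apply (half_plane_schwarz H G a dH dG); auto.
      + intros h Uh. apply Cmod_mobius_lt_1; auto.
      + intros eps He. destruct (mobius_near_boundary b eps Ub He) as [R1 [HR1 N1]].
        destruct (automorphism_proper R1) as [R2 [HR2 N2]].
        exists R2. split; auto. intros R' HR' h Uh Oh.
        apply (N1 R1); auto; [lra|]. apply (N2 R'); auto. }
  set (q := fun z => (G z * / H z)%C).
  assert (HdG' := HdG). destruct HdG' as (qG & r1 & Hr1 & CG & EG & FG).
  assert (HdH' := HdH). destruct HdH' as (qH & r2 & Hr2 & CH & EH & FH).
  assert (NqH : qH a <> 0%C) by now rewrite EH.
  destruct (ccont_neq_0 qH a CH NqH) as [r3 [Hr3 NH]].
  set (rho := (qG a * / qH a)%C).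
  assert (Hq1 : forall z, upper_half_plane z -> z <> a -> Cmod (q z) = 1).
  { intros z Uz Nz. assert (X : H z <> 0%C) by (intro E; apply Nz; auto).
    unfold q. rewrite Cmod_mult, Cmod_inv, Eq by auto. apply Rinv_r.
    apply Cmod_gt_0 in X. lra. }
  assert (Hray : forall z, upper_half_plane z -> z <> a -> forall t, 0 < t < 1 ->
    q (a + RtoC t * (z - a))%C = q z).
  { intros z Uz Nz t Ht. transitivity (q (a + RtoC 1 * (z - a))%C); [|f_equal; ring].
    apply cderiv_zero_segment; [lra|]. intros u Hu.
    set (p := (a + RtoC u * (z - a))%C).
    assert (Up : upper_half_plane p) by (apply half_plane_segment; auto; lra).
    assert (Np : p <> a).
    { intro E. assert (X : (RtoC u * (z - a))%C = 0%C).
      { replace (RtoC u * (z - a))%C with (p - a)%C by (unfold p; ring). rewrite E. ring. }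
      revert X. apply Cmult_neq_0; [|now apply Csub_neq_0].
      intro X. apply (f_equal fst) in X. simpl in X. lra. }
    destruct (DG p Up) as [e1 E1]. destruct (DH p Up) as [e2 E2].
    assert (NHp : H p <> 0%C) by (intro E; apply Np; auto).
    assert (E3 := cderiv_mult _ _ _ _ _ E1 (cderiv_inv _ _ _ E2 NHp)). cbv beta in E3.
    set (e := (e1 * / H p + _)%C) in E3.
    assert (P : 0 < Cmod (p - a)) by (apply Cmod_gt_0; now apply Csub_neq_0).
    assert (e = 0%C) as <-.
    { apply (cderiv_unimodular q p e (Rmin (Im p) (Cmod (p - a)))); auto.
      - apply Rmin_pos; auto.
      - intros h Hh. apply Hq1.
        + apply (half_plane_open p). eapply Rlt_le_trans; [exact Hh|apply Rmin_l].
        + intros ->. rewrite Cmod_sub_comm in Hh.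
          assert (X := Rmin_r (Im p) (Cmod (p - a))). lra. }
    exact E3. }
  assert (Hq : forall z, upper_half_plane z -> z <> a -> q z = rho).
  { intros z Uz Nz.
    assert (Crho : ccont (fun h => qG h * / qH h)%C a) by (apply ccont_mult; auto; now apply ccont_inv).
    assert (Small : forall eps, 0 < eps -> Cmod (q z - rho) < eps).
    { intros eps He. destruct (Crho eps He) as [del [Hdel HC]].
      assert (P : 0 < Cmod (z - a)) by (apply Cmod_gt_0; now apply Csub_neq_0).
      set (m := Rmin (Rmin r1 r2) (Rmin r3 del)).
      assert (Hm : 0 < m) by (repeat apply Rmin_pos; auto).
      set (t := Rmin (1 / 2) (m / (2 * Cmod (z - a)))).
      assert (Ht : 0 < t) by (apply Rmin_pos; [lra|apply Rdiv_lt_0_compat; lra]).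
      assert (Ht1 : t <= 1 / 2) by apply Rmin_l.
      assert (Ht2 : t * (2 * Cmod (z - a)) <= m).
      { apply Rle_div_r; [lra|]. apply Rmin_r. }
      rewrite <- (Hray z Uz Nz t) by lra.
      set (p := (a + RtoC t * (z - a))%C).
      assert (Ep : (p - a = RtoC t * (z - a))%C) by (unfold p; ring).
      assert (Hp : Cmod (p - a) < m).
      { rewrite Ep, Cmod_mult, Cmod_R, Rabs_pos_eq by lra. nra. }
      assert (L1 := Rmin_l (Rmin r1 r2) (Rmin r3 del)). assert (L2 := Rmin_r (Rmin r1 r2) (Rmin r3 del)).
      assert (L3 := Rmin_l r1 r2). assert (L4 := Rmin_r r1 r2).
      assert (L5 := Rmin_l r3 del). assert (L6 := Rmin_r r3 del). fold m in L1, L2.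
      assert (Np : (p - a)%C <> 0%C).
      { rewrite Ep. apply Cmult_neq_0; [|now apply Csub_neq_0].
        intro X. apply (f_equal fst) in X. simpl in X. lra. }
      replace (q p) with (qG p * / qH p)%C; [apply HC; lra|].
      assert (FG' : G p = (G a + qG p * (p - a))%C) by (apply FG; lra).
      assert (FH' : H p = (H a + qH p * (p - a))%C) by (apply FH; lra).
      unfold q. rewrite FG', FH', G0, H0.
      field. split; [|apply NH; lra]. exact Np. }
    apply NNPP. intro N. apply Csub_neq_0, Cmod_gt_0 in N.
    specialize (Small _ N). lra. }
  exists a, rho. split; auto. split.
  - assert (U : upper_half_plane (a + Ci)%C).
    { clear - Ua. destruct a. unfold upper_half_plane in *. simpl in *. lra. }
    assert (N : (a + Ci)%C <> a).
    { intro E. apply (f_equal snd) in E. simpl in E. lra. }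
    rewrite <- (Hq _ U N). now apply Hq1.
  - intros z Uz. fold b. change (G z = (rho * H z)%C).
    destruct (classic (z = a)) as [->|N].
    + rewrite G0, H0. ring.
    + rewrite <- (Hq z Uz N). unfold q. field. intro E. apply N. auto.
Qed.

End HalfPlaneAutomorphism.

(** * Recognizing the identity by its boundary values *)

Lemma half_plane_neq_conj (a : C) : upper_half_plane a -> (a - Cconj a)%C <> 0%C.
Proof. intros Ha. apply mobius_denominator; auto. now left. Qed.

Lemma mobius_neq_1 (a z : C) :
  upper_half_plane a -> 0 <= Im z -> (1 - mobius a z)%C <> 0%C.
Proof.
  intros Ha Hz. assert (N := mobius_denominator a z Ha Hz).
  replace (1 - mobius a z)%C with ((a - Cconj a) * / (z - Cconj a))%C
    by (unfold mobius; field; exact N).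
  apply Cmult_neq_0; [now apply half_plane_neq_conj|].
  intro E. assert (X : ((z - Cconj a) * / (z - Cconj a))%C = 1%C) by (field; exact N).
  rewrite E in X. apply (f_equal fst) in X. simpl in X. lra.
Qed.

Lemma mobius_inverse (a z : C) :
  upper_half_plane a -> 0 <= Im z ->
  ((a - mobius a z * Cconj a) / (1 - mobius a z))%C = z.
Proof.
  intros Ha Hz. assert (N := mobius_denominator a z Ha Hz).
  assert (N1 := half_plane_neq_conj a Ha).
  replace (1 - mobius a z)%C with ((a - Cconj a) / (z - Cconj a))%C
    by (unfold mobius; field; exact N).
  unfold mobius. field. auto.
Qed.

(** The inversion formula for [mobius b] applied to k gives a point p; since conj k = 1 / k, it
    equals its own conjugate. *)
Lemma mobius_circle_real (b k : C) :
  upper_half_plane b -> Cmod k = 1 -> k <> 1%C -> exists p : R, mobius b (RtoC p) = k.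
Proof.
  intros Ub Hk Nk.
  assert (N1 : (1 - k)%C <> 0%C) by (apply Csub_neq_0; auto).
  set (p := ((b - k * Cconj b) / (1 - k))%C).
  assert (Hk2 : (k * Cconj k)%C = 1%C) by (rewrite <- Cmod2_conj, Hk; unfold RtoC; f_equal; ring).
  assert (N2 : (1 - Cconj k)%C <> 0%C).
  { intro E. apply N1. replace (1 - k)%C with (- (k * (1 - Cconj k)))%C.
    - rewrite E. ring.
    - replace (k * (1 - Cconj k))%C with (k - k * Cconj k)%C by ring. rewrite Hk2. ring. }
  assert (Ep : Cconj p = p).
  { unfold p. rewrite Cdiv_conj by exact N1.
    rewrite !Cminus_conj, Cmult_conj, Cconj_conj.
    replace (Cconj 1) with (RtoC 1) by (unfold Cconj, RtoC; simpl; f_equal; ring).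
    assert (X : ((Cconj b - Cconj k * b) * (1 - k) = (b - k * Cconj b) * (1 - Cconj k))%C).
    { transitivity (Cconj b - Cconj k * b - k * Cconj b + (k * Cconj k) * b)%C; [ring|].
      rewrite Hk2. transitivity (b - k * Cconj b - Cconj k * b + (k * Cconj k) * Cconj b)%C; [|ring].
      rewrite Hk2. ring. }
    replace ((Cconj b - Cconj k * b) / (1 - Cconj k))%C
      with ((Cconj b - Cconj k * b) * (1 - k) / ((1 - k) * (1 - Cconj k)))%C by (field; auto).
    rewrite X. field. auto. }
  assert (Rp : p = RtoC (fst p)).
  { assert (E := f_equal snd Ep). destruct p as [p1 p2]. simpl in E |- *.
    unfold RtoC. f_equal. lra. }
  exists (fst p). rewrite <- Rp.
  assert (Nb := half_plane_neq_conj b Ub).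
  unfold mobius, p. field. split; auto.
  replace (b - k * Cconj b - Cconj b * (1 - k))%C with (b - Cconj b)%C by ring. auto.
Qed.

Lemma mobius_vertical_limit (b : C) (p eps : R) :
  upper_half_plane b -> 0 < eps -> exists del, 0 < del /\
    forall y, 0 < y < del -> Cmod (mobius b (p, y) - mobius b (RtoC p)) < eps.
Proof.
  intros Ub He.
  destruct (cderiv_mobius_comp b (fun h => h) (RtoC p) 1) as [e [D _]]; auto.
  { simpl. lra. } { apply cderiv_id. }
  apply cderiv_ccont in D. destruct (D eps He) as [del [Hd H]].
  exists del. split; auto. intros y Hy. apply H.
  replace ((p, y) - RtoC p)%C with (RtoC y * Ci)%C
    by (unfold Cminus, Cplus, Copp, RtoC, Cmult, Ci; simpl; f_equal; ring).
  rewrite Cmod_mult, Cmod_Ci, Cmod_R, Rabs_pos_eq; lra.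
Qed.

Lemma mobius_infinity_limit (b : C) (eps : R) :
  upper_half_plane b -> 0 < eps -> exists Y, 0 < Y /\
    forall y, Y < y -> Cmod (mobius b (0, y) - 1) < eps.
Proof.
  intros Ub He. assert (Nb := half_plane_neq_conj b Ub).
  set (A := Cmod (b - Cconj b)). assert (HA : 0 < A) by now apply Cmod_gt_0.
  exists (A / eps). split; [now apply Rdiv_lt_0_compat|]. intros y Hy.
  assert (HAe : 0 < A / eps) by now apply Rdiv_lt_0_compat.
  assert (N : ((0%R, y) - Cconj b)%C <> 0%C) by (apply mobius_denominator; auto; simpl; lra).
  replace (mobius b (0, y) - 1)%C with (- ((b - Cconj b) / ((0%R, y) - Cconj b)))%C
    by (unfold mobius; field; exact N).
  rewrite Cmod_opp, Cmod_div by exact N. fold A.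
  assert (X : y <= Cmod ((0%R, y) - Cconj b)).
  { eapply Rle_trans; [|apply Rabs_im_le_Cmod]. destruct b. unfold upper_half_plane in Ub.
    simpl in *. rewrite Rabs_pos_eq; lra. }
  apply Rlt_div_l; [lra|]. apply Rlt_div_l in Hy; [|auto]. nra.
Qed.

Section IdentityFromBoundary.

Variables phi eta : C -> C.
Hypothesis phi_half_plane : forall z, upper_half_plane z -> upper_half_plane (phi z).
Hypothesis phi_cderiv : forall z, upper_half_plane z -> exists d, cderiv phi z d.
Hypothesis eta_half_plane : forall z, upper_half_plane z -> upper_half_plane (eta z).
Hypothesis eta_phi : forall z, upper_half_plane z -> eta (phi z) = z.
Hypothesis phi_eta : forall z, upper_half_plane z -> phi (eta z) = z.

(** Only vertical approach is tested. A Möbius map extends continuously to the boundary, so one path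
    decides its boundary value, and on vertical lines the logarithmic sum has explicit limits even
    at its singularities. *)
Definition tends_at_real (g : C -> C) (p : R) (l : C) : Prop :=
  forall eps, 0 < eps -> exists del, 0 < del /\
    forall y, 0 < y < del -> Cmod (g (p, y) - l) < eps.

Definition tends_at_infinity (g : C -> C) (l : C) : Prop :=
  forall eps, 0 < eps -> exists Y, 0 < Y /\
    forall y, Y < y -> Cmod (g (0, y) - l) < eps.

Definition blows_up_at_real (g : C -> C) (p : R) : Prop :=
  forall M, exists del, 0 < del /\ forall y, 0 < y < del -> M < Cmod (g (p, y)).

Hypothesis fix_0 : forall p, tends_at_real eta p (RtoC 0) -> p = 0.
Hypothesis fix_1 : forall p, tends_at_real eta p (RtoC 1) -> p = 1.
Hypothesis not_0 : ~ tends_at_infinity eta (RtoC 0).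
Hypothesis not_1 : ~ tends_at_infinity eta (RtoC 1).
Hypothesis fix_infinity : forall p, ~ blows_up_at_real eta p.

(** The Möbius map eta sends some boundary point to x, for x = 0 and x = 1. It is not infinity by
    [not_0] and [not_1], so it is real, and [fix_0], [fix_1] identify it with x; this gives mobius b
    x = rho mobius a x. If rho differed from 1, the real point p with mobius b p = rho would be a
    pole of eta. With rho = 1 the two equations at 0 and 1 force a = b. *)
Lemma automorphism_identity (z : C) : upper_half_plane z -> phi z = z.
Proof.
  destruct (automorphism_is_mobius phi eta phi_half_plane phi_cderiv eta_half_plane eta_phi phi_eta)
    as (a & rho & Ua & Hrho & E).
  set (b := phi a) in *. assert (Ub : upper_half_plane b) by now apply phi_half_plane.
  assert (Nrho : rho <> 0%C) by (intro X; rewrite X, Cmod_0 in Hrho; lra).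
  assert (Im_ge : forall z, upper_half_plane z -> 0 <= Im z)
    by (unfold upper_half_plane; intros; lra).
  assert (Eeta : forall u, upper_half_plane u -> mobius a (eta u) = (mobius b u * / rho)%C).
  { intros u Uu. assert (X := E (eta u) (eta_half_plane u Uu)). rewrite phi_eta in X by auto.
    rewrite X. field. exact Nrho. }
  (* The inverse of u -> rho mobius a u, so that eta u = B (mobius b u). *)
  set (B := fun m => ((a - (m * / rho) * Cconj a) * / (1 - m * / rho))%C).
  assert (Heta : forall u, upper_half_plane u -> eta u = B (mobius b u)).
  { intros u Uu. rewrite <- (mobius_inverse a (eta u)) at 1; auto.
    rewrite (Eeta u Uu). reflexivity. }
  assert (Up : forall p y, 0 < y -> upper_half_plane (p, y))
    by (intros; unfold upper_half_plane; simpl; lra).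
  assert (key : forall x : R, (forall p, tends_at_real eta p (RtoC x) -> p = x) ->
    ~ tends_at_infinity eta (RtoC x) -> mobius b (RtoC x) = (rho * mobius a (RtoC x))%C).
  { intros x Hfix Hnot.
    assert (Hx : 0 <= Im (RtoC x)) by (simpl; lra).
    set (k := (rho * mobius a (RtoC x))%C).
    assert (Ek : (k * / rho)%C = mobius a (RtoC x)) by (unfold k; field; auto).
    assert (Bk : B k = RtoC x).
    { unfold B. rewrite Ek. now apply mobius_inverse. }
    assert (CB : ccont B k).
    { assert (C1 : ccont (fun m => m * / rho)%C k)
        by (apply ccont_mult; [apply ccont_id|apply ccont_const]).
      apply ccont_mult.
      - apply (ccont_ext_loc (fun m => a + (- Cconj a) * (m * / rho))%C _ _ 1); [lra|intros; ring|].
        apply ccont_plus; [apply ccont_const|]. apply ccont_mult; [apply ccont_const|exact C1].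
      - apply ccont_inv.
        + apply (ccont_ext_loc (fun m => 1 + (- (1)) * (m * / rho))%C _ _ 1); [lra|intros; ring|].
          apply ccont_plus; [apply ccont_const|]. apply ccont_mult; [apply ccont_const|exact C1].
        + rewrite Ek. now apply mobius_neq_1. }
    (* 1 is the value of [mobius b] at infinity, so this case says that eta takes infinity to x. *)
    destruct (classic (k = 1%C)) as [K1|K1].
    - exfalso. apply Hnot. intros eps He. destruct (CB eps He) as [d [Hd Hc]].
      rewrite K1, <- K1, Bk in Hc.
      destruct (mobius_infinity_limit b d Ub Hd) as [Y [HY H]].
      exists Y. split; auto. intros y Hy. rewrite Heta by (apply Up; lra).
      apply Hc. rewrite K1. auto.
    - assert (Hk1 : Cmod k = 1).
      { unfold k. rewrite Cmod_mult, Hrho, Rmult_1_l.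
        assert (S := Cmod_mobius_sqr a (RtoC x) Ua Hx). simpl Im in S.
        rewrite Rmult_0_r in S. unfold Rdiv in S. rewrite Rmult_0_l in S.
        assert (X := Cmod_ge_0 (mobius a (RtoC x))). nra. }
      destruct (mobius_circle_real b k Ub Hk1 K1) as [p Hp].
      assert (p = x) as <-; [|exact Hp].
      apply Hfix. intros eps He. destruct (CB eps He) as [d [Hd Hc]]. rewrite Bk in Hc.
      destruct (mobius_vertical_limit b p d Ub Hd) as [Y [HY H]].
      exists Y. split; auto. intros y Hy. rewrite Heta by (apply Up; lra).
      apply Hc. rewrite <- Hp. auto. }
  assert (K0 := key 0 fix_0 not_0). assert (K1 := key 1 fix_1 not_1).
  assert (R1 : rho = 1%C).
  { apply NNPP. intro N. destruct (mobius_circle_real b rho Ub Hrho N) as [p Hp].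
    apply (fix_infinity p). intro M.
    assert (Na := half_plane_neq_conj a Ua). set (A := Cmod (a - Cconj a)).
    assert (HA : 0 < A) by now apply Cmod_gt_0.
    assert (Ha := Cmod_ge_0 a). assert (HM := Rabs_pos M).
    set (tau := A / (Rabs M + Cmod a + 1)).
    assert (Htau : 0 < tau) by (apply Rdiv_lt_0_compat; lra).
    destruct (mobius_vertical_limit b p tau Ub Htau) as [Y [HY H]].
    exists Y. split; auto. intros y Hy. specialize (H y Hy).
    assert (U : upper_half_plane (p, y)) by (apply Up; lra).
    set (m := mobius a (eta (p, y))).
    assert (Em : Cmod (1 - m) < tau).
    { unfold m. rewrite (Eeta _ U).
      replace (1 - mobius b (p, y) * / rho)%C with ((rho - mobius b (p, y)) * / rho)%C by (field; auto).
      rewrite Cmod_mult, Cmod_inv, Hrho, Rinv_1, Rmult_1_r by auto.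
      rewrite Cmod_sub_comm, <- Hp. exact H. }
    assert (Ez : (eta (p, y) * (1 - m) = (a - Cconj a) + (1 - m) * Cconj a)%C).
    { rewrite <- (mobius_inverse a (eta (p, y))) at 1 by auto. fold m. field.
      apply mobius_neq_1; auto. }
    assert (T : A <= Cmod (1 - m) * (Cmod (eta (p, y)) + Cmod a)).
    { replace (Cmod (1 - m) * (Cmod (eta (p, y)) + Cmod a))
        with (Cmod (eta (p, y) * (1 - m)) + Cmod ((1 - m) * Cconj a))
        by (rewrite !Cmod_mult, Cmod_conj; ring).
      unfold A. replace (a - Cconj a)%C with (eta (p, y) * (1 - m) - (1 - m) * Cconj a)%C
        by (rewrite Ez; ring).
      unfold Cminus at 1. eapply Rle_trans; [apply Cmod_triangle|]. rewrite Cmod_opp. lra. }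
    assert (Q : tau * (Rabs M + Cmod a + 1) = A) by (unfold tau; field; lra).
    assert (X := Cmod_ge_0 (eta (p, y))). assert (X2 := Cmod_ge_0 (1 - m)).
    assert (Rabs M < Cmod (eta (p, y))) by nra.
    assert (Y2 := Rle_abs M). lra. }
  rewrite R1, Cmult_1_l in K0, K1. cbv beta in K0, K1.
  assert (Ea : b = a).
  { assert (N1 := mobius_denominator a 0 Ua ltac:(simpl; lra)).
    assert (N2 := mobius_denominator b 0 Ub ltac:(simpl; lra)).
    assert (N3 := mobius_denominator a 1 Ua ltac:(simpl; lra)).
    assert (N4 := mobius_denominator b 1 Ub ltac:(simpl; lra)).
    assert (N1' : Cconj a <> 0%C) by (intro X; apply N1; rewrite X; ring).
    assert (N2' : Cconj b <> 0%C) by (intro X; apply N2; rewrite X; ring).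
    assert (P0 : ((0 - b) * (0 - Cconj a) = (0 - a) * (0 - Cconj b))%C).
    { transitivity (mobius b 0 * ((0 - Cconj b) * (0 - Cconj a)))%C; [unfold mobius; field; auto|].
      rewrite K0. unfold mobius. field. auto. }
    assert (P1 : ((1 - b) * (1 - Cconj a) = (1 - a) * (1 - Cconj b))%C).
    { transitivity (mobius b 1 * ((1 - Cconj b) * (1 - Cconj a)))%C; [unfold mobius; field; auto|].
      rewrite K1. unfold mobius. field. auto. }
    clear - P0 P1 Ua Ub. destruct a as [a1 a2], b as [b1 b2].
    unfold upper_half_plane in *. simpl in *.
    apply (f_equal snd) in P0. apply (f_equal snd) in P1. simpl in P0, P1.
    assert (b2 = a2) by lra. subst. f_equal. nra. }
  intros Uz. assert (X := E z Uz). rewrite R1, Cmult_1_l, Ea in X.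
  rewrite <- (mobius_inverse a (phi z)) by auto. rewrite X. now apply mobius_inverse; auto.
Qed.

End IdentityFromBoundary.

(** * Sums of logarithms in the upper half-plane *)

(** The lemmas on [wsum] ask for information on f at indices of positive weight only: the end nodes
    0 and 1 may have weight zero, and f, a logarithm or an inverse, may then be evaluated at its
    singularity. *)
Definition wsum (a : nat -> R) (N : nat) (f : nat -> R) : R :=
  sum_f_R0 (fun k => a k * f k) N.

Lemma wsum_S (a : nat -> R) (N : nat) (f : nat -> R) :
  wsum a (S N) f = wsum a N f + a (S N) * f (S N).
Proof. reflexivity. Qed.

Lemma wsum_le (a : nat -> R) (N : nat) (f g : nat -> R) :
  (forall k, 0 <= a k) -> (forall k, (k <= N)%nat -> 0 < a k -> f k <= g k) ->
  wsum a N f <= wsum a N g.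
Proof.
  intros Ha H. apply sum_Rle. intros k Hk. destruct (Ha k) as [P|<-]; [|lra].
  apply Rmult_le_compat_l; [lra|auto].
Qed.

Lemma wsum_ext (a : nat -> R) (N : nat) (f g : nat -> R) :
  (forall k, 0 <= a k) -> (forall k, (k <= N)%nat -> 0 < a k -> f k = g k) ->
  wsum a N f = wsum a N g.
Proof.
  intros Ha H. apply sum_eq. intros k Hk. destruct (Ha k) as [P|<-]; [|lra].
  now rewrite H.
Qed.

Lemma wsum_lt_at (a : nat -> R) (N j : nat) (f g : nat -> R) :
  (forall k, 0 <= a k) -> (forall k, (k <= N)%nat -> 0 < a k -> f k <= g k) ->
  (j <= N)%nat -> 0 < a j -> f j < g j -> wsum a N f < wsum a N g.
Proof.
  intros Ha. induction N as [|N IH]; intros H Hj P Hlt.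
  - replace j with 0%nat in * by lia. now apply Rmult_lt_compat_l.
  - assert (Hle : wsum a N f <= wsum a N g) by (apply wsum_le; auto).
    unfold wsum in *. simpl. destruct (Nat.eq_dec j (S N)) as [->|Ne].
    + assert (X : a (S N) * f (S N) < a (S N) * g (S N)) by now apply Rmult_lt_compat_l. lra.
    + assert (X := IH ltac:(auto) ltac:(lia) P Hlt).
      destruct (Ha (S N)) as [Q|<-]; [|lra].
      assert (Y : a (S N) * f (S N) <= a (S N) * g (S N)) by (apply Rmult_le_compat_l; auto; lra).
      lra.
Qed.

Lemma wsum_lt (a : nat -> R) (N : nat) (f g : nat -> R) :
  (forall k, 0 <= a k) -> (exists k, (k <= N)%nat /\ 0 < a k) ->
  (forall k, (k <= N)%nat -> 0 < a k -> f k < g k) ->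
  wsum a N f < wsum a N g.
Proof.
  intros Ha [k [Hk P]] H. apply (wsum_lt_at a N k); auto. intros. left. auto.
Qed.

Lemma wsum_const (a : nat -> R) (N : nat) (c : R) :
  wsum a N (fun _ => c) = sum_f_R0 a N * c.
Proof. unfold wsum. induction N; simpl; [ring|rewrite IHN; ring]. Qed.

Lemma wsum_plus (a : nat -> R) (N : nat) (f g : nat -> R) :
  wsum a N (fun k => f k + g k) = wsum a N f + wsum a N g.
Proof. unfold wsum. induction N; simpl; [ring|rewrite IHN; ring]. Qed.

Lemma wsum_scal (a : nat -> R) (N : nat) (c : R) (f : nat -> R) :
  wsum a N (fun k => c * f k) = c * wsum a N f.
Proof. unfold wsum. induction N; simpl; [ring|rewrite IHN; ring]. Qed.

Lemma wsum_filterlim {T : Type} (F : (T -> Prop) -> Prop) {FF : Filter F}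
    (a : nat -> R) (N : nat) (f : nat -> T -> R) (l : nat -> R) :
  (forall k, 0 <= a k) ->
  (forall k, (k <= N)%nat -> 0 < a k -> filterlim (f k) F (locally (l k))) ->
  filterlim (fun t => wsum a N (fun k => f k t)) F (locally (wsum a N l)).
Proof.
  intros Ha H.
  assert (Hterm : forall k, (k <= N)%nat ->
    filterlim (fun t => a k * f k t) F (locally (a k * l k))).
  { intros k Hk. destruct (Ha k) as [P|P].
    - apply (filterlim_comp _ _ _ (f k) (fun r => a k * r) F (locally (l k))); auto.
      apply (filterlim_scal_r (V := R_NormedModule)).
    - rewrite <- P. apply (filterlim_ext (fun _ => 0)); [intros; ring|].
      rewrite Rmult_0_l. apply filterlim_const. }
  clear H. unfold wsum. induction N as [|N IH]; simpl.
  - apply Hterm. lia.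
  - apply (filterlim_comp_2 (G := locally (sum_f_R0 (fun k => a k * l k) N))
      (H := locally (a (S N) * l (S N)))); auto.
    apply (filterlim_plus (V := R_NormedModule)).
Qed.

Lemma is_derive_wsum (a : nat -> R) (N : nat) (f : nat -> R -> R) (df : nat -> R) (t : R) :
  (forall k, 0 <= a k) ->
  (forall k, (k <= N)%nat -> 0 < a k -> is_derive (f k) t (df k)) ->
  is_derive (fun s => wsum a N (fun k => f k s)) t (wsum a N df).
Proof.
  intros Ha H.
  assert (Hterm : forall k, (k <= N)%nat -> is_derive (fun s => a k * f k s) t (a k * df k)).
  { intros k Hk. destruct (Ha k) as [P|P].
    - apply is_derive_scal; auto.
    - rewrite <- P. apply (is_derive_ext (fun _ => 0)); [intros; simpl; ring|].
      rewrite Rmult_0_l. apply (is_derive_const (V := R_NormedModule) 0). }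
  clear H. unfold wsum. induction N as [|N IH]; simpl.
  - apply Hterm. lia.
  - apply (is_derive_plus (V := R_NormedModule)); auto.
Qed.

(* [lnmod] and [angle] are the real and imaginary parts of the logarithm in the
   upper half-plane; [step] is the boundary value of [angle] on the real line. *)
Definition lnmod (t y : R) : R := ln (t ^ 2 + y ^ 2) / 2.
Definition angle (t y : R) : R := PI / 2 - atan (t / y).
Definition step (t : R) : R :=
  if Rlt_dec t 0 then PI else if Rlt_dec 0 t then 0 else PI / 2.

Lemma sum_squares_pos (t y : R) : t <> 0 \/ y <> 0 -> 0 < t ^ 2 + y ^ 2.
Proof.
  intros [H|H]; apply pow2_gt_0 in H; [assert (X := pow2_ge_0 y)|assert (X := pow2_ge_0 t)]; lra.
Qed.

Lemma angle_bounds (t y : R) : 0 < angle t y < PI.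
Proof. unfold angle. assert (X := atan_bound (t / y)). lra. Qed.

Lemma angle_decreasing (t t' y : R) : 0 < y -> t < t' -> angle t' y < angle t y.
Proof.
  intros Hy H. unfold angle. assert (X : atan (t / y) < atan (t' / y)); [|lra].
  apply atan_increasing. apply Rmult_lt_compat_r; auto. now apply Rinv_0_lt_compat.
Qed.

Lemma angle_step (t y : R) : t <> 0 -> 0 < y -> angle t y = step t + atan (y / t).
Proof.
  intros Ht Hy. unfold angle, step.
  destruct (Rlt_dec t 0) as [L|L].
  - replace (y / t) with (- / (- t / y)) by (field; lra).
    rewrite atan_opp, atan_inv.
    + replace (- t / y) with (- (t / y)) by (field; lra). rewrite atan_opp. lra.
    + apply Rdiv_lt_0_compat; lra.
  - destruct (Rlt_dec 0 t); [|lra].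
    replace (y / t) with (/ (t / y)) by (field; lra). rewrite atan_inv; [lra|].
    apply Rdiv_lt_0_compat; lra.
Qed.

(** Above its own singularity the angle is constantly PI / 2, the mean of the two one-sided boundary
    values. With this value of [step 0] vertical limits of the angle are described by [step] at
    every real point. *)
Lemma angle_at_zero (y : R) : angle 0 y = step 0.
Proof.
  unfold angle, step. rewrite Rdiv_0_l, atan_0.
  destruct (Rlt_dec 0 0); lra.
Qed.

Definition upper_near (e : R) : (R * R -> Prop) -> Prop :=
  within (fun p : R * R => 0 < snd p) (locally ((e, 0) : R * R)).

Global Instance upper_near_filter (e : R) : Filter (upper_near e).
Proof. apply within_filter, locally_filter. Qed.

Lemma upper_near_intro (e del : R) (P : R * R -> Prop) :
  0 < del -> (forall t y, Rabs (t - e) < del -> 0 < y < del -> P (t, y)) -> upper_near e P.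
Proof.
  intros Hd H. exists (mkposreal del Hd). intros [t y] [B1 B2] Hy. simpl in B1, B2, Hy.
  apply H; auto. split; auto.
  change (Rabs (y - 0) < del) in B2. rewrite Rminus_0_r in B2.
  apply Rabs_def2 in B2. lra.
Qed.

Lemma upper_near_elim (e : R) (P : R * R -> Prop) :
  upper_near e P ->
  exists del, 0 < del /\ forall t y, Rabs (t - e) < del -> 0 < y < del -> P (t, y).
Proof.
  intros [del H]. exists del. split; [apply cond_pos|]. intros t y Ht Hy.
  apply H; [|apply Hy]. split; [exact Ht|].
  change (Rabs (y - 0) < del). rewrite Rminus_0_r, Rabs_pos_eq; lra.
Qed.

Lemma lnmod_upper_near (e s : R) : e <> s ->
  filterlim (fun p : R * R => lnmod (fst p - s) (snd p)) (upper_near e)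
    (locally (lnmod (e - s) 0)).
Proof.
  intros Hne.
  apply (filterlim_filter_le_1 (F := locally ((e, 0) : R * R))).
  { intros P H. now apply filter_le_within. }
  change (continuous (fun p : R * R => lnmod (fst p - s) (snd p)) ((e, 0) : R * R)).
  unfold lnmod.
  apply (continuous_mult (fun p : R * R => ln ((fst p - s) ^ 2 + snd p ^ 2)) (fun _ => / 2));
    [|apply continuous_const].
  apply (continuous_comp (fun p : R * R => (fst p - s) ^ 2 + snd p ^ 2) ln).
  - apply (continuous_plus (V := R_NormedModule)).
    + apply (continuous_comp (fun p : R * R => fst p) (fun r => (r - s) ^ 2)).
      * apply continuous_fst.
      * apply continuity_pt_filterlim. simpl. reg.
    + apply (continuous_comp (fun p : R * R => snd p) (fun r => r ^ 2)).
      * apply continuous_snd.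
      * apply continuity_pt_filterlim. simpl. reg.
  - apply continuity_pt_filterlim. apply derivable_continuous_pt.
    exists (/ ((e - s) ^ 2 + 0 ^ 2)). apply derivable_pt_lim_ln. simpl fst; simpl snd.
    apply sum_squares_pos. left. lra.
Qed.

Lemma step_locally_constant (t t' : R) : Rabs (t' - t) < Rabs t -> step t' = step t.
Proof.
  intros H. unfold step. unfold Rabs in H.
  destruct (Rcase_abs (t' - t)), (Rcase_abs t);
  destruct (Rlt_dec t' 0), (Rlt_dec t 0), (Rlt_dec 0 t'), (Rlt_dec 0 t); lra.
Qed.

Lemma angle_upper_near (e s : R) : e <> s ->
  filterlim (fun p : R * R => angle (fst p - s) (snd p)) (upper_near e)
    (locally (step (e - s))).
Proof.
  intros Hne. apply filterlim_locally. intros eps.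
  assert (Hs : 0 < Rabs (e - s)) by (apply Rabs_pos_lt; lra).
  assert (C0 : continuity_pt atan 0).
  { apply derivable_continuous_pt. exists (/ (1 + 0 ^ 2)). apply derivable_pt_lim_atan. }
  destruct (C0 eps (cond_pos eps)) as [m [Hm Hc]].
  set (A := Rabs (e - s) / 2).
  apply (upper_near_intro e (Rmin A (m * A))).
  { apply Rmin_pos; unfold A; [lra|]. apply Rmult_lt_0_compat; lra. }
  intros t y Ht Hy.
  assert (L1 := Rmin_l A (m * A)). assert (L2 := Rmin_r A (m * A)).
  assert (Hts : A < Rabs (t - s)).
  { assert (T := Rabs_triang_inv (e - s) (e - t)).
    replace (e - s - (e - t)) with (t - s) in T by ring.
    rewrite (Rabs_minus_sym e t) in T. unfold A in *. lra. }
  assert (Hts0 : t - s <> 0) by (intro E; rewrite E, Rabs_R0 in Hts; unfold A in Hts; lra).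
  simpl fst; simpl snd. change (Rabs (angle (t - s) y - step (e - s)) < eps).
  rewrite angle_step by (auto; lra).
  rewrite (step_locally_constant (e - s) (t - s)).
  2:{ replace (t - s - (e - s)) with (t - e) by ring. unfold A in *. lra. }
  replace (step (e - s) + atan (y / (t - s)) - step (e - s)) with (atan (y / (t - s)) - atan 0)
    by (rewrite atan_0; ring).
  assert (Hq : Rabs (y / (t - s) - 0) < m).
  { rewrite Rminus_0_r. unfold Rdiv. rewrite Rabs_mult, Rabs_inv, (Rabs_pos_eq y) by lra.
    apply Rlt_div_l; [lra|]. apply Rlt_le_trans with (m * A); [lra|].
    apply Rmult_le_compat_l; lra. }
  destruct (Req_dec (y / (t - s)) 0) as [E|N].
  - rewrite E, Rminus_diag, Rabs_R0. apply cond_pos.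
  - apply Hc. split; auto. split; auto. exact Logic.I.
Qed.

Lemma lnmod_at_origin (M : R) : exists del, 0 < del /\
  forall t y, Rabs t < del -> 0 < y < del -> lnmod t y < M.
Proof.
  exists (Rmin (1 / 2) (exp (2 * M))). assert (P := exp_pos (2 * M)).
  split; [apply Rmin_pos; lra|]. intros t y Ht Hy.
  assert (L1 := Rmin_l (1 / 2) (exp (2 * M))). assert (L2 := Rmin_r (1 / 2) (exp (2 * M))).
  unfold lnmod. assert (X : ln (t ^ 2 + y ^ 2) < 2 * M); [|lra].
  rewrite <- (ln_exp (2 * M)). apply ln_increasing.
  - apply sum_squares_pos. right. lra.
  - rewrite <- (pow2_abs t). assert (Y := Rabs_pos t).
    assert (T : Rabs t < 1 / 2) by lra. assert (T' : y < 1 / 2) by lra.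
    assert (Rabs t ^ 2 <= Rabs t * (1 / 2)) by nra.
    assert (y ^ 2 < y * (1 / 2)) by nra. lra.
Qed.

Lemma lnmod_le (t y : R) : t <> 0 \/ y <> 0 -> lnmod t y <= t ^ 2 + y ^ 2.
Proof.
  intros H. apply sum_squares_pos in H. unfold lnmod.

  assert (ln (t ^ 2 + y ^ 2) <= t ^ 2 + y ^ 2); [|lra].
  assert (Y := exp_ineq1_le (ln (t ^ 2 + y ^ 2))). rewrite exp_ln in Y by auto. lra.
Qed.

Lemma lnmod_ge (t y : R) : 0 < y -> ln y <= lnmod t y.
Proof.
  intros Hy. unfold lnmod. assert (X : ln (y ^ 2) <= ln (t ^ 2 + y ^ 2)).
  { apply ln_le; [apply pow_lt; auto|]. assert (Y := pow2_ge_0 t). lra. }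
  assert (E : ln (y ^ 2) = ln y + ln y) by (rewrite <- ln_mult by auto; f_equal; ring). lra.
Qed.

Lemma cderiv_log (s x y : R) : 0 < y ->
  cderiv (fun z => (lnmod (fst z - s) (snd z), angle (fst z - s) (snd z))) (x, y)
    ((x - s) / ((x - s) ^ 2 + y ^ 2), - y / ((x - s) ^ 2 + y ^ 2)).
Proof.
  intros Hy.
  assert (P : forall t y, y <> 0 -> (t - s) ^ 2 + y ^ 2 <> 0).
  { intros t y' H. apply Rgt_not_eq, sum_squares_pos. now right. }
  assert (Cfst : continuous (fun u : R * R => fst u - s) ((x, y) : R * R)).
  { apply (continuous_minus (V := R_NormedModule)); [apply continuous_fst|apply continuous_const]. }
  assert (Cden : continuous (fun u : R * R => / ((fst u - s) ^ 2 + snd u ^ 2)) ((x, y) : R * R)).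
  { apply (continuous_comp (fun u : R * R => (fst u - s) ^ 2 + snd u ^ 2) Rinv).
    - apply (continuous_plus (V := R_NormedModule)).
      + apply (continuous_comp (fun u : R * R => fst u - s) (fun r => r ^ 2)); auto.
        apply continuity_pt_filterlim. simpl. reg.
      + apply (continuous_comp (fun u : R * R => snd u) (fun r => r ^ 2)); [apply continuous_snd|].
        apply continuity_pt_filterlim. simpl. reg.
    - apply continuous_Rinv. simpl fst; simpl snd. apply P. lra. }
  apply (cderiv_cauchy_riemann (fun x y => lnmod (x - s) y) (fun x y => angle (x - s) y)).
  - replace (- (- y / ((x - s) ^ 2 + y ^ 2))) with (y / ((x - s) ^ 2 + y ^ 2))
      by (field; apply P; lra).
    apply (differentiable_pt_lim_of_partials _ (fun x y => (x - s) / ((x - s) ^ 2 + y ^ 2)) x y _ y); auto.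
    + intros p q _ Hq. assert (Q : q <> 0) by (apply Rabs_def2 in Hq; lra).
      unfold lnmod. auto_derive; [|field; now apply P].
      apply sum_squares_pos. now right.
    + unfold lnmod. auto_derive; [|field; apply P; lra].
      apply sum_squares_pos. right; lra.
    + now apply (continuous_mult (fun u : R * R => fst u - s)).
  - apply (differentiable_pt_lim_of_partials _ (fun x y => - y / ((x - s) ^ 2 + y ^ 2)) x y _ y); auto.
    + intros p q _ Hq. assert (Q : q <> 0) by (apply Rabs_def2 in Hq; lra).
      unfold angle. auto_derive; auto. field. auto.
    + unfold angle. auto_derive; [lra|]. field. split; [apply P|]; lra.
    + apply (continuous_mult (fun u : R * R => - snd u)); auto.
      apply (continuous_opp (V := R_NormedModule)), continuous_snd.
Qed.

Lemma upper_near_eps (e : R) (f : R * R -> R) (l eps : R) :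
  filterlim f (upper_near e) (locally l) -> 0 < eps ->
  exists del, 0 < del /\
    forall t y, Rabs (t - e) < del -> 0 < y < del -> Rabs (f (t, y) - l) < eps.
Proof.
  intros H He. apply (upper_near_elim e (fun p => Rabs (f p - l) < eps)).
  apply (proj1 (filterlim_locally f l) H (mkposreal eps He)).
Qed.

Lemma filterlim_plus_const {T : Type} (F : (T -> Prop) -> Prop) {FF : Filter F}
    (f : T -> R) (l c : R) :
  filterlim f F (locally l) -> filterlim (fun t => f t + c) F (locally (l + c)).
Proof.
  intros H. apply (filterlim_comp_2 (G := locally l) (H := locally c)); auto.
  - apply filterlim_const.
  - apply (filterlim_plus (V := R_NormedModule)).
Qed.

Lemma atan_le_self (s : R) : 0 <= s -> atan s <= s.
Proof.
  intros [Hs|<-]; [|rewrite atan_0; lra].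
  destruct (MVT_cor2 atan (fun r => / (1 + r ^ 2)) 0 s Hs) as [c [E Hc]].
  { intros. apply derivable_pt_lim_atan. }
  rewrite atan_0 in E.
  assert (/ (1 + c ^ 2) <= / 1) by (apply Rinv_le_contravar; [lra|assert (X := pow2_ge_0 c); lra]).
  rewrite Rinv_1 in *. nra.
Qed.

Lemma angle_le (t y : R) : 0 < t -> 0 < y -> angle t y <= y / t.
Proof.
  intros Ht Hy. rewrite angle_step by lra. unfold step.
  destruct (Rlt_dec t 0); [lra|]. destruct (Rlt_dec 0 t); [|lra].
  rewrite Rplus_0_l. apply atan_le_self. left. now apply Rdiv_lt_0_compat.
Qed.

Lemma angle_opp (t y : R) : angle (- t) y = PI - angle t y.
Proof.
  unfold angle. replace (- t / y) with (- (t / y)) by (unfold Rdiv; ring).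
  rewrite atan_opp. lra.
Qed.

Lemma finitely_many_bounded (x : nat -> R) (N : nat) :
  exists B, 0 < B /\ forall k, (k <= N)%nat -> Rabs (x k) <= B.
Proof.
  induction N as [|N [B [HB H]]].
  - exists (Rabs (x 0%nat) + 1). assert (X := Rabs_pos (x 0%nat)). split; [lra|].
    intros k Hk. replace k with 0%nat by lia. lra.
  - exists (B + Rabs (x (S N))). assert (X := Rabs_pos (x (S N))). split; [lra|].
    intros k Hk. destruct (Nat.eq_dec k (S N)) as [->|]; [lra|].
    specialize (H k ltac:(lia)). lra.
Qed.

(** * Weighted sums of logarithms: boundary values, injectivity and range *)

Section LogSum.

Variables (N : nat) (a x : nat -> R) (c0 v0 : R).
Hypothesis Ha : forall k, 0 <= a k.
Hypothesis Hpos : exists k, (k <= N)%nat /\ 0 < a k.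

(** With [lsv], the real and imaginary parts of the sum of a_k ln (z - x_k), plus c0 - i v0. *)
Definition lsu (X Y : R) : R := wsum a N (fun k => lnmod (X - x k) Y) + c0.
Definition lsv (X Y : R) : R := wsum a N (fun k => angle (X - x k) Y) - v0.
Definition logsum (z : C) : C := (lsu (fst z) (snd z), lsv (fst z) (snd z)).

Definition regular (e : R) : Prop := forall k, (k <= N)%nat -> 0 < a k -> e <> x k.
Definition lsv_boundary (e : R) : R := wsum a N (fun k => step (e - x k)) - v0.
(** The derivative of the boundary values of [lsu] along the real line and, by the Cauchy-Riemann
    equations, of [lsv] in the direction of Y at the boundary. *)
Definition lsu_slope (e : R) : R := wsum a N (fun k => / (e - x k)).

Lemma weight_sum_pos : 0 < sum_f_R0 a N.
Proof.
  assert (H : wsum a N (fun _ => 0) < wsum a N (fun _ => 1)).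
  { apply wsum_lt; auto. intros; lra. }
  rewrite !wsum_const in H. lra.
Qed.

Lemma cderiv_logsum (z : C) : upper_half_plane z -> exists d, cderiv logsum z d /\ snd d < 0.
Proof.
  unfold upper_half_plane. destruct z as [X Y]. simpl. intros HY.
  assert (H : forall j, cderiv
    (fun z => (wsum a j (fun k => lnmod (fst z - x k) (snd z)),
               wsum a j (fun k => angle (fst z - x k) (snd z)))) (X, Y)
    (wsum a j (fun k => (X - x k) / ((X - x k) ^ 2 + Y ^ 2)),
     wsum a j (fun k => - Y / ((X - x k) ^ 2 + Y ^ 2)))).
  { assert (Hterm : forall k, cderiv
      (fun z => (a k * lnmod (fst z - x k) (snd z), a k * angle (fst z - x k) (snd z))) (X, Y)
      (a k * ((X - x k) / ((X - x k) ^ 2 + Y ^ 2)), a k * (- Y / ((X - x k) ^ 2 + Y ^ 2)))).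
    { intro k. assert (D := cderiv_mult _ _ _ _ _ (cderiv_const (RtoC (a k)) (X, Y))
        (cderiv_log (x k) X Y HY)).
      match type of D with cderiv _ _ ?d => match goal with |- cderiv _ _ ?e =>
        replace e with d end end.
      - apply (cderiv_ext_loc _ _ _ _ 1 Rlt_0_1) with (2 := D).
        intros h _. unfold RtoC, Cmult; simpl; f_equal; ring.
      - unfold RtoC, Cmult, Cplus; simpl; f_equal; ring. }
    induction j as [|j IH]; [apply Hterm|].
    apply (cderiv_ext_loc _ _ _ _ 1 Rlt_0_1) with (2 := cderiv_plus _ _ _ _ _ IH (Hterm (S j))).
    reflexivity. }
  specialize (H N).
  assert (H2 := cderiv_plus _ _ _ _ _ H (cderiv_const (c0, - v0) (X, Y))).
  eexists. split.
  - apply (cderiv_ext_loc _ _ _ _ 1 Rlt_0_1) with (2 := H2). reflexivity.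
  - change (wsum a N (fun k => - Y / ((X - x k) ^ 2 + Y ^ 2)) + 0 < 0).
    rewrite Rplus_0_r. apply Rlt_le_trans with (wsum a N (fun _ => 0)).
    + apply wsum_lt; auto. intros k _ _. cbv beta.
      assert (P : 0 < (X - x k) ^ 2 + Y ^ 2) by (apply sum_squares_pos; right; lra).
      unfold Rdiv. rewrite Ropp_mult_distr_l_reverse.
      assert (0 < Y * / ((X - x k) ^ 2 + Y ^ 2)); [|lra].
      apply Rmult_lt_0_compat; auto. now apply Rinv_0_lt_compat.
    + rewrite wsum_const. lra.
Qed.

(** Its derivative in t is |h|^2 Im f' with f = [logsum]. For h = (h1, h2) it reads - h2 u + h1
    v. *)
Definition secant (p h : C) (t : R) : R := fst (- Ci * Cconj h * logsum (p + RtoC t * h))%C.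

(* Noshiro-Warschawski: the derivative has negative imaginary part, hence so does
   every difference quotient. *)
Lemma secant_decreasing (p h : C) (s t : R) :
  h <> 0%C -> s < t -> upper_half_plane (p + RtoC s * h)%C -> upper_half_plane (p + RtoC t * h)%C ->
  secant p h t < secant p h s.
Proof.
  intros Hh Hst Us Ut.
  assert (U : forall r, s <= r <= t -> upper_half_plane (p + RtoC r * h)%C).
  { intros r Hr. unfold upper_half_plane in *. destruct p as [p1 p2], h as [h1 h2]. simpl in *.
    destruct (Rle_dec 0 h2); nra. }
  destruct (functional_choice (fun r l =>
    s <= r <= t -> derivable_pt_lim (secant p h) r l /\ l < 0)) as [D HD].
  { intros r. destruct (classic (s <= r <= t)) as [Hr|Hr]; [|exists 0; tauto].
    destruct (cderiv_logsum _ (U r Hr)) as [d [Hd1 Hd2]].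
    exists (fst (- Ci * Cconj h * d * h)%C). intros _. split.
    - now apply cderiv_line.
    - apply Cmod_gt_0 in Hh.
      assert (Hh2 : 0 < Cmod h ^ 2) by now apply pow_lt.
      rewrite Cmod_sqr in Hh2.
      replace (fst (- Ci * Cconj h * d * h)%C) with (snd d * (fst h ^ 2 + snd h ^ 2))
        by (destruct d, h; simpl; ring). nra. }
  destruct (MVT_cor2 (secant p h) D s t Hst) as [c [E Hc]].
  { intros r Hr. now apply HD. }
  destruct (HD c ltac:(lra)) as [_ Hneg]. nra.
Qed.

Lemma logsum_injective (z z' : C) :
  upper_half_plane z -> upper_half_plane z' -> logsum z = logsum z' -> z = z'.
Proof.
  intros U U' E. apply NNPP. intro Nz.
  assert (S := secant_decreasing z (z' - z)%C 0 1).
  unfold secant in S.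
  replace (z + RtoC 0 * (z' - z))%C with z in S by ring.
  replace (z + RtoC 1 * (z' - z))%C with z' in S by ring.
  rewrite E in S.
  specialize (S ltac:(apply Csub_neq_0; auto) ltac:(lra) U U'). lra.
Qed.

Lemma lsu_upper_near (e : R) : regular e ->
  filterlim (fun p : R * R => lsu (fst p) (snd p)) (upper_near e) (locally (lsu e 0)).
Proof.
  intros He. apply (filterlim_plus_const (upper_near e)
    (fun p : R * R => wsum a N (fun k => lnmod (fst p - x k) (snd p)))).
  apply (wsum_filterlim (upper_near e) a N (fun k p => lnmod (fst p - x k) (snd p))); auto.
  intros k Hk P. apply lnmod_upper_near. now apply He.
Qed.

Lemma lsv_upper_near (e : R) : regular e ->
  filterlim (fun p : R * R => lsv (fst p) (snd p)) (upper_near e) (locally (lsv_boundary e)).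
Proof.
  intros He. apply (filterlim_plus_const (upper_near e)
    (fun p : R * R => wsum a N (fun k => angle (fst p - x k) (snd p))) _ (- v0)).
  apply (wsum_filterlim (upper_near e) a N (fun k p => angle (fst p - x k) (snd p))); auto.
  intros k Hk P. apply angle_upper_near. now apply He.
Qed.

Lemma lsv_vertical (p eps : R) : 0 < eps -> exists del, 0 < del /\
  forall y, 0 < y < del -> Rabs (lsv p y - lsv_boundary p) < eps.
Proof.
  intros He.
  assert (L : filterlim (fun y => lsv p y) (at_right 0) (locally (lsv_boundary p))).
  { apply (filterlim_plus_const (at_right 0)
      (fun y => wsum a N (fun k => angle (p - x k) y)) _ (- v0)).
    apply (wsum_filterlim (at_right 0) a N (fun k y => angle (p - x k) y)); auto.
    intros k _ _. destruct (Req_dec p (x k)) as [E|Ne].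
    - replace (p - x k) with 0 by lra.
      apply (filterlim_ext (fun _ => step 0)); [intros; symmetry; apply angle_at_zero|].
      apply filterlim_const.
    - apply filterlim_locally. intros eps'.
      destruct (upper_near_eps p _ _ eps' (angle_upper_near p (x k) Ne) (cond_pos eps'))
        as [del [Hd H]].
      exists (mkposreal del Hd). intros y Hy Hy0. apply (H p y).
      + rewrite Rminus_diag, Rabs_R0. auto.
      + change (Rabs (y - 0) < del) in Hy. rewrite Rminus_0_r in Hy.
        apply Rabs_def2 in Hy. lra. }
  destruct (proj1 (filterlim_locally _ _) L (mkposreal eps He)) as [del H].
  exists del. split; [apply cond_pos|]. intros y Hy. apply H; [|lra].
  change (Rabs (y - 0) < del). rewrite Rminus_0_r, Rabs_pos_eq; lra.
Qed.

(** The secant function along the segment from e to (X, Y) is strictly decreasing, and it has a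
    limit at e because e is regular. As v has the same value at both ends, the terms in v cancel and
    the decrease says u (e) < u (X, Y). This keeps the image off the slits. *)
Lemma logsum_above_tip (e X Y : R) :
  regular e -> 0 < Y -> lsv X Y = lsv_boundary e -> lsu e 0 < lsu X Y.
Proof.
  intros He HY EV.
  set (h := ((X, Y) - RtoC e)%C).
  assert (Eh : h = (X - e, Y)) by (unfold h, Cminus, Cplus, Copp, RtoC; simpl; f_equal; ring).
  assert (Hh : h <> 0%C) by (rewrite Eh; intro E; apply (f_equal snd) in E; simpl in E; lra).
  assert (Us : forall s, 0 < s -> upper_half_plane (RtoC e + RtoC s * h)%C).
  { intros s Hs. rewrite Eh. unfold upper_half_plane. simpl.
    replace (0 + (s * Y + 0 * (X - e))) with (s * Y) by ring. now apply Rmult_lt_0_compat. }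
  set (L := Y * - lsu e 0 + (X - e) * lsv_boundary e).
  assert (Esec : forall s, secant (RtoC e) h s
    = Y * - lsu (e + s * (X - e)) (s * Y) + (X - e) * lsv (e + s * (X - e)) (s * Y)).
  { intro s. unfold secant. rewrite Eh. unfold logsum. simpl.
    replace (e + (s * (X - e) - 0 * Y)) with (e + s * (X - e)) by ring.
    replace (0 + (s * Y + 0 * (X - e))) with (s * Y) by ring. ring. }
  (* The passage to the limit at e yields only a weak inequality; it is taken up to the parameter 1
     / 2, and the strict one comes from there to 1. *)
  assert (Hlim : secant (RtoC e) h (1 / 2) <= L).
  { apply Rnot_lt_le. intro Lt.
    set (gap := secant (RtoC e) h (1 / 2) - L).
    set (m := gap / (Y + Rabs (X - e) + 1)).
    assert (HX := Rabs_pos (X - e)).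
    assert (Hm : 0 < m) by (apply Rdiv_lt_0_compat; unfold gap; lra).
    destruct (upper_near_eps e _ _ m (lsu_upper_near e He) Hm) as [d1 [Hd1 H1]].
    destruct (upper_near_eps e _ _ m (lsv_upper_near e He) Hm) as [d2 [Hd2 H2]].
    set (s := Rmin (1 / 4) (Rmin d1 d2 / (Y + Rabs (X - e) + 1))).
    assert (Hmin : 0 < Rmin d1 d2) by now apply Rmin_pos.
    assert (Hs : 0 < s) by (apply Rmin_pos; [lra|apply Rdiv_lt_0_compat; lra]).
    assert (Hs1 : s <= 1 / 4) by apply Rmin_l.
    assert (Hs2 : s * (Y + Rabs (X - e) + 1) <= Rmin d1 d2).
    { apply Rle_div_r; [lra|]. apply Rmin_r. }
    assert (L1 := Rmin_l d1 d2). assert (L2 := Rmin_r d1 d2).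
    assert (Ax : Rabs (e + s * (X - e) - e) = s * Rabs (X - e)).
    { replace (e + s * (X - e) - e) with (s * (X - e)) by ring.
      rewrite Rabs_mult, (Rabs_pos_eq s); lra. }
    assert (HsY : 0 < s * Y) by now apply Rmult_lt_0_compat.
    assert (HsX : 0 <= s * Rabs (X - e)) by (apply Rmult_le_pos; lra).
    specialize (H1 (e + s * (X - e)) (s * Y) ltac:(rewrite Ax; lra) ltac:(lra)).
    specialize (H2 (e + s * (X - e)) (s * Y) ltac:(rewrite Ax; lra) ltac:(lra)).
    simpl in H1, H2.
    assert (Hdec := secant_decreasing (RtoC e) h s (1 / 2) Hh ltac:(lra) (Us s Hs) (Us (1 / 2) ltac:(lra))).
    rewrite (Esec s) in Hdec.
    set (u := lsu (e + s * (X - e)) (s * Y)) in *. set (v := lsv (e + s * (X - e)) (s * Y)) in *.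
    assert (B : Y * - u + (X - e) * v - L <= m * (Y + Rabs (X - e))).
    { unfold L. replace (Y * - u + (X - e) * v - (Y * - lsu e 0 + (X - e) * lsv_boundary e))
        with (Y * - (u - lsu e 0) + (X - e) * (v - lsv_boundary e)) by ring.
      assert (T1 : Y * - (u - lsu e 0) <= Y * m).
      { apply Rmult_le_compat_l; [lra|]. apply Rabs_def2 in H1. lra. }
      assert (T2 : (X - e) * (v - lsv_boundary e) <= Rabs (X - e) * m).
      { eapply Rle_trans; [apply Rle_abs|]. rewrite Rabs_mult. apply Rmult_le_compat_l; lra. }
      lra. }
    assert (Q : m * (Y + Rabs (X - e) + 1) = gap) by (unfold m; field; lra).
    unfold gap in *. lra. }
  assert (Hdec := secant_decreasing (RtoC e) h (1 / 2) 1 Hh ltac:(lra) (Us (1 / 2) ltac:(lra)) (Us 1 ltac:(lra))).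
  rewrite (Esec 1) in Hdec.
  replace (e + 1 * (X - e)) with X in Hdec by ring. rewrite Rmult_1_l, EV in Hdec.
  unfold L in Hlim. nra.
Qed.

Lemma lsv_decreasing (X X' Y : R) : 0 < Y -> X < X' -> lsv X' Y < lsv X Y.
Proof.
  intros HY HX. apply Rplus_lt_compat_r. apply wsum_lt; auto.
  intros k _ _. apply angle_decreasing; lra.
Qed.

Lemma lsv_bounds (X Y : R) : - v0 < lsv X Y < sum_f_R0 a N * PI - v0.
Proof.
  unfold lsv. split.
  - assert (H : wsum a N (fun _ => 0) < wsum a N (fun k => angle (X - x k) Y)).
    { apply wsum_lt; auto. intros. apply angle_bounds. }
    rewrite wsum_const in H. lra.
  - assert (H : wsum a N (fun k => angle (X - x k) Y) < wsum a N (fun _ => PI)).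
    { apply wsum_lt; auto. intros. apply angle_bounds. }
    rewrite wsum_const in H. lra.
Qed.

Lemma lsu_ge (X Y : R) : 0 < Y -> sum_f_R0 a N * ln Y + c0 <= lsu X Y.
Proof.
  intros HY. apply Rplus_le_compat_r. rewrite <- wsum_const. apply wsum_le; auto.
  intros. now apply lnmod_ge.
Qed.

Lemma lsv_eq_boundary_plus (e Y : R) : regular e -> 0 < Y ->
  lsv e Y = lsv_boundary e + wsum a N (fun k => atan (Y / (e - x k))).
Proof.
  intros He HY. unfold lsv, lsv_boundary.
  rewrite (wsum_ext a N _ (fun k => step (e - x k) + atan (Y / (e - x k)))); auto.
  - rewrite wsum_plus. ring.
  - intros k Hk P. apply angle_step; auto. specialize (He k Hk P). lra.
Qed.

(** Above a regular point v is its boundary value plus the sum of a_k atan (Y / (e - x_k)), whose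
    derivative at Y = 0 is [lsu_slope]. On the two sides of a tip the slope has opposite signs, so
    the level of the slit is enclosed there. *)
Lemma lsv_near_boundary_sign (e : R) : regular e -> lsu_slope e <> 0 ->
  exists del, 0 < del /\
    forall Y, 0 < Y < del -> 0 < (lsv e Y - lsv_boundary e) * lsu_slope e.
Proof.
  intros He Hs.
  assert (D : is_derive (fun Y => wsum a N (fun k => atan (Y / (e - x k)))) 0 (lsu_slope e)).
  { apply (is_derive_wsum a N (fun k Y => atan (Y / (e - x k)))); auto.
    intros k Hk P. specialize (He k Hk P). auto_derive; [lra|]. field. lra. }
  apply is_derive_Reals in D.
  destruct (D (Rabs (lsu_slope e))) as [del Hd]; [now apply Rabs_pos_lt|].
  exists del. split; [apply cond_pos|]. intros Y HY.
  specialize (Hd Y ltac:(lra) ltac:(rewrite Rabs_pos_eq; lra)).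
  rewrite Rplus_0_l in Hd.
  assert (E0 : wsum a N (fun k => atan (0 / (e - x k))) = 0).
  { rewrite (wsum_ext a N _ (fun _ => 0)); auto.
    - rewrite wsum_const. ring.
    - intros. unfold Rdiv. rewrite Rmult_0_l. apply atan_0. }
  rewrite E0, Rminus_0_r in Hd.
  rewrite lsv_eq_boundary_plus by (auto; lra).
  set (T := wsum a N (fun k => atan (Y / (e - x k)))) in *.
  replace (lsv_boundary e + T - lsv_boundary e) with (Y * (T / Y)) by (field; lra).
  rewrite Rmult_assoc. apply Rmult_lt_0_compat; [lra|].
  set (q := T / Y) in *. set (s := lsu_slope e) in *.
  destruct (Rlt_dec s 0).
  - rewrite (Rabs_left s) in Hd by auto. apply Rabs_def2 in Hd. nra.
  - rewrite (Rabs_pos_eq s) in Hd by lra. apply Rabs_def2 in Hd. nra.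
Qed.

Lemma lsu_below_near_singularity (m : nat) (M : R) :
  (m <= N)%nat -> 0 < a m -> exists del, 0 < del /\
    forall X Y, Rabs (X - x m) < del -> 0 < Y < del -> lsu X Y < M.
Proof.
  intros Hm P.
  (* A crude bound, from ln s <= s, for each logarithm within distance 1 of the singularity x m; the
     m-th term alone then drags the sum down. *)
  set (K := fun k => (Rabs (x m - x k) + 1) ^ 2 + 1).
  set (M' := (M - c0 - wsum a N K) / a m).
  destruct (lnmod_at_origin M') as [del [Hd H]].
  exists (Rmin del 1). split; [apply Rmin_pos; lra|]. intros X Y HX HY.
  assert (L1 := Rmin_l del 1). assert (L2 := Rmin_r del 1).
  assert (Hk : forall k, lnmod (X - x k) Y <= K k).
  { intro k. eapply Rle_trans; [apply lnmod_le; right; lra|]. unfold K.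
    assert (T : Rabs (X - x k) <= Rabs (x m - x k) + 1).
    { replace (X - x k) with ((x m - x k) + (X - x m)) by ring.
      eapply Rle_trans; [apply Rabs_triang|]. lra. }
    rewrite <- (pow2_abs (X - x k)). assert (Z := Rabs_pos (X - x k)). nra. }
  assert (HK0 : forall k, 0 <= K k).
  { intro k. unfold K. assert (Z := pow2_ge_0 (Rabs (x m - x k) + 1)). lra. }
  assert (Hsum : wsum a N (fun k => lnmod (X - x k) Y) <= wsum a N K + a m * lnmod (X - x m) Y).
  { clear - Ha Hm Hk HK0. unfold wsum. induction N as [|j IH]; simpl.
    - replace m with 0%nat by lia. assert (Z := Ha 0%nat). specialize (HK0 0%nat). nra.
    - destruct (Nat.eq_dec m (S j)) as [->|Nm].
      + assert (Z : sum_f_R0 (fun k => a k * lnmod (X - x k) Y) j <= sum_f_R0 (fun k => a k * K k) j).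
        { apply sum_Rle. intros k _. now apply Rmult_le_compat_l. }
        assert (Z2 : 0 <= a (S j) * K (S j)) by now apply Rmult_le_pos. lra.
      + specialize (IH ltac:(lia)).
        assert (a (S j) * lnmod (X - x (S j)) Y <= a (S j) * K (S j)) by now apply Rmult_le_compat_l.
        lra. }
  assert (HT : a m * lnmod (X - x m) Y < M - c0 - wsum a N K).
  { replace (M - c0 - wsum a N K) with (a m * M') by (unfold M'; field; lra).
    apply Rmult_lt_compat_l; auto. apply H; lra. }
  unfold lsu. lra.
Qed.

Lemma lsv_level (V Y : R) :
  - v0 < V < sum_f_R0 a N * PI - v0 -> 0 < Y -> exists X, lsv X Y = V.
Proof.
  intros HV HY. assert (HA := weight_sum_pos). set (A := sum_f_R0 a N) in *.
  destruct (finitely_many_bounded x N) as [B [HB Hx]].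
  assert (far : forall eta, 0 < eta -> exists T, 0 < T /\
    forall t k, (k <= N)%nat -> (T <= t -> angle (t - x k) Y < eta)
      /\ (t <= - T -> PI - eta < angle (t - x k) Y)).
  { intros eta He. assert (Q : 0 < Y / eta) by now apply Rdiv_lt_0_compat.
    assert (key : forall s, Y / eta + 1 <= s -> angle s Y < eta).
    { intros s Hs. eapply Rle_lt_trans; [apply angle_le; lra|].
      apply Rlt_div_l; [lra|].
      replace Y with (eta * (Y / eta)) at 1 by (field; lra).
      apply Rmult_lt_compat_l; lra. }
    exists (B + (Y / eta + 1)). split; [lra|]. intros t k Hk.
    specialize (Hx k Hk). apply Rabs_le_between in Hx. split; intros Ht.
    - apply key. lra.
    - replace (t - x k) with (- (x k - t)) by ring. rewrite angle_opp.
      assert (Z := key (x k - t) ltac:(lra)). lra. }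
  assert (Hc : continuity (fun t => lsv t Y)).
  { intros t. destruct (cderiv_logsum (t, Y) HY) as [d [Hd _]].
    apply cderiv_ccont in Hd. apply ccont_horizontal in Hd.
    apply continuity_pt_filterlim. apply Hd. }
  (* If every angle is below (V + v0) / A, the weighted sum is below V + v0, since the weights add
     up to A. Far to the left the angles are compared with PI in the same way. *)
  destruct (far ((V + v0) / A)) as [T1 [HT1 F1]]; [apply Rdiv_lt_0_compat; lra|].
  destruct (far ((A * PI - v0 - V) / A)) as [T2 [HT2 F2]]; [apply Rdiv_lt_0_compat; lra|].
  assert (V1 : lsv T1 Y < V).
  { unfold lsv. assert (L : wsum a N (fun k => angle (T1 - x k) Y) < wsum a N (fun _ => (V + v0) / A)).
    { apply wsum_lt; auto. intros k Hk _. apply (F1 T1 k Hk). lra. }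
    rewrite wsum_const in L. fold A in L.
    replace (A * ((V + v0) / A)) with (V + v0) in L by (field; lra). lra. }
  assert (V2 : V < lsv (- T2) Y).
  { unfold lsv. assert (L : wsum a N (fun _ => PI - (A * PI - v0 - V) / A)
      < wsum a N (fun k => angle (- T2 - x k) Y)).
    { apply wsum_lt; auto. intros k Hk _. apply (F2 (- T2) k Hk). lra. }
    rewrite wsum_const in L. fold A in L.
    replace (A * (PI - (A * PI - v0 - V) / A)) with (V + v0) in L by (field; lra). lra. }
  destruct (IVT_gen (fun t => lsv t Y) (- T2) T1 V Hc) as [X [_ E]].
  - rewrite Rmin_right, Rmax_left; lra.
  - now exists X.
Qed.

(* The level set {v = V} is the graph of a continuous function of Y; the
   intermediate value theorem is applied to u along it. *)
Lemma logsum_attains (p q Y0 U V : R) :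
  0 < Y0 ->
  (forall Y, 0 < Y < Y0 -> lsv q Y < V < lsv p Y) ->
  (forall X Y, p < X < q -> 0 < Y < Y0 -> lsu X Y < U) ->
  exists z, upper_half_plane z /\ logsum z = (U, V).
Proof.
  intros HY0 Hb Hu.
  assert (HV : - v0 < V < sum_f_R0 a N * PI - v0).
  { specialize (Hb (Y0 / 2) ltac:(lra)). assert (B1 := lsv_bounds q (Y0 / 2)).
    assert (B2 := lsv_bounds p (Y0 / 2)). lra. }
  destruct (functional_choice (fun Y X => 0 < Y -> lsv X Y = V)) as [Xf HXf].
  { intros Y. destruct (Rlt_dec 0 Y) as [HY|HY].
    - destruct (lsv_level V Y HV HY) as [X HX]. now exists X.
    - exists 0. lra. }
  assert (Xcont : forall Y eps, 0 < Y -> 0 < eps -> exists del, 0 < del /\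
    forall Y', Rabs (Y' - Y) < del -> Rabs (Xf Y' - Xf Y) < eps).
  { intros Y eps HY He.
    assert (HE := HXf Y HY).
    assert (D1 := lsv_decreasing (Xf Y - eps) (Xf Y) Y HY ltac:(lra)).
    assert (D2 := lsv_decreasing (Xf Y) (Xf Y + eps) Y HY ltac:(lra)).
    assert (Cv : forall X, continuity_pt (fun y => lsv X y) Y).
    { intros X. destruct (cderiv_logsum (X, Y) HY) as [d [Hd _]].
      apply cderiv_ccont in Hd. apply ccont_vertical in Hd.
      apply continuity_pt_filterlim. apply Hd. }
    assert (near : forall X eta, 0 < eta -> exists del, 0 < del /\
      forall Y', Rabs (Y' - Y) < del -> Rabs (lsv X Y' - lsv X Y) < eta).
    { intros X eta Heta. destruct (Cv X eta Heta) as [del [Hd H]].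
      exists del. split; auto. intros Y' HY'. destruct (Req_dec Y Y') as [<-|Ne].
      - now rewrite Rminus_diag, Rabs_R0.
      - apply H. split; auto. split; auto. exact Logic.I. }
    destruct (near (Xf Y - eps) (lsv (Xf Y - eps) Y - V)) as [d1 [Hd1 N1]]; [lra|].
    destruct (near (Xf Y + eps) (V - lsv (Xf Y + eps) Y)) as [d2 [Hd2 N2]]; [lra|].
    exists (Rmin Y (Rmin d1 d2)). split; [repeat apply Rmin_pos; lra|].
    intros Y' HY'. assert (L1 := Rmin_l Y (Rmin d1 d2)). assert (L2 := Rmin_r Y (Rmin d1 d2)).
    assert (L3 := Rmin_l d1 d2). assert (L4 := Rmin_r d1 d2).
    specialize (N1 Y' ltac:(lra)). specialize (N2 Y' ltac:(lra)).
    apply Rabs_def2 in N1. apply Rabs_def2 in N2.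
    assert (HYp : 0 < Y') by (assert (Z : Rabs (Y' - Y) < Y) by lra; apply Rabs_def2 in Z; lra).
    assert (HE' := HXf Y' HYp).
    apply Rabs_def1.
    - apply Rnot_le_lt. intro Le.
      destruct (Req_dec (Xf Y') (Xf Y + eps)) as [E|Ne]; [rewrite E in HE'; lra|].
      assert (Z := lsv_decreasing (Xf Y + eps) (Xf Y') Y' HYp ltac:(lra)). lra.
    - apply Rnot_le_lt. intro Le.
      destruct (Req_dec (Xf Y') (Xf Y - eps)) as [E|Ne]; [rewrite E in HE'; lra|].
      assert (Z := lsv_decreasing (Xf Y') (Xf Y - eps) Y' HYp ltac:(lra)). lra. }
  set (g := fun Y => lsu (Xf Y) Y - U).
  assert (gcont : forall Y, 0 < Y -> continuity_pt g Y).
  { intros Y HY eps He.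
    destruct (cderiv_logsum (Xf Y, Y) HY) as [d [Hd _]].
    apply cderiv_ccont in Hd. destruct (Hd eps He) as [del [Hdel H]].
    destruct (Xcont Y (del / 2) HY ltac:(lra)) as [d2 [Hd2 H2]].
    exists (Rmin (del / 2) d2). split; [apply Rmin_pos; lra|].
    intros Y' [_ HY']. simpl in HY' |- *. unfold Rdist in *.
    assert (L1 := Rmin_l (del / 2) d2). assert (L2 := Rmin_r (del / 2) d2).
    unfold g. replace (lsu (Xf Y') Y' - U - (lsu (Xf Y) Y - U))
      with (fst (logsum (Xf Y', Y') - logsum (Xf Y, Y))%C) by (simpl; ring).
    eapply Rle_lt_trans; [apply Rabs_re_le_Cmod|]. apply H.
    change ((Xf Y', Y') - (Xf Y, Y))%C with (Xf Y' - Xf Y, Y' - Y).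
    eapply Rle_lt_trans; [apply Cmod_le_components|].
    specialize (H2 Y' ltac:(lra)). lra. }
  assert (HA := weight_sum_pos). set (A := sum_f_R0 a N) in *.
  (* At Y1 the graph runs between p and q, where u < U. At Y2 the lower bound A ln Y + c0 of u
     already exceeds U. *)
  set (Y1 := Y0 / 2). set (Y2 := Y1 + exp ((U - c0) / A)).
  assert (HY1 : 0 < Y1 < Y0) by (unfold Y1; lra).
  assert (Pexp := exp_pos ((U - c0) / A)).
  assert (g1 : g Y1 < 0).
  { unfold g. assert (Z : lsu (Xf Y1) Y1 < U); [|lra].
    assert (HE := HXf Y1 ltac:(lra)). specialize (Hb Y1 HY1).
    apply Hu; auto. split; apply Rnot_le_lt; intro Le.
    - destruct Le as [Lt|E]; [|rewrite E in HE; lra].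
      assert (Z := lsv_decreasing (Xf Y1) p Y1 ltac:(lra) Lt). lra.
    - destruct Le as [Lt|E]; [|rewrite <- E in HE; lra].
      assert (Z := lsv_decreasing q (Xf Y1) Y1 ltac:(lra) Lt). lra. }
  assert (g2 : 0 < g Y2).
  { unfold g. assert (Z := lsu_ge (Xf Y2) Y2 ltac:(unfold Y2; lra)). fold A in Z.
    assert (Q : (U - c0) / A < ln Y2).
    { rewrite <- (ln_exp ((U - c0) / A)). apply ln_increasing; auto. unfold Y2. lra. }
    apply Rlt_div_l in Q; [|auto]. lra. }
  destruct (IVT_interv g Y1 Y2) as [Y [HY E]]; auto.
  - intros r Hr. apply gcont. lra.
  - unfold Y2. lra.
  - exists (Xf Y, Y). split; [unfold upper_half_plane; simpl; lra|].
    unfold logsum. simpl. f_equal; [unfold g in E; lra|]. apply HXf. lra.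
Qed.

End LogSum.

(** * Weighted polynomials with equal local maxima *)

Definition unit_box (n : nat) (l : list R) : Prop :=
  length l = n /\ List.Forall (fun r => 0 <= r <= 1) l.

Fixpoint list_dist (l l' : list R) : R :=
  match l, l' with
  | r :: l, r' :: l' => Rabs (r - r') + list_dist l l'
  | _, _ => 0
  end.

Lemma list_dist_self (l : list R) : list_dist l l = 0.
Proof. induction l as [|r l IH]; simpl; [auto|]. rewrite IH, Rminus_diag, Rabs_R0. ring. Qed.

Lemma interval_max (f : R -> R) (a b : R) :
  a <= b -> continuity f -> exists t, a <= t <= b /\ forall s, a <= s <= b -> f s <= f t.
Proof.
  intros Hab Hf. destruct (continuity_ab_maj f a b Hab) as [t [H1 H2]].
  - intros; apply Hf.
  - exists t. auto.
Qed.

Lemma lipschitz_continuity (f : R -> R) (K : R) :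
  (forall s t, f t - f s <= K * Rabs (t - s)) -> continuity f.
Proof.
  intros Hf t eps He. set (K' := Rabs K + 1). assert (HK := Rabs_pos K).
  exists (eps / K'). split; [apply Rdiv_lt_0_compat; unfold K'; lra|].
  intros s [_ Hs]. simpl in Hs |- *. unfold Rdist in *.
  apply Rlt_div_r in Hs; [|unfold K'; lra].
  assert (HK2 := Rle_abs K). assert (P := Rabs_pos (s - t)).
  assert (H1 := Hf s t). assert (H2 := Hf t s). rewrite (Rabs_minus_sym t s) in H1.
  unfold K' in Hs. apply Rabs_def1; nra.
Qed.

(** Extends a function on [0, 1] to the line without increasing its Lipschitz constant, so that the
    global notion [continuity] applies. *)
Definition clamp (t : R) : R := Rmax 0 (Rmin t 1).

Lemma clamp_bounds (t : R) : 0 <= clamp t <= 1.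
Proof.
  unfold clamp. split; [apply Rmax_l|]. apply Rmax_lub; [lra|apply Rmin_r].
Qed.

Lemma clamp_id (t : R) : 0 <= t <= 1 -> clamp t = t.
Proof. intros H. unfold clamp. rewrite Rmin_left, Rmax_right; lra. Qed.

Lemma clamp_contraction (s t : R) : Rabs (clamp t - clamp s) <= Rabs (t - s).
Proof.
  unfold clamp, Rmax, Rmin.
  repeat (destruct Rle_dec); unfold Rabs; repeat (destruct Rcase_abs); lra.
Qed.

(** Induction on the dimension: the minimum over the tail exists for each head, and as a function of
    the head it is again Lipschitz, because the best tail for one head can be tried with another. *)
Lemma lipschitz_box_min (n : nat) (F : list R -> R) (K : R) :
  (forall l l', unit_box n l -> unit_box n l' -> F l - F l' <= K * list_dist l l') ->
  exists l, unit_box n l /\ forall l', unit_box n l' -> F l <= F l'.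
Proof.
  revert F. induction n as [|n IH]; intros F HF.
  - exists []. split; [split; auto|]. intros l' [Hl' _].
    destruct l'; [lra|discriminate].
  - assert (cons_box : forall t l, 0 <= t <= 1 -> unit_box n l -> unit_box (S n) (t :: l)).
    { intros t l Ht [H1 H2]. split; [simpl; auto|constructor; auto]. }
    destruct (functional_choice (fun t l => 0 <= t <= 1 ->
      unit_box n l /\ forall l', unit_box n l' -> F (t :: l) <= F (t :: l'))) as [best Hbest].
    { intros t. destruct (classic (0 <= t <= 1)) as [Ht|Ht]; [|exists []; tauto].
      destruct (IH (fun l => F (t :: l))) as [l [H1 H2]].
      - intros l l' Hl Hl'. eapply Rle_trans; [apply HF; auto|]. simpl.
        rewrite Rminus_diag, Rabs_R0, Rplus_0_l. lra.
      - exists l. auto. }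
    set (G := fun t => - F (clamp t :: best (clamp t))).
    assert (HG : forall s t, G t - G s <= Rabs K * Rabs (t - s)).
    { intros s t. unfold G.
      destruct (Hbest (clamp t) (clamp_bounds t)) as [B1 M1].
      destruct (Hbest (clamp s) (clamp_bounds s)) as [B2 M2].
      specialize (M2 _ B1).
      assert (L := HF (clamp s :: best (clamp t)) (clamp t :: best (clamp t))
        (cons_box _ _ (clamp_bounds s) B1) (cons_box _ _ (clamp_bounds t) B1)).
      simpl in L. rewrite list_dist_self, Rplus_0_r in L.
      assert (C := clamp_contraction s t). rewrite (Rabs_minus_sym (clamp s)) in L.
      assert (A1 := Rle_abs K). assert (A2 := Rabs_pos (clamp t - clamp s)).
      assert (A3 := Rabs_pos K). nra. }
    destruct (interval_max G 0 1 ltac:(lra) (lipschitz_continuity G _ HG)) as [t [Ht Hmax]].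
    exists (t :: best t). destruct (Hbest t Ht) as [B1 M1]. split; [auto|].
    intros l' [Hl1 Hl2]. destruct l' as [|s l']; [discriminate|].
    inversion Hl2 as [|? ? Hs Hl3]; subst. injection Hl1 as Hl1.
    specialize (Hmax s Hs). unfold G in Hmax. rewrite !clamp_id in Hmax by auto.
    destruct (Hbest s Hs) as [_ M2]. specialize (M2 l' (conj Hl1 Hl3)). lra.
Qed.

(** Roots form a list, so that a permutation can bring those to be moved to the front. *)
Definition sqprod (l : list R) (x : R) : R := fold_right (fun r acc => (x - r) ^ 2 * acc) 1 l.

Lemma sqprod_cons (r : R) (l : list R) (x : R) : sqprod (r :: l) x = (x - r) ^ 2 * sqprod l x.
Proof. reflexivity. Qed.

Lemma sqprod_app (l l' : list R) (x : R) : sqprod (l ++ l') x = sqprod l x * sqprod l' x.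
Proof. induction l; cbn [app]; [unfold sqprod; simpl; ring|]. rewrite !sqprod_cons, IHl. ring. Qed.

Lemma sqprod_perm (l l' : list R) (x : R) : Permutation l l' -> sqprod l x = sqprod l' x.
Proof. induction 1; rewrite ?sqprod_cons; try congruence. ring. Qed.

Lemma sqr_bounds (y : R) : -1 <= y <= 1 -> 0 <= y ^ 2 <= 1.
Proof. intros. simpl. nra. Qed.

Lemma sqprod_bounds (l : list R) (x : R) :
  List.Forall (fun r => 0 <= r <= 1) l -> 0 <= x <= 1 -> 0 <= sqprod l x <= 1.
Proof.
  intros Hl Hx. induction Hl as [|r l Hr Hl IH]; [unfold sqprod; simpl; lra|].
  rewrite sqprod_cons.
  assert (Hs : 0 <= (x - r) ^ 2 <= 1) by (apply sqr_bounds; lra).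
  split; [now apply Rmult_le_pos|]. rewrite <- (Rmult_1_r 1). now apply Rmult_le_compat.
Qed.

Lemma sqprod_root (l : list R) (x : R) : In x l -> sqprod l x = 0.
Proof.
  induction l as [|r l IH]; [intros []|]. rewrite sqprod_cons. intros [->|H].
  - ring.
  - rewrite IH by auto. ring.
Qed.

Lemma sqprod_lipschitz (l l' : list R) (x : R) :
  length l = length l' -> List.Forall (fun r => 0 <= r <= 1) l ->
  List.Forall (fun r => 0 <= r <= 1) l' -> 0 <= x <= 1 ->
  Rabs (sqprod l x - sqprod l' x) <= 2 * list_dist l l'.
Proof.
  revert l'. induction l as [|r l IH]; intros [|r' l'] Hlen Hl Hl' Hx; try discriminate.
  - simpl. rewrite Rminus_diag, Rabs_R0. lra.
  - inversion Hl as [|? ? Hr Hl2]; inversion Hl' as [|? ? Hr' Hl2']; subst.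
    injection Hlen as Hlen. specialize (IH l' Hlen Hl2 Hl2' Hx).
    assert (B := sqprod_bounds l x Hl2 Hx).
    change (sqprod (r :: l) x) with ((x - r) ^ 2 * sqprod l x).
    change (sqprod (r' :: l') x) with ((x - r') ^ 2 * sqprod l' x).
    simpl list_dist. set (P := sqprod l x) in *. set (P' := sqprod l' x) in *.
    replace ((x - r) ^ 2 * P - (x - r') ^ 2 * P')
      with ((x - r') ^ 2 * (P - P') + P * ((r - r') * (r + r' - 2 * x))) by ring.
    eapply Rle_trans; [apply Rabs_triang|]. rewrite !Rabs_mult.
    rewrite (Rabs_pos_eq ((x - r') ^ 2)), (Rabs_pos_eq P) by (try apply pow2_ge_0; lra).
    assert (0 <= (x - r') ^ 2 <= 1) by (apply sqr_bounds; lra).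
    assert (Rabs (r + r' - 2 * x) <= 2) by (apply Rabs_le; lra).
    assert (Z1 := Rabs_pos (P - P')). assert (Z2 := Rabs_pos (r - r')).
    assert (Z3 := Rabs_pos (r + r' - 2 * x)).
    assert (Rabs (r - r') * Rabs (r + r' - 2 * x) <= 2 * Rabs (r - r')) by nra.
    assert (0 <= Rabs (r - r') * Rabs (r + r' - 2 * x)) by nra.
    nra.
Qed.

(** * Roots that minimize the maximum of the weighted square *)

Section ExtremalRoots.

Variables p q : nat.

(** p and q stand for k1 - l1 = 2 alpha and k2 - l2 = 2 beta; after squaring, all exponents are
    natural numbers. *)
Definition weighted_square (l : list R) (x : R) : R := x ^ p * (1 - x) ^ q * sqprod l x.

Lemma weight_bounds (x : R) : 0 <= x <= 1 -> 0 <= x ^ p * (1 - x) ^ q <= 1.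
Proof.
  intros Hx.
  assert (P : forall (y : R) (k : nat), 0 <= y <= 1 -> 0 <= y ^ k <= 1).
  { intros y k Hy. split; [now apply pow_le|]. rewrite <- (pow1 k). now apply pow_incr. }
  assert (H1 := P x p Hx). assert (H2 := P (1 - x) q ltac:(lra)). nra.
Qed.

Lemma weighted_square_continuity (l : list R) : continuity (weighted_square l).
Proof.
  assert (H : continuity (sqprod l)).
  { unfold sqprod. induction l as [|r l IH]; simpl; [reg|].
    apply (continuity_mult (fun x => (x - r) * ((x - r) * 1)) (fun x => fold_right _ 1 l)); auto.
    reg. }
  apply (continuity_mult (fun x => x ^ p * (1 - x) ^ q) (sqprod l)); auto. reg.
Qed.

Lemma avoid_list (l : list R) (lo hi : R) : lo < hi -> exists x, lo < x < hi /\ ~ In x l.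
Proof.
  revert lo hi. induction l as [|r l IH]; intros lo hi H.
  - exists ((lo + hi) / 2). split; [lra|tauto].
  - destruct (Rlt_le_dec r ((lo + hi) / 2)).
    + destruct (IH ((lo + hi) / 2) hi) as [x [H1 H2]]; [lra|].
      exists x. split; [lra|]. intros [E|E]; [lra|auto].
    + destruct (IH lo ((lo + hi) / 2)) as [x [H1 H2]]; [lra|].
      exists x. split; [lra|]. intros [E|E]; [lra|auto].
Qed.

Lemma weighted_square_somewhere_pos (l : list R) : exists x, 0 <= x <= 1 /\ 0 < weighted_square l x.
Proof.
  destruct (avoid_list l 0 1 Rlt_0_1) as [x [Hx Nx]]. exists x. split; [lra|].
  apply Rmult_lt_0_compat; [apply Rmult_lt_0_compat; apply pow_lt; lra|].
  unfold sqprod. clear Hx. induction l as [|r l IH]; simpl; [lra|].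
  apply Rmult_lt_0_compat.
  - assert (Z : 0 < (x - r) ^ 2) by (apply pow2_gt_0; intro; apply Nx; left; lra).
    simpl in Z. exact Z.
  - apply IH. intro; apply Nx; now right.
Qed.

Definition minimal_height (l : list R) (H : R) : Prop :=
  0 < H /\ (forall x, 0 <= x <= 1 -> weighted_square l x <= H) /\
  (exists x, 0 <= x <= 1 /\ weighted_square l x = H) /\
  forall l', unit_box (length l) l' -> exists x, 0 <= x <= 1 /\ H <= weighted_square l' x.

Lemma minimal_height_exists (n : nat) : exists l H, unit_box n l /\ minimal_height l H.
Proof.
  destruct (functional_choice (fun l t => 0 <= t <= 1 /\
    forall s, 0 <= s <= 1 -> weighted_square l s <= weighted_square l t)) as [top Htop].
  { intros l. apply (interval_max (weighted_square l) 0 1); [lra|].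
    apply weighted_square_continuity. }
  set (F := fun l => weighted_square l (top l)).
  destruct (lipschitz_box_min n F 2) as [l [Hl Hmin]].
  { intros l l' [E1 B1] [E2 B2]. destruct (Htop l) as [T1 M1]. destruct (Htop l') as [T2 M2].
    specialize (M2 (top l) T1). unfold F.
    apply Rle_trans with (weighted_square l (top l) - weighted_square l' (top l)); [lra|].
    unfold weighted_square. rewrite <- Rmult_minus_distr_l.
    assert (L := sqprod_lipschitz l l' (top l) ltac:(congruence) B1 B2 T1).
    assert (W := weight_bounds (top l) T1).
    apply Rabs_le_between in L.
    assert (D : 0 <= list_dist l l').
    { clear. revert l'. induction l; intros [|]; simpl; try lra.
      specialize (IHl l0). assert (Z := Rabs_pos (a - r)). lra. }
    nra. }
  exists l, (F l). split; auto. destruct (Htop l) as [T1 M1].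
  split; [|split; [|split]].
  - destruct (weighted_square_somewhere_pos l) as [x [Hx P]]. specialize (M1 x Hx). unfold F. lra.
  - exact M1.
  - exists (top l). split; auto.
  - intros l' Hl'. destruct Hl as [E B]. rewrite E in Hl'. specialize (Hmin l' Hl').
    exists (top l'). split; [apply Htop|exact Hmin].
Qed.

Lemma minimal_height_perm (l l' : list R) (H : R) :
  Permutation l l' -> minimal_height l H -> minimal_height l' H.
Proof.
  intros P (H0 & H1 & (x & Hx & Ex) & H3).
  assert (E : forall x, weighted_square l' x = weighted_square l x)
    by (intro; unfold weighted_square; now rewrite (sqprod_perm l l') by auto).
  split; [auto|split; [|split]].
  - intros. rewrite E. auto.
  - exists x. rewrite E. auto.
  - intros l2 B. apply H3. now rewrite (Permutation_length P).
Qed.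

(* If the maximum H were not attained on [lo, hi], moving the roots [l1] slightly
   to [l2 del] would lower the whole graph below H. *)
Lemma minimal_height_perturbation (l1 l : list R) (l2 : R -> list R) (lo hi H del0 : R) :
  0 < del0 -> 0 <= lo -> lo <= hi -> hi <= 1 ->
  List.Forall (fun r => 0 <= r <= 1) (l1 ++ l) -> minimal_height (l1 ++ l) H ->
  (forall del, 0 < del <= del0 -> unit_box (length l1) (l2 del)) ->
  (forall del, 0 < del <= del0 -> list_dist l1 (l2 del) <= 2 * del) ->
  (forall del x, 0 < del <= del0 -> 0 <= x <= 1 -> ~ lo <= x <= hi ->
     sqprod (l2 del) x <= del \/ sqprod (l2 del) x < sqprod l1 x) ->
  exists x, lo <= x <= hi /\ weighted_square (l1 ++ l) x = H.
Proof.
  intros Hd0 Hlo Hlh Hhi HB (H0 & H1 & _ & H3) Hbox Hdist Hout.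
  apply NNPP. intro N.
  destruct (interval_max (weighted_square (l1 ++ l)) lo hi Hlh (weighted_square_continuity _))
    as [t [Ht Hmax]].
  assert (Hlt : weighted_square (l1 ++ l) t < H).
  { destruct (H1 t ltac:(lra)) as [L|L]; auto. exfalso. apply N. now exists t. }
  apply Forall_app in HB. destruct HB as [HB1 HB2].
  set (mu := H - weighted_square (l1 ++ l) t).
  (* On [lo, hi] the value changes by at most 4 del <= mu / 2, less than the gap mu. Elsewhere the
     new product is either at most del <= H / 2 or smaller than the old one. So the maximum would
     fall below H. *)
  set (del := Rmin del0 (Rmin (mu / 8) (H / 2))).
  assert (Hdel : 0 < del) by (unfold del, mu; repeat apply Rmin_pos; lra).
  assert (L1 := Rmin_l del0 (Rmin (mu / 8) (H / 2))).
  assert (L2 := Rmin_r del0 (Rmin (mu / 8) (H / 2))).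
  assert (L3 := Rmin_l (mu / 8) (H / 2)). assert (L4 := Rmin_r (mu / 8) (H / 2)).
  fold del in L1, L2.
  destruct (Hbox del ltac:(lra)) as [E2 B2].
  destruct (H3 (l2 del ++ l)) as [x [Hx Hge]].
  { split; [rewrite !length_app; congruence|]. apply Forall_app. auto. }
  revert Hge. apply Rlt_not_le.
  unfold weighted_square. rewrite sqprod_app.
  assert (W := weight_bounds x Hx). assert (P := sqprod_bounds l x HB2 Hx).
  set (c := x ^ p * (1 - x) ^ q) in *.
  assert (Hc : 0 <= c * sqprod l x <= 1) by nra.
  replace (c * (sqprod (l2 del) x * sqprod l x))
    with ((c * sqprod l x) * sqprod (l2 del) x) by ring.
  assert (Q1 := H1 x Hx). unfold weighted_square in Q1. rewrite sqprod_app in Q1. fold c in Q1.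
  replace (c * (sqprod l1 x * sqprod l x)) with ((c * sqprod l x) * sqprod l1 x) in Q1 by ring.
  destruct (classic (lo <= x <= hi)) as [I|I].
  - specialize (Hmax x I). unfold weighted_square at 1 in Hmax. rewrite sqprod_app in Hmax.
    fold c in Hmax.
    replace (c * (sqprod l1 x * sqprod l x)) with ((c * sqprod l x) * sqprod l1 x) in Hmax by ring.
    assert (L := sqprod_lipschitz l1 (l2 del) x (eq_sym E2) HB1 B2 Hx).
    apply Rabs_le_between in L. specialize (Hdist del ltac:(lra)).
    unfold mu in *. nra.
  - destruct (Hout del x ltac:(lra) Hx I) as [O|O].
    + assert (Z := sqprod_bounds (l2 del) x B2 Hx). nra.
    + destruct (proj1 Hc) as [C|C]; [nra|]. rewrite <- C. lra.
Qed.

(** Shifting r to the right by d lowers (x - r)^2 for x > r + d, and on ]r, r + d] the new square is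
    at most d^2 <= d. Hence the height H must occur on [0, r]. If r = 1 there is no room for the
    shift, but [0, r] is then the whole interval. *)
Lemma extremum_left_of_root (r : R) (l : list R) (H : R) :
  List.Forall (fun r => 0 <= r <= 1) (r :: l) -> minimal_height (r :: l) H ->
  exists x, 0 <= x <= r /\ weighted_square (r :: l) x = H.
Proof.
  intros HB HM. assert (Hr := Forall_inv HB).
  destruct (Req_dec r 1) as [->|N].
  { destruct HM as (_ & _ & X & _). exact X. }
  apply (minimal_height_perturbation [r] l (fun d => [r + d]) 0 r H (1 - r)); auto; try lra.
  - intros d Hd. split; auto. constructor; [lra|auto].
  - intros d Hd. simpl. replace (r - (r + d)) with (- d) by ring.
    rewrite Rabs_Ropp, Rabs_pos_eq; lra.
  - intros d x Hd Hx I. unfold sqprod; simpl.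
    assert (r < x) by (apply Rnot_le_lt; intro; apply I; lra).
    destruct (Rle_dec x (r + d)); [left|right]; nra.
Qed.

Lemma extremum_right_of_root (r : R) (l : list R) (H : R) :
  List.Forall (fun r => 0 <= r <= 1) (r :: l) -> minimal_height (r :: l) H ->
  exists x, r <= x <= 1 /\ weighted_square (r :: l) x = H.
Proof.
  intros HB HM. assert (Hr := Forall_inv HB).
  destruct (Req_dec r 0) as [->|N].
  { destruct HM as (_ & _ & X & _). exact X. }
  apply (minimal_height_perturbation [r] l (fun d => [r - d]) r 1 H r); auto; try lra.
  - intros d Hd. split; auto. constructor; [lra|auto].
  - intros d Hd. simpl. replace (r - (r - d)) with d by ring.
    rewrite Rabs_pos_eq; lra.
  - intros d x Hd Hx I. unfold sqprod; simpl.
    assert (x < r) by (apply Rnot_le_lt; intro; apply I; lra).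
    destruct (Rle_dec (r - d) x); [left|right]; nra.
Qed.

(** Moving the roots apart by d replaces (x - r) (x - s) by itself minus d (s - r) + d^2. Outside
    the enlarged interval both products are positive, so the square decreases; within distance d of
    a moved root it is at most d. *)
Lemma extremum_between_roots (r s : R) (l : list R) (H : R) :
  List.Forall (fun r => 0 <= r <= 1) (r :: s :: l) -> minimal_height (r :: s :: l) H ->
  0 < r -> r <= s -> s < 1 ->
  exists x, r <= x <= s /\ weighted_square (r :: s :: l) x = H.
Proof.
  intros HB HM Hr Hrs Hs.
  assert (L1 := Rmin_l r (1 - s)). assert (L2 := Rmin_r r (1 - s)).
  apply (minimal_height_perturbation [r; s] l (fun d => [r - d; s + d]) r s H (Rmin r (1 - s)));
    auto; try lra.
  - apply Rmin_pos; lra.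
  - intros d Hd. split; auto. constructor; [lra|constructor; [lra|auto]].
  - intros d Hd. simpl. replace (r - (r - d)) with d by ring.
    replace (s - (s + d)) with (- d) by ring.
    rewrite Rabs_Ropp, Rabs_pos_eq; lra.
  - intros d x Hd Hx I. unfold sqprod; simpl.
    replace ((x - (r - d)) * ((x - (r - d)) * 1) * ((x - (s + d)) * ((x - (s + d)) * 1) * 1))
      with ((x - (r - d)) ^ 2 * (x - (s + d)) ^ 2) by ring.
    replace ((x - r) * ((x - r) * 1) * ((x - s) * ((x - s) * 1) * 1))
      with (((x - r) * (x - s)) ^ 2) by ring.
    assert (B1 : (x - (r - d)) ^ 2 <= 1) by nra. assert (B2 : (x - (s + d)) ^ 2 <= 1) by nra.
    assert (P1 := pow2_ge_0 (x - (r - d))). assert (P2 := pow2_ge_0 (x - (s + d))).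
    assert (far : 0 < (x - (r - d)) * (x - (s + d)) ->
      (x - (r - d)) ^ 2 * (x - (s + d)) ^ 2 < ((x - r) * (x - s)) ^ 2).
    { intro P. replace ((x - (r - d)) ^ 2 * (x - (s + d)) ^ 2)
        with (((x - (r - d)) * (x - (s + d))) ^ 2) by ring.
      assert ((x - (r - d)) * (x - (s + d)) < (x - r) * (x - s)) by nra. nra. }
    destruct (Rlt_le_dec x r).
    + destruct (Rle_dec (r - d) x); [left; assert ((x - (r - d)) ^ 2 <= d) by nra; nra|].
      right. apply far. nra.
    + assert (s < x) by (apply Rnot_le_lt; intro; apply I; lra).
      destruct (Rle_dec x (s + d)); [left; assert ((x - (s + d)) ^ 2 <= d) by nra; nra|].
      right. apply far. nra.
Qed.

Lemma sorted_insertion (r : R) (l : list R) :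
  StronglySorted Rle l -> exists l', Permutation (r :: l) l' /\ StronglySorted Rle l'.
Proof.
  induction l as [|s l IH]; intros Hs.
  - exists [r]. split; [auto|]. repeat constructor.
  - apply StronglySorted_inv in Hs. destruct Hs as [Hs1 Hs2].
    destruct (Rle_dec r s) as [L|L].
    + exists (r :: s :: l). split; auto.
      constructor; [constructor; auto|]. constructor; auto.
      eapply Forall_impl; [|exact Hs2]. simpl. intros; lra.
    + destruct (IH Hs1) as [l' [P S]]. exists (s :: l'). split.
      * eapply perm_trans; [apply perm_swap|]. now constructor.
      * constructor; auto. eapply Permutation_Forall; [exact P|]. constructor; [lra|auto].
Qed.

Lemma sorted_permutation (l : list R) :
  exists l', Permutation l l' /\ StronglySorted Rle l'.
Proof.
  induction l as [|r l [l1 [P1 S1]]].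
  - exists []. split; constructor.
  - destruct (sorted_insertion r l1 S1) as [l2 [P2 S2]]. exists l2. split; auto.
    eapply perm_trans; [|exact P2]. now constructor.
Qed.

Lemma sqprod_root_product (x : nat -> R) (m n : nat) (t : R) :
  sqprod (map x (seq (S m) n)) t = root_product x m n t ^ 2.
Proof.
  unfold root_product. generalize (S m) as j. clear m.
  induction n as [|n IH]; intros j; simpl; [ring|].
  unfold sqprod in *. simpl. rewrite IH. ring.
Qed.

(** The sorted optimal roots, framed by the end points 0 and 1, are the nodes. Since H > 0, a point
    of height H is never a root: this makes the roots distinct and interior, as each gap contains
    such a point. *)
Lemma extremal_nodes (n : nat) : exists (x e : nat -> R) (H : R),
  0 < H /\ x 0%nat = 0 /\ x (S n) = 1 /\
  (forall i, (i <= n)%nat -> x i < x (S i)) /\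
  (forall t, 0 <= t <= 1 -> t ^ p * (1 - t) ^ q * root_product x 0 n t ^ 2 <= H) /\
  (forall i, (i <= n)%nat -> x i <= e i <= x (S i) /\
     e i ^ p * (1 - e i) ^ q * root_product x 0 n (e i) ^ 2 = H).
Proof.
  destruct (minimal_height_exists n) as (l0 & H & [Len0 B0] & M0).
  destruct (sorted_permutation l0) as [l [P S]].
  assert (M := minimal_height_perm _ _ _ P M0).
  assert (B := Permutation_Forall P B0).
  assert (Len : length l = n) by (rewrite <- (Permutation_length P); auto).
  clear l0 Len0 B0 M0 P.
  assert (H0 : 0 < H) by apply M.
  set (x := fun k => nth k (0 :: l ++ [1]) 1).
  assert (Emap : map x (seq 1 n) = l).
  { apply (nth_ext _ _ 0 0).
    - rewrite length_map, length_seq. auto.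
    - rewrite length_map, length_seq. intros k Hk.
      rewrite (nth_indep _ 0 (x 0%nat)) by (rewrite length_map, length_seq; auto).
      rewrite map_nth, seq_nth by auto. unfold x. simpl.
      rewrite app_nth1 by lia. apply nth_indep. lia. }
  assert (EQ : forall t, t ^ p * (1 - t) ^ q * root_product x 0 n t ^ 2 = weighted_square l t).
  { intro t. unfold weighted_square. rewrite <- Emap, sqprod_root_product. reflexivity. }
  assert (xn : x (Datatypes.S n) = 1).
  { unfold x. simpl. rewrite app_nth2 by lia. rewrite Len, Nat.sub_diag. reflexivity. }
  assert (front : forall l1 r l2, l = l1 ++ r :: l2 -> Permutation l (r :: l1 ++ l2)).
  { intros l1 r l2 ->. symmetry. apply Permutation_middle. }
  assert (WP : forall l' t, Permutation l l' -> weighted_square l' t = weighted_square l t).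
  { intros l' t P. unfold weighted_square. now rewrite (sqprod_perm l l') by auto. }
  assert (noroot : forall t, weighted_square l t = H -> ~ In t l).
  { intros t E I. unfold weighted_square in E. rewrite sqprod_root in E by auto. lra. }
  assert (left : forall l1 r l2, l = l1 ++ r :: l2 -> exists t, 0 <= t < r /\ weighted_square l t = H).
  { intros l1 r l2 E. assert (P := front _ _ _ E).
    destruct (extremum_left_of_root r (l1 ++ l2) H) as [t [Ht Et]].
    - eapply Permutation_Forall; eauto.
    - eapply minimal_height_perm; eauto.
    - rewrite WP in Et by auto. exists t. split; auto.
      destruct Ht as [Ht1 [Ht2|Ht2]]; [lra|]. exfalso. apply (noroot t Et).
      rewrite E, Ht2. apply in_elt. }
  assert (right : forall l1 r l2, l = l1 ++ r :: l2 -> exists t, r < t <= 1 /\ weighted_square l t = H).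
  { intros l1 r l2 E. assert (P := front _ _ _ E).
    destruct (extremum_right_of_root r (l1 ++ l2) H) as [t [Ht Et]].
    - eapply Permutation_Forall; eauto.
    - eapply minimal_height_perm; eauto.
    - rewrite WP in Et by auto. exists t. split; auto.
      destruct Ht as [[Ht1|Ht1] Ht2]; [lra|]. exfalso. apply (noroot t Et).
      rewrite E, <- Ht1. apply in_elt. }
  assert (gap : forall i, (i <= n)%nat -> x i < x (Datatypes.S i) /\
    exists t, x i <= t <= x (Datatypes.S i) /\ weighted_square l t = H).
  { intros i Hi. destruct i as [|i].
    - destruct l as [|r l'].
      + simpl in Len. subst n. rewrite xn. unfold x. simpl nth. split; [lra|]. apply M.
      + destruct (left [] r l' eq_refl) as [t [Ht Et]]. unfold x. simpl nth.
        split; [lra|]. exists t. split; [lra|auto].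
    - destruct (nth_split l 1 (n := i)) as (l1 & l2 & E & Hl1); [lia|].
      set (r := nth i l 1) in *.
      assert (Er : x (Datatypes.S i) = r) by (unfold x, r; simpl; apply app_nth1; lia).
      rewrite Er. destruct l2 as [|s l2].
      + assert (i = (n - 1)%nat).
        { rewrite E, length_app in Len. simpl in Len. lia. }
        replace (Datatypes.S (Datatypes.S i)) with (Datatypes.S n) by lia. rewrite xn.
        destruct (right _ _ _ E) as [t [Ht Et]]. split; [lra|]. exists t. split; [lra|auto].
      + assert (Es : x (Datatypes.S (Datatypes.S i)) = s).
        { unfold x. simpl. rewrite E, <- app_assoc, app_nth2 by lia.
          replace (Datatypes.S i - length l1)%nat with 1%nat by lia. reflexivity. }
        rewrite Es.
        assert (E' : l = (l1 ++ [r]) ++ s :: l2) by (rewrite <- app_assoc; exact E).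
        (* t1 < r and s < t2 give 0 < r and s < 1, the room needed to move r and s apart. *)
        destruct (left _ _ _ E) as [t1 [Ht1 _]]. destruct (right _ _ _ E') as [t2 [Ht2 _]].
        assert (Hrs : r <= s).
        { clear - S E. rewrite E in S. clear E. induction l1 as [|a l1 IH]; simpl in S.
          - apply StronglySorted_inv in S. destruct S as [_ F]. now apply Forall_inv in F.
          - apply StronglySorted_inv in S. apply IH, S. }
        assert (P : Permutation l (r :: s :: l1 ++ l2)).
        { rewrite E at 1. symmetry.
          eapply perm_trans; [|apply Permutation_middle]. constructor. apply Permutation_middle. }
        destruct (extremum_between_roots r s (l1 ++ l2) H) as [t [Ht Et]]; try lra.
        * eapply Permutation_Forall; eauto.
        * eapply minimal_height_perm; eauto.
        * rewrite WP in Et by auto. assert (N := noroot t Et).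
          assert (t <> r) by (intros ->; apply N; rewrite E; apply in_elt).
          split; [lra|]. exists t. auto. }
  destruct (functional_choice (fun i t => (i <= n)%nat ->
    x i <= t <= x (Datatypes.S i) /\ weighted_square l t = H)) as [e He].
  { intro i. destruct (classic (i <= n)%nat) as [Hi|Hi]; [|exists 0; tauto].
    destruct (gap i Hi) as [_ [t Ht]]. exists t. auto. }
  exists x, e, H. split; [auto|]. split; [reflexivity|]. split; [auto|].
  split; [intros i Hi; apply (gap i Hi)|]. split.
  - intros t Ht. rewrite EQ. now apply M.
  - intros i Hi. rewrite EQ. auto.
Qed.

End ExtremalRoots.

(** * Conformal maps onto comb domains *)

Lemma root_product_S (x : nat -> R) (m l : nat) (t : R) :
  root_product x m (S l) t = root_product x m l t * (t - x (m + S l)%nat).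
Proof.
  unfold root_product. rewrite seq_S, map_app, fold_right_app. simpl.
  replace (S (m + l)) with (m + S l)%nat by lia.
  generalize (map (fun j => t - x j) (seq (S m) l)) as s. intro s.
  induction s as [|r s IH]; simpl; [ring|]. rewrite IH. ring.
Qed.

Lemma root_product_app (x : nat -> R) (m l l' : nat) (t : R) :
  root_product x m (l + l') t = root_product x m l t * root_product x (m + l) l' t.
Proof.
  induction l' as [|l' IH].
  - rewrite Nat.add_0_r. unfold root_product at 3. simpl. ring.
  - rewrite Nat.add_succ_r, !root_product_S, IH.
    replace (m + l + S l')%nat with (m + S (l + l'))%nat by lia. ring.
Qed.

Lemma root_product_eq_0 (x : nat -> R) (m l k : nat) :
  (m < k <= m + l)%nat -> root_product x m l (x k) = 0.
Proof.
  induction l as [|l IH]; intros Hk; [lia|]. rewrite root_product_S.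
  destruct (Nat.eq_dec k (m + S l)) as [->|N]; [ring|]. rewrite IH by lia. ring.
Qed.

Lemma isolated_node (x : nat -> R) (m N : nat) :
  (forall k, (k <= N)%nat -> k <> m -> x k <> x m) ->
  exists r, 0 < r /\ forall k, (k <= N)%nat -> k <> m -> r < Rabs (x k - x m).
Proof.
  induction N as [|N IH]; intros H.
  - destruct (Nat.eq_dec 0 m) as [E|Ne].
    + exists 1. split; [lra|]. intros; lia.
    + assert (P : 0 < Rabs (x 0%nat - x m)) by (apply Rabs_pos_lt, Rminus_eq_contra; auto).
      exists (Rabs (x 0%nat - x m) / 2). split; [lra|]. intros k Hk _.
      replace k with 0%nat by lia. lra.
  - destruct IH as [r [Hr HI]]; [auto|].
    destruct (Nat.eq_dec (S N) m) as [E|Ne].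
    + exists r. split; auto. intros k Hk Nk. apply HI; [lia|auto].
    + assert (P : 0 < Rabs (x (S N) - x m)) by (apply Rabs_pos_lt, Rminus_eq_contra; auto).
      exists (Rmin r (Rabs (x (S N) - x m) / 2)). split; [apply Rmin_pos; lra|].
      intros k Hk Nk. assert (L1 := Rmin_l r (Rabs (x (S N) - x m) / 2)).
      assert (L2 := Rmin_r r (Rabs (x (S N) - x m) / 2)).
      destruct (Nat.eq_dec k (S N)) as [->|]; [lra|].
      specialize (HI k ltac:(lia) Nk). lra.
Qed.

Lemma decreasing_bracket (f : nat -> R) (N : nat) (V : R) :
  V < f 0%nat -> f N <= V -> exists m, (m < N)%nat /\ f (S m) <= V < f m.
Proof.
  intros H0. induction N as [|N IH]; intros HN; [lra|].
  destruct (Rle_dec (f N) V) as [L|L].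
  - destruct (IH L) as [m [Hm H]]. exists m. split; [lia|auto].
  - exists N. split; [lia|lra].
Qed.

Lemma node_lt (x : nat -> R) (n : nat) (x_incr : forall i, (i <= n)%nat -> x i < x (S i))
    (i j : nat) : (i < j <= S n)%nat -> x i < x j.
Proof.
  intros [Hij Hj]. induction Hij as [|j Hij IH].
  - apply x_incr. lia.
  - eapply Rlt_trans; [apply IH; lia|]. apply x_incr. lia.
Qed.

Lemma node_le (x : nat -> R) (n : nat) (x_incr : forall i, (i <= n)%nat -> x i < x (S i))
    (i j : nat) : (i <= j <= S n)%nat -> x i <= x j.
Proof.
  intros Hij. destruct (Nat.eq_dec i j) as [->|N]; [lra|]. left. apply (node_lt x n x_incr). lia.
Qed.

Lemma node_unit (x : nat -> R) (n : nat) (x_incr : forall i, (i <= n)%nat -> x i < x (S i))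
    (x_0 : x 0%nat = 0) (x_Sn : x (S n) = 1) (k : nat) : (k <= S n)%nat -> 0 <= x k <= 1.
Proof.
  intros Hk. rewrite <- x_0 at 1. rewrite <- x_Sn. split; apply (node_le x n x_incr); lia.
Qed.

(** * The comb map built from the extremal nodes *)

Section CombModel.

Variables (n p q : nat) (x e : nat -> R) (H : R).
Hypothesis H_pos : 0 < H.
Hypothesis x_0 : x 0%nat = 0.
Hypothesis x_Sn : x (S n) = 1.
Hypothesis x_incr : forall i, (i <= n)%nat -> x i < x (S i).
Hypothesis height_le :
  forall t, 0 <= t <= 1 -> t ^ p * (1 - t) ^ q * root_product x 0 n t ^ 2 <= H.
Hypothesis height_tip : forall i, (i <= n)%nat -> x i <= e i <= x (S i) /\
  e i ^ p * (1 - e i) ^ q * root_product x 0 n (e i) ^ 2 = H.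

Definition comb_weight (k : nat) : R :=
  if Nat.eq_dec k 0 then INR p / 2 else if Nat.eq_dec k (S n) then INR q / 2 else 1.

Hypothesis positive_weight : exists k, (k <= S n)%nat /\ 0 < comb_weight k.

Local Notation alpha := (INR p / 2).
Local Notation beta := (INR q / 2).
Local Notation cu := (lsu (S n) comb_weight x (- ln H / 2)).
Local Notation cv := (lsv (S n) comb_weight x (beta * PI)).
Local Notation cw := (logsum (S n) comb_weight x (- ln H / 2) (beta * PI)).
Local Notation reg := (regular (S n) comb_weight x).
Local Notation bv := (lsv_boundary (S n) comb_weight x (beta * PI)).

Lemma comb_weight_nonneg (k : nat) : 0 <= comb_weight k.
Proof.
  unfold comb_weight. assert (A := pos_INR p). assert (B := pos_INR q).
  destruct (Nat.eq_dec k 0); [lra|]. destruct (Nat.eq_dec k (S n)); lra.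
Qed.
Local Notation Wnn := comb_weight_nonneg.

Lemma comb_weight_0 : comb_weight 0 = alpha.
Proof. reflexivity. Qed.

Lemma comb_weight_Sn : comb_weight (S n) = beta.
Proof. unfold comb_weight. simpl. destruct (Nat.eq_dec n n); lia || auto. Qed.

Lemma comb_weight_mid (k : nat) : (1 <= k <= n)%nat -> comb_weight k = 1.
Proof.
  intros Hk. unfold comb_weight.
  destruct (Nat.eq_dec k 0); [lia|]. destruct (Nat.eq_dec k (S n)); [lia|auto].
Qed.

Local Notation x_lt := (node_lt x n x_incr).
Local Notation x_le := (node_le x n x_incr).
Local Notation x_unit := (node_unit x n x_incr x_0 x_Sn).

(* The boundary value of the imaginary part between the nodes m - 1 and m. *)
Definition comb_level (m : nat) : R :=
  if Nat.eq_dec m 0 then (INR n + alpha) * PI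
  else if le_dec m (S n) then INR (S n - m) * PI else - beta * PI.

Lemma comb_level_0 : comb_level 0 = (INR n + alpha) * PI.
Proof. reflexivity. Qed.

Lemma comb_level_mid (m : nat) : (1 <= m <= S n)%nat -> comb_level m = INR (S n - m) * PI.
Proof.
  intros Hm. unfold comb_level. destruct (Nat.eq_dec m 0); [lia|]. destruct (le_dec m (S n)); lia || auto.
Qed.

Lemma comb_level_last : comb_level (S (S n)) = - beta * PI.
Proof.
  unfold comb_level. destruct (Nat.eq_dec (S (S n)) 0); [lia|].
  destruct (le_dec (S (S n)) (S n)); lia || auto.
Qed.

Lemma comb_level_wsum (m : nat) : (m <= S (S n))%nat ->
  wsum comb_weight (S n) (fun k => if le_dec m k then PI else 0) = comb_level m + beta * PI.
Proof.
  intros Hm.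
  change (wsum comb_weight (S n) (fun k => if le_dec m k then PI else 0))
    with (wsum comb_weight n (fun k => if le_dec m k then PI else 0)
          + comb_weight (S n) * (if le_dec m (S n) then PI else 0)).
  rewrite comb_weight_Sn.
  destruct (Nat.eq_dec m 0) as [->|Nm].
  - assert (E : forall j, (j <= n)%nat ->
      wsum comb_weight j (fun k => if le_dec 0 k then PI else 0) = (INR j + alpha) * PI).
    { induction j as [|j IH]; intros Hj.
      - unfold wsum. simpl. rewrite comb_weight_0. ring.
      - rewrite wsum_S, IH by lia. rewrite comb_weight_mid by lia.
        destruct (le_dec 0 (S j)); [|lia]. rewrite S_INR. ring. }
    rewrite E by lia. rewrite comb_level_0. destruct (le_dec 0 (S n)); [|lia]. ring.
  - assert (E : forall j, (j <= n)%nat ->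
      wsum comb_weight j (fun k => if le_dec m k then PI else 0) = INR (S j - m) * PI).
    { induction j as [|j IH]; intros Hj.
      - unfold wsum. simpl sum_f_R0. destruct (le_dec m 0); [lia|].
        replace (1 - m)%nat with 0%nat by lia. simpl. ring.
      - rewrite wsum_S, IH by lia. rewrite comb_weight_mid by lia. destruct (le_dec m (S j)).
        + replace (S (S j) - m)%nat with (S (S j - m)) by lia. rewrite S_INR. ring.
        + replace (S (S j) - m)%nat with 0%nat by lia.
          replace (S j - m)%nat with 0%nat by lia. ring. }
    rewrite E by lia. destruct (le_dec m (S n)).
    + rewrite comb_level_mid by lia. ring.
    + replace m with (S (S n)) by lia. rewrite comb_level_last.
      replace (S n - S (S n))%nat with 0%nat by lia. simpl. ring.
Qed.

Lemma comb_weight_sum : sum_f_R0 comb_weight (S n) = alpha + beta + INR n.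
Proof.
  assert (E := comb_level_wsum 0 ltac:(lia)).
  rewrite comb_level_0 in E.
  assert (E2 : wsum comb_weight (S n) (fun k => if le_dec 0 k then PI else 0)
    = wsum comb_weight (S n) (fun _ => PI)).
  { apply wsum_ext; [apply Wnn|]. intros k _ _. destruct (le_dec 0 k); [auto|lia]. }
  rewrite E2, wsum_const in E. assert (P := PI_RGT_0).
  apply (Rmult_eq_reg_r PI); lra.
Qed.

Lemma comb_level_diff (m : nat) : (m <= S n)%nat ->
  comb_level m - comb_level (S m) = comb_weight m * PI.
Proof.
  intros Hm.
  destruct (Nat.eq_dec m 0) as [->|N0].
  - rewrite comb_level_0, comb_weight_0, comb_level_mid by lia.
    replace (S n - 1)%nat with n by lia. ring.
  - destruct (Nat.eq_dec m (S n)) as [->|N1].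
    + rewrite comb_level_last, comb_weight_Sn, comb_level_mid by lia.
      replace (S n - S n)%nat with 0%nat by lia. simpl. ring.
    + rewrite comb_weight_mid, !comb_level_mid by lia.
      replace (S n - m)%nat with (S (S n - S m)) by lia. rewrite S_INR. ring.
Qed.

Lemma comb_level_decr (m m' : nat) : (m <= m' <= S (S n))%nat -> comb_level m' <= comb_level m.
Proof.
  intros [L1 L2]. induction L1 as [|m' L1 IH]; [lra|].
  specialize (IH ltac:(lia)). assert (D := comb_level_diff m' ltac:(lia)).
  assert (W := Wnn m'). assert (P := PI_RGT_0). nra.
Qed.

(** Exactly the nodes to the right of t contribute the angle PI. Nodes of weight zero are not
    constrained, so t may be an end point 0 or 1 where the channel is closed. *)
Lemma boundary_in_gap (t : R) (m : nat) : (m <= S (S n))%nat ->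
  (forall k, (k <= S n)%nat -> 0 < comb_weight k -> (k < m)%nat -> x k < t) ->
  (forall k, (k <= S n)%nat -> 0 < comb_weight k -> (m <= k)%nat -> t < x k) ->
  bv t = comb_level m.
Proof.
  intros Hm H1 H2. unfold lsv_boundary.
  rewrite (wsum_ext _ _ _ (fun k => if le_dec m k then PI else 0)); [|apply Wnn|].
  - rewrite comb_level_wsum by auto. ring.
  - intros k Hk P. unfold step. destruct (le_dec m k) as [L|L].
    + specialize (H2 k Hk P L). destruct (Rlt_dec (t - x k) 0); lra.
    + specialize (H1 k Hk P ltac:(lia)). destruct (Rlt_dec (t - x k) 0); [lra|].
      destruct (Rlt_dec 0 (t - x k)); lra.
Qed.

(** The node contributes PI / 2. When its weight is positive, this vertical limit lies strictly
    between the two neighbouring levels and identifies the channel belonging to the node. *)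
Lemma boundary_at_node (m : nat) : (m <= S n)%nat ->
  bv (x m) = (comb_level m + comb_level (S m)) / 2.
Proof.
  intros Hm. unfold lsv_boundary.
  rewrite (wsum_ext _ _ _ (fun k => / 2 * (if le_dec m k then PI else 0)
    + / 2 * (if le_dec (S m) k then PI else 0))); [|apply Wnn|].
  - rewrite wsum_plus, !wsum_scal, !comb_level_wsum by lia. field.
  - intros k Hk _. unfold step. destruct (lt_eq_lt_dec k m) as [[L|E]|L].
    + assert (X := x_lt k m ltac:(lia)).
      destruct (Rlt_dec (x m - x k) 0); [lra|]. destruct (Rlt_dec 0 (x m - x k)); [|lra].
      destruct (le_dec m k); [lia|]. destruct (le_dec (S m) k); [lia|]. ring.
    + subst k. rewrite Rminus_diag. destruct (Rlt_dec 0 0); [lra|].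
      destruct (le_dec m m); [|lia]. destruct (le_dec (S m) m); [lia|]. field.
    + assert (X := x_lt m k ltac:(lia)).
      destruct (Rlt_dec (x m - x k) 0); [|lra].
      destruct (le_dec m k); [|lia]. destruct (le_dec (S m) k); [|lia]. field.
Qed.

Lemma lnmod_sqr (t : R) : t <> 0 -> ln (t ^ 2) = 2 * lnmod t 0.
Proof. intros _. unfold lnmod. rewrite pow_ne_zero, Rplus_0_r by lia. field. Qed.

Lemma lnmod_pow (t : R) (k : nat) : 0 < t -> ln (t ^ k) = 2 * (INR k / 2 * lnmod t 0).
Proof.
  intros Ht. rewrite ln_pow by auto. unfold lnmod. rewrite pow_ne_zero, Rplus_0_r by lia.
  rewrite ln_pow by auto. simpl. field.
Qed.

Lemma lnmod_pow_weight (t : R) (k : nat) :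
  0 <= t -> (0 < INR k / 2 -> t <> 0) -> 0 < t ^ k /\ ln (t ^ k) = 2 * (INR k / 2 * lnmod t 0).
Proof.
  intros Ht Hk. destruct k as [|k].
  - simpl. rewrite ln_1. split; [lra|]. unfold Rdiv. ring.
  - assert (P : 0 < t).
    { assert (Z := pos_INR k). rewrite S_INR in Hk. specialize (Hk ltac:(lra)). lra. }
    split; [now apply pow_lt|now apply lnmod_pow].
Qed.

(** Explains the additive constant - ln H / 2: twice the boundary value of u is the logarithm of
    height / H. So u <= 0 on [0, 1], with equality at the points e i, whose images are the slit
    tips. *)
Lemma regular_height (t : R) : 0 <= t <= 1 -> reg t ->
  0 < t ^ p * (1 - t) ^ q * root_product x 0 n t ^ 2 /\
  2 * cu t 0 = ln (t ^ p * (1 - t) ^ q * root_product x 0 n t ^ 2) - ln H.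
Proof.
  intros Ht Hreg.
  destruct (lnmod_pow_weight t p) as [Pp Ep]; [lra| |].
  { intros P. specialize (Hreg 0%nat ltac:(lia)). rewrite comb_weight_0, x_0 in Hreg. auto. }
  destruct (lnmod_pow_weight (1 - t) q) as [Pq Eq]; [lra| |].
  { intros P. specialize (Hreg (S n) ltac:(lia)). rewrite comb_weight_Sn, x_Sn in Hreg.
    specialize (Hreg P). lra. }
  assert (Mid : forall j, (j <= n)%nat -> 0 < root_product x 0 j t ^ 2 /\
    2 * wsum comb_weight j (fun k => lnmod (t - x k) 0)
      = ln (t ^ p) + ln (root_product x 0 j t ^ 2)).
  { induction j as [|j IH]; intros Hj.
    - unfold root_product, wsum. simpl. rewrite !Rmult_1_r, ln_1, Ep, comb_weight_0, x_0, Rminus_0_r.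
      split; [lra|]. ring.
    - destruct IH as [P E]; [lia|]. rewrite root_product_S. rewrite Nat.add_0_l.
      assert (N : t - x (S j) <> 0).
      { specialize (Hreg (S j) ltac:(lia)). rewrite comb_weight_mid in Hreg by lia.
        specialize (Hreg ltac:(lra)). lra. }
      rewrite Rpow_mult_distr. assert (P2 := pow2_gt_0 _ N).
      split; [now apply Rmult_lt_0_compat|].
      rewrite ln_mult, (lnmod_sqr (t - x (S j))) by auto.
      rewrite wsum_S, comb_weight_mid by lia. lra. }
  destruct (Mid n ltac:(lia)) as [P E].
  split; [apply Rmult_lt_0_compat; auto; apply Rmult_lt_0_compat; auto|].
  rewrite !ln_mult by (auto; apply Rmult_lt_0_compat; auto).
  unfold lsu. rewrite wsum_S, comb_weight_Sn, x_Sn.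
  assert (E1 : lnmod (t - 1) 0 = lnmod (1 - t) 0) by (unfold lnmod; do 2 f_equal; ring).
  rewrite E1, Eq. lra.
Qed.

Lemma regular_of_height (t : R) :
  0 < t ^ p * (1 - t) ^ q * root_product x 0 n t ^ 2 -> reg t.
Proof.
  intros P k Hk W E. destruct (Nat.eq_dec k 0) as [->|N0].
  - rewrite comb_weight_0 in W. rewrite x_0 in E. subst t.
    destruct p as [|p']; [simpl in W; lra|]. rewrite pow_ne_zero in P by lia. lra.
  - destruct (Nat.eq_dec k (S n)) as [->|N1].
    + rewrite comb_weight_Sn in W. rewrite x_Sn in E. subst t.
      destruct q as [|q']; [simpl in W; lra|].
      rewrite Rminus_diag, (pow_ne_zero (S q')) in P by lia. lra.
    + rewrite E, root_product_eq_0 in P by lia. rewrite (pow_ne_zero 2) in P by lia. lra.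
Qed.

Lemma tip_unit (i : nat) : (i <= n)%nat -> 0 <= e i <= 1.
Proof.
  intros Hi. destruct (height_tip i Hi) as [B _].
  assert (A1 := x_unit i ltac:(lia)). assert (A2 := x_unit (S i) ltac:(lia)). lra.
Qed.

Lemma tip_regular (i : nat) : (i <= n)%nat -> reg (e i).
Proof. intros Hi. apply regular_of_height. destruct (height_tip i Hi) as [_ ->]. auto. Qed.

Lemma cu_tip (i : nat) : (i <= n)%nat -> cu (e i) 0 = 0.
Proof.
  intros Hi. destruct (regular_height (e i) (tip_unit i Hi) (tip_regular i Hi)) as [_ E].
  destruct (height_tip i Hi) as [_ E2]. rewrite E2 in E. lra.
Qed.

Lemma cu_nonpos (t : R) : 0 <= t <= 1 -> reg t -> cu t 0 <= 0.
Proof.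
  intros Ht Hr. destruct (regular_height t Ht Hr) as [P E].
  assert (L := height_le t Ht). assert (ln (t ^ p * (1 - t) ^ q * root_product x 0 n t ^ 2) <= ln H); [|lra].
  now apply ln_le.
Qed.

Lemma tip_node_lt (i k : nat) : (i <= n)%nat -> (k <= S n)%nat -> 0 < comb_weight k ->
  (k <= i)%nat -> x k < e i.
Proof.
  intros Hi Hk W L. destruct (height_tip i Hi) as [B _].
  assert (X := x_le k i ltac:(lia)). assert (R := tip_regular i Hi k Hk W). lra.
Qed.

Lemma node_tip_lt (i k : nat) : (i <= n)%nat -> (k <= S n)%nat -> 0 < comb_weight k ->
  (S i <= k)%nat -> e i < x k.
Proof.
  intros Hi Hk W L. destruct (height_tip i Hi) as [B _].
  assert (X := x_le (S i) k ltac:(lia)). assert (R := tip_regular i Hi k Hk W). lra.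
Qed.

Lemma bv_tip (i : nat) : (i <= n)%nat -> bv (e i) = comb_level (S i).
Proof.
  intros Hi. apply boundary_in_gap; [lia| |].
  - intros k Hk W L. apply tip_node_lt; auto; lia.
  - intros k Hk W L. apply node_tip_lt; auto; lia.
Qed.

Lemma comb_model_image (z : C) : upper_half_plane z -> comb_domain n alpha beta (cw z).
Proof.
  intros Uz. assert (P := PI_RGT_0). split.
  - assert (B := lsv_bounds (S n) comb_weight x (beta * PI) Wnn positive_weight (fst z) (snd z)).
    rewrite comb_weight_sum in B. simpl Im. split.
    + apply Rlt_div_r; [auto|]. lra.
    + apply Rlt_div_l; [auto|]. lra.
  - intros (j & Hj & E & L). simpl in E, L.
    (* Nodes are numbered from left to right while the levels decrease, so the slit at height j PI
       belongs to the gap between the nodes n - j and n - j + 1, with tip e (n - j). *)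
    assert (Ev : cv (fst z) (snd z) = bv (e (n - j)%nat)).
    { rewrite bv_tip by lia. rewrite comb_level_mid by lia.
      replace (S n - S (n - j))%nat with j by lia. rewrite <- E. field. lra. }
    assert (X := logsum_above_tip (S n) comb_weight x (- ln H / 2) (beta * PI) Wnn positive_weight
      (e (n - j)%nat) (fst z) (snd z) (tip_regular (n - j) ltac:(lia)) Uz Ev).
    rewrite cu_tip in X by lia. lra.
Qed.

Lemma lsu_slope_tip (i : nat) : (i <= n)%nat -> x i < e i < x (S i) ->
  lsu_slope (S n) comb_weight x (e i) = 0.
Proof.
  intros Hi Hin.
  assert (D : is_derive (fun t => cu t 0) (e i) (lsu_slope (S n) comb_weight x (e i) + 0)).
  { apply (is_derive_plus (V := R_NormedModule) (fun t => wsum comb_weight (S n) (fun k => lnmod (t - x k) 0))).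
    - apply (is_derive_wsum comb_weight (S n) (fun k t => lnmod (t - x k) 0)); [apply Wnn|].
      intros k Hk W. assert (N := tip_regular i Hi k Hk W). unfold lnmod.
      auto_derive.
      + apply sum_squares_pos. left. lra.
      + field. lra.
    - apply (is_derive_const (V := R_NormedModule)). }
  rewrite Rplus_0_r in D. apply is_derive_Reals in D.
  assert (Z := deriv_maximum _ (x i) (x (S i)) (e i) (exist _ _ D) ltac:(lra) ltac:(lra)).
  apply Z. intros t Ht1 Ht2. rewrite cu_tip by auto.
  assert (A1 := x_unit i ltac:(lia)). assert (A2 := x_unit (S i) ltac:(lia)).
  apply cu_nonpos; [lra|]. intros k Hk _ ->.
  destruct (le_lt_dec k i) as [L|L].
  - assert (X := x_le k i ltac:(lia)). lra.
  - assert (X := x_le (S i) k ltac:(lia)). lra.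
Qed.

Lemma lsu_slope_decr (s t : R) :
  s < t -> (forall k, (k <= S n)%nat -> 0 < comb_weight k -> t < x k \/ x k < s) ->
  lsu_slope (S n) comb_weight x t < lsu_slope (S n) comb_weight x s.
Proof.
  intros Hst Hk. apply wsum_lt; [apply Wnn|exact positive_weight|].
  intros k Lk W. destruct (Hk k Lk W) as [L|L].
  - assert (Z : / (x k - s) < / (x k - t)) by (apply Rinv_lt_contravar; [apply Rmult_lt_0_compat|]; lra).
    replace (t - x k) with (- (x k - t)) by ring. replace (s - x k) with (- (x k - s)) by ring.
    rewrite !Rinv_opp. lra.
  - apply Rinv_lt_contravar; [apply Rmult_lt_0_compat|]; lra.
Qed.

(** If V lies strictly between two levels, the channel leads to a node m of positive weight: near it
    u is below any U, and v passes from one level to the other. If V is the height of a slit, then U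
    > 0 and the search starts near the tip e m, where u is close to 0 and the slope of the boundary
    values changes sign. *)
Lemma comb_model_surjective (y : C) :
  comb_domain n alpha beta y -> exists z, upper_half_plane z /\ cw z = y.
Proof.
  destruct y as [U V]. intros [HV Hslit]. simpl in HV, Hslit. assert (P := PI_RGT_0).
  assert (HV1 : - beta * PI < V) by (apply Rlt_div_r; [auto|lra]).
  assert (HV2 : V < (INR n + alpha) * PI) by (apply Rlt_div_l; [auto|lra]).
  destruct (decreasing_bracket comb_level (S (S n)) V) as [m [Hm [Hm1 Hm2]]].
  { rewrite comb_level_0. lra. }
  { rewrite comb_level_last. lra. }
  destruct Hm1 as [Hm1|Hm1].
  - assert (Dm := comb_level_diff m ltac:(lia)).
    assert (Wm : 0 < comb_weight m) by nra.
    destruct (lsu_below_near_singularity (S n) comb_weight x (- ln H / 2) Wnn m U ltac:(lia) Wm)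
      as [d1 [Hd1 N1]].
    destruct (isolated_node x m (S n)) as [r [Hr Iso]].
    { intros k Hk Nk. destruct (lt_eq_lt_dec k m) as [[L|E]|L]; [|lia|].
      - assert (X := x_lt k m ltac:(lia)). lra.
      - assert (X := x_lt m k ltac:(lia)). lra. }
    assert (Iso1 : forall k, (k < m)%nat -> x k < x m - r).
    { intros k Hk. assert (X := x_lt k m ltac:(lia)). specialize (Iso k ltac:(lia) ltac:(lia)).
      rewrite Rabs_left in Iso; lra. }
    assert (Iso2 : forall k, (m < k <= S n)%nat -> x m + r < x k).
    { intros k Hk. assert (X := x_lt m k ltac:(lia)). specialize (Iso k ltac:(lia) ltac:(lia)).
      rewrite Rabs_right in Iso; lra. }
    set (d := Rmin r (d1 / 2)). assert (Hd : 0 < d) by (apply Rmin_pos; lra).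
    assert (L1 : d <= r) by apply Rmin_l. assert (L2 : d <= d1 / 2) by apply Rmin_r.
    assert (Bl : bv (x m - d) = comb_level m).
    { apply boundary_in_gap; [lia| |].
      - intros k Hk _ L. specialize (Iso1 k L). lra.
      - intros k Hk _ L. destruct (Nat.eq_dec k m) as [->|Nk]; [lra|].
        specialize (Iso2 k ltac:(lia)). lra. }
    assert (Br : bv (x m + d) = comb_level (S m)).
    { apply boundary_in_gap; [lia| |].
      - intros k Hk _ L. destruct (Nat.eq_dec k m) as [->|Nk]; [lra|].
        specialize (Iso1 k ltac:(lia)). lra.
      - intros k Hk _ L. specialize (Iso2 k ltac:(lia)). lra. }
    destruct (lsv_vertical (S n) comb_weight x (beta * PI) Wnn (x m - d) (comb_level m - V))
      as [y1 [Hy1 V1]]; [lra|].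
    destruct (lsv_vertical (S n) comb_weight x (beta * PI) Wnn (x m + d) (V - comb_level (S m)))
      as [y2 [Hy2 V2]]; [lra|].
    apply (logsum_attains (S n) comb_weight x (- ln H / 2) (beta * PI) Wnn positive_weight
      (x m - d) (x m + d) (Rmin d1 (Rmin y1 y2))).
    + repeat apply Rmin_pos; auto.
    + intros Y HY. assert (M1 := Rmin_l d1 (Rmin y1 y2)). assert (M2 := Rmin_r d1 (Rmin y1 y2)).
      assert (M3 := Rmin_l y1 y2). assert (M4 := Rmin_r y1 y2).
      specialize (V1 Y ltac:(lra)). specialize (V2 Y ltac:(lra)).
      rewrite Bl in V1. rewrite Br in V2. apply Rabs_def2 in V1. apply Rabs_def2 in V2. lra.
    + intros X Y HX HY. assert (M1 := Rmin_l d1 (Rmin y1 y2)).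
      apply N1; [apply Rabs_def1; lra|lra].
  - assert (Hmn : (m <= n)%nat).
    { destruct (Nat.eq_dec m (S n)) as [->|]; [|lia]. rewrite comb_level_last in Hm1. lra. }
    assert (HU : 0 < U).
    { apply Rnot_le_lt. intro L. apply Hslit. exists (n - m)%nat. split; [lia|].
      split; [|exact L]. rewrite <- Hm1, comb_level_mid by lia.
      replace (S n - S m)%nat with (n - m)%nat by lia. field. lra. }
    assert (W1 : 0 < comb_weight m).
    { assert (D := comb_level_diff m ltac:(lia)). nra. }
    assert (W2 : 0 < comb_weight (S m)).
    { destruct (Nat.eq_dec m n) as [->|N].
      - rewrite comb_weight_Sn. rewrite comb_level_mid, Nat.sub_diag in Hm1 by lia. simpl in Hm1. nra.
      - rewrite comb_weight_mid by lia. lra. }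
    (* Both nodes bounding the gap have positive weight, because V is strictly inside the range of
       v; hence e m is an interior maximum and the slope vanishes there. *)
    assert (Hin : x m < e m < x (S m)).
    { split; [apply tip_node_lt|apply node_tip_lt]; auto; lia. }
    assert (HS := lsu_slope_tip m Hmn Hin).
    destruct (upper_near_eps (e m) _ _ U (lsu_upper_near (S n) comb_weight x (- ln H / 2) Wnn
      (e m) (tip_regular m Hmn)) HU) as [d1 [Hd1 N1]].
    rewrite cu_tip in N1 by auto.
    set (d := Rmin (d1 / 2) (Rmin (e m - x m) (x (S m) - e m) / 2)).
    assert (Hg : 0 < Rmin (e m - x m) (x (S m) - e m)) by (apply Rmin_pos; lra).
    assert (Hd : 0 < d) by (apply Rmin_pos; lra).
    assert (L1 : d <= d1 / 2) by apply Rmin_l.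
    assert (L2 : d <= Rmin (e m - x m) (x (S m) - e m) / 2) by apply Rmin_r.
    assert (L3 := Rmin_l (e m - x m) (x (S m) - e m)).
    assert (L4 := Rmin_r (e m - x m) (x (S m) - e m)).
    assert (gap : forall t, x m < t < x (S m) -> bv t = comb_level (S m) /\ reg t /\
      forall k, (k <= S n)%nat -> x (S m) <= x k \/ x k <= x m).
    { intros t Ht.
      assert (G : forall k, (k <= S n)%nat -> x (S m) <= x k \/ x k <= x m).
      { intros k Hk. destruct (le_lt_dec k m); [right|left]; apply x_le; lia. }
      split; [|split].
      - apply boundary_in_gap; [lia| |].
        + intros k Hk _ L. assert (X := x_le k m ltac:(lia)). lra.
        + intros k Hk _ L. assert (X := x_le (S m) k ltac:(lia)). lra.
      - intros k Hk _ ->. destruct (G k Hk); lra.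
      - exact G. }
    destruct (gap (e m - d) ltac:(lra)) as (B1 & R1 & G).
    destruct (gap (e m + d) ltac:(lra)) as (B2 & R2 & _).
    assert (S1 := lsu_slope_decr (e m - d) (e m) ltac:(lra)
      ltac:(intros k Hk _; destruct (G k Hk); lra)).
    assert (S2 := lsu_slope_decr (e m) (e m + d) ltac:(lra)
      ltac:(intros k Hk _; destruct (G k Hk); lra)).
    rewrite HS in S1, S2.
    destruct (lsv_near_boundary_sign (S n) comb_weight x (beta * PI) Wnn (e m - d) R1 ltac:(lra))
      as [y1 [Hy1 V1]].
    destruct (lsv_near_boundary_sign (S n) comb_weight x (beta * PI) Wnn (e m + d) R2 ltac:(lra))
      as [y2 [Hy2 V2]].
    apply (logsum_attains (S n) comb_weight x (- ln H / 2) (beta * PI) Wnn positive_weight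
      (e m - d) (e m + d) (Rmin d1 (Rmin y1 y2))).
    + repeat apply Rmin_pos; auto.
    + intros Y HY. assert (M1 := Rmin_l d1 (Rmin y1 y2)). assert (M2 := Rmin_r d1 (Rmin y1 y2)).
      assert (M3 := Rmin_l y1 y2). assert (M4 := Rmin_r y1 y2).
      specialize (V1 Y ltac:(lra)). specialize (V2 Y ltac:(lra)).
      rewrite B1 in V1. rewrite B2 in V2. rewrite <- Hm1. split; nra.
    + intros X Y HX HY. assert (M1 := Rmin_l d1 (Rmin y1 y2)).
      assert (Z := N1 X Y ltac:(apply Rabs_def1; lra) ltac:(lra)). simpl in Z.
      apply Rabs_def2 in Z. lra.
Qed.

Lemma not_regular_node (t : R) :
  ~ reg t -> exists m, (m <= S n)%nat /\ 0 < comb_weight m /\ t = x m.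
Proof.
  intros N. apply NNPP. intro N'. apply N. intros k Hk W E. apply N'. exists k. auto.
Qed.

Lemma cu_vertical_regular (t eps : R) : reg t -> 0 < eps -> exists del, 0 < del /\
  forall y, 0 < y < del -> Rabs (cu t y - cu t 0) < eps.
Proof.
  intros Ht He.
  destruct (upper_near_eps t _ _ eps (lsu_upper_near (S n) comb_weight x (- ln H / 2) Wnn t Ht) He)
    as [del [Hd N]].
  exists del. split; auto. intros y Hy. apply (N t y); auto. rewrite Rminus_diag, Rabs_R0. auto.
Qed.

Lemma cu_vertical_node (t M : R) : ~ reg t -> exists del, 0 < del /\
  forall y, 0 < y < del -> cu t y < M.
Proof.
  intros N. destruct (not_regular_node t N) as (m & Hm & W & ->).
  destruct (lsu_below_near_singularity (S n) comb_weight x (- ln H / 2) Wnn m M Hm W) as [d [Hd B]].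
  exists d. split; auto. intros y Hy. apply B; auto. rewrite Rminus_diag, Rabs_R0. auto.
Qed.

(** Matches infty_j with the node j: the channel lies between the levels on the two sides of the
    node. Weight zero can occur only at the end nodes, where the limit is a slit tip instead. *)
Lemma infinite_point_cases (j : nat) : (j <= S n)%nat ->
  (0 < comb_weight j /\ exists a b, infinite_point n alpha beta j = left_end a b /\
     a * PI = comb_level (S j) /\ b * PI = comb_level j)
  \/ (comb_weight j = 0 /\ (j = 0%nat \/ j = S n) /\
      infinite_point n alpha beta j = to_point (0, comb_level j)).
Proof.
  intros Hj. unfold infinite_point.
  destruct (Nat.eq_dec j 0) as [->|N0].
  - rewrite comb_weight_0. destruct (Rlt_dec 0 alpha) as [P|P].
    + left. split; auto. exists (INR n), (INR n + alpha).
      rewrite comb_level_0, comb_level_mid by lia.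
      replace (S n - 1)%nat with n by lia. auto.
    + right. assert (E : alpha = 0) by (assert (Z := pos_INR p); lra).
      split; auto. split; auto. rewrite comb_level_0, E. do 2 f_equal. ring.
  - destruct (le_dec j n) as [L|L].
    + left. rewrite comb_weight_mid by lia. split; [lra|].
      exists (INR n - INR j), (INR n - INR j + 1).
      rewrite !comb_level_mid by lia.
      rewrite !minus_INR, !S_INR by lia. repeat split; ring.
    + replace j with (S n) in * by lia. destruct (Nat.eq_dec (S n) (n + 1)) as [_|]; [|lia].
      rewrite comb_weight_Sn. destruct (Rlt_dec 0 beta) as [P|P].
      * left. split; auto. exists (- beta), 0.
        rewrite comb_level_last, comb_level_mid, Nat.sub_diag by lia. simpl. split; auto; ring.
      * right. assert (E : beta = 0) by (assert (Z := pos_INR q); lra).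
        split; auto. split; auto. rewrite comb_level_mid, Nat.sub_diag by lia. do 2 f_equal.
        simpl. ring.
Qed.

Lemma at_right_elim (P : R -> Prop) :
  at_right 0 P -> exists del, 0 < del /\ forall y, 0 < y < del -> P y.
Proof.
  intros [d Hd]. exists d. split; [apply cond_pos|]. intros y Hy. apply Hd; [|lra].
  change (Rabs (y - 0) < d). rewrite Rminus_0_r, Rabs_pos_eq; lra.
Qed.

Lemma eventually_meet (P Q : R -> Prop) :
  (exists d, 0 < d /\ forall y, 0 < y < d -> P y) ->
  (exists d, 0 < d /\ forall y, 0 < y < d -> Q y) -> exists y, P y /\ Q y.
Proof.
  intros [d1 [Hd1 H1]] [d2 [Hd2 H2]]. assert (P0 := Rmin_pos _ _ Hd1 Hd2).
  assert (M1 := Rmin_l d1 d2). assert (M2 := Rmin_r d1 d2).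
  exists (Rmin d1 d2 / 2). split; [apply H1|apply H2]; lra.
Qed.

Lemma lnmod_lt (s t : R) : t <> 0 -> Rabs t < Rabs s -> lnmod t 0 < lnmod s 0.
Proof.
  intros Ht L. unfold lnmod.
  assert (X : ln (t ^ 2 + 0 ^ 2) < ln (s ^ 2 + 0 ^ 2)); [|lra].
  apply ln_increasing.
  - apply sum_squares_pos. now left.
  - rewrite <- (pow2_abs t), <- (pow2_abs s). assert (P := Rabs_pos t). nra.
Qed.

Lemma cu_decreasing_left (s t : R) : s < t ->
  (forall k, (k <= S n)%nat -> 0 < comb_weight k -> t < x k) -> cu t 0 < cu s 0.
Proof.
  intros L Hk. apply Rplus_lt_compat_r. apply wsum_lt; [apply Wnn|exact positive_weight|].
  intros k Lk W. specialize (Hk k Lk W). apply lnmod_lt; [lra|].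
  rewrite !Rabs_left by lra. lra.
Qed.

Lemma cu_increasing_right (s t : R) : s < t ->
  (forall k, (k <= S n)%nat -> 0 < comb_weight k -> x k < s) -> cu s 0 < cu t 0.
Proof.
  intros L Hk. apply Rplus_lt_compat_r. apply wsum_lt; [apply Wnn|exact positive_weight|].
  intros k Lk W. specialize (Hk k Lk W). apply lnmod_lt; [lra|].
  rewrite !Rabs_pos_eq by lra. lra.
Qed.

(** The level of a closed end channel is an extreme value of the angle sum, so t lies outside all
    nodes of positive weight. There u is strictly monotone and vanishes only at the outermost tip.
    That tip is the end point itself, since otherwise the end point would have height above H. *)
Lemma tip_at_closed_channel (j : nat) (t : R) : (j = 0%nat \/ j = S n) ->
  comb_weight j = 0 -> reg t -> cu t 0 = 0 -> bv t = comb_level j -> t = x j.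
Proof.
  intros [->|E] W R C B; [|subst j].
  - assert (D := comb_level_diff 0 ltac:(lia)). rewrite W in D.
    assert (Left : forall k, (k <= S n)%nat -> 0 < comb_weight k -> t < x k).
    { intros k Hk Wk. apply Rnot_le_lt. intro L. specialize (R k Hk Wk).
      assert (Lt : bv t < comb_level 0); [|lra].
      assert (Z : wsum comb_weight (S n) (fun i => step (t - x i)) < wsum comb_weight (S n) (fun _ => PI)).
      { assert (P := PI_RGT_0). apply (wsum_lt_at _ _ k); auto; [apply Wnn| |].
        - intros i _ _. unfold step. destruct (Rlt_dec (t - x i) 0); [lra|].
          destruct (Rlt_dec 0 (t - x i)); lra.
        - unfold step. destruct (Rlt_dec (t - x k) 0); [lra|].
          destruct (Rlt_dec 0 (t - x k)); lra. }
      rewrite wsum_const, comb_weight_sum in Z. rewrite comb_level_0. unfold lsv_boundary. lra. }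
    assert (LeftE : forall k, (k <= S n)%nat -> 0 < comb_weight k -> e 0%nat < x k).
    { intros k Hk Wk. apply node_tip_lt; auto; [lia|].
      destruct k; [rewrite W in Wk; lra|lia]. }
    assert (Ht : t = e 0%nat).
    { destruct (Rtotal_order t (e 0%nat)) as [L|[E|L]]; auto.
      - assert (Z := cu_decreasing_left _ _ L LeftE). rewrite cu_tip in Z by lia. lra.
      - assert (Z := cu_decreasing_left _ _ L Left). rewrite cu_tip in Z by lia. lra. }
    rewrite Ht. destruct (height_tip 0 ltac:(lia)) as [[[L|L] _] _]; auto. exfalso.
    assert (Z := cu_decreasing_left _ _ L LeftE). rewrite cu_tip in Z by lia.
    assert (Z2 := cu_nonpos (x 0%nat) (x_unit 0 ltac:(lia))).
    assert (R0 : reg (x 0%nat)); [|specialize (Z2 R0); lra].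
    intros k Hk Wk. specialize (LeftE k Hk Wk). lra.
  - assert (D := comb_level_diff (S n) ltac:(lia)). rewrite W in D.
    assert (Right : forall k, (k <= S n)%nat -> 0 < comb_weight k -> x k < t).
    { intros k Hk Wk. apply Rnot_le_lt. intro L. specialize (R k Hk Wk).
      assert (Lt : comb_level (S (S n)) < bv t); [|lra].
      assert (Z : wsum comb_weight (S n) (fun _ => 0) < wsum comb_weight (S n) (fun i => step (t - x i))).
      { assert (P := PI_RGT_0). apply (wsum_lt_at _ _ k); auto; [apply Wnn| |].
        - intros i _ _. unfold step. destruct (Rlt_dec (t - x i) 0); [lra|].
          destruct (Rlt_dec 0 (t - x i)); lra.
        - unfold step. destruct (Rlt_dec (t - x k) 0); lra. }
      rewrite wsum_const in Z. rewrite comb_level_last. unfold lsv_boundary. lra. }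
    assert (RightE : forall k, (k <= S n)%nat -> 0 < comb_weight k -> x k < e n).
    { intros k Hk Wk. apply tip_node_lt; auto.
      destruct (Nat.eq_dec k (S n)) as [->|]; [rewrite W in Wk; lra|lia]. }
    assert (Ht : t = e n).
    { destruct (Rtotal_order t (e n)) as [L|[E|L]]; auto.
      - assert (Z := cu_increasing_right _ _ L Right). rewrite cu_tip in Z by lia. lra.
      - assert (Z := cu_increasing_right _ _ L RightE). rewrite cu_tip in Z by lia. lra. }
    rewrite Ht. destruct (height_tip n ltac:(lia)) as [[_ [L|L]] _]; auto. exfalso.
    assert (Z := cu_increasing_right _ _ L RightE). rewrite cu_tip in Z by lia.
    assert (Z2 := cu_nonpos (x (S n)) (x_unit (S n) ltac:(lia))).
    assert (R0 : reg (x (S n))); [|specialize (Z2 R0); lra].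
    intros k Hk Wk. specialize (RightE k Hk Wk). lra.
Qed.

Lemma left_end_elim {F : (R -> Prop) -> Prop} (f : R -> C) (a b M : R) :
  filterlim f F (left_end a b) -> F (fun y => a * PI < Im (f y) < b * PI /\ Re (f y) < M).
Proof.
  intros L. assert (P := PI_RGT_0).
  apply (L (fun z => a * PI < Im z < b * PI /\ Re z < M)).
  exists M. intros z [B1 B2] B3. split; auto. split.
  - apply Rlt_div_r in B1; auto.
  - apply Rlt_div_l in B2; auto.
Qed.

Lemma to_point_elim {F : (R -> Prop) -> Prop} (f : R -> C) (z0 : C) (eps : R) :
  0 < eps -> filterlim f F (to_point z0) -> F (fun y => Cmod (f y - z0) < eps).
Proof.
  intros He L. apply (L (fun z => Cmod (z - z0) < eps)).
  (* The balls of [C_UniformSpace] are squares: half-side eps / 2 only guarantees modulus sqrt 2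
     (eps / 2), which is below eps. *)
  assert (He2 : 0 < eps / 2) by lra.
  exists (mkposreal _ He2). intros z B.
  assert (Z := C_NormedModule_mixin_compat2 z0 z (mkposreal _ He2) B). simpl in Z.
  change (Cmod (z - z0) < sqrt 2 * (eps / 2)) in Z.
  assert (sqrt 2 < 2).
  { rewrite <- (sqrt_square 2) at 2 by lra. apply sqrt_lt_1; lra. }
  nra.
Qed.

(** For an open channel u tends to minus infinity, so t is a node; the vertical limit of v, the mean
    of the levels around it, must lie in the closed channel j, which leaves only the node j. For a
    closed channel the limit is finite, so t is regular with u = 0 and v at the level of the tip. *)
Lemma end_at_real (t : R) (j : nat) : (j <= S n)%nat ->
  filterlim (fun y => cw (t, y)) (at_right 0) (infinite_point n alpha beta j) -> t = x j.
Proof.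
  intros Hj L.
  assert (Vv := lsv_vertical (S n) comb_weight x (beta * PI) Wnn t).
  destruct (infinite_point_cases j Hj) as [(W & a & b & E & Ea & Eb)|(W & J & E)]; rewrite E in L.
  - assert (N : ~ reg t).
    { intro R. destruct (eventually_meet _ _ (at_right_elim _ (left_end_elim _ _ _ (cu t 0 - 1) L))
        (cu_vertical_regular t 1 R Rlt_0_1)) as [y [[_ X] Y]].
      simpl in X. apply Rabs_def2 in Y. lra. }
    destruct (not_regular_node t N) as (m & Hm & Wm & Et).
    assert (L1 := at_right_elim _ (left_end_elim _ _ _ 0 L)).
    rewrite Ea, Eb in L1. clear a b E Ea Eb L.
    assert (Bd : comb_level (S j) <= bv t <= comb_level j).
    { split; apply Rnot_lt_le; intro Lt.
      - destruct (eventually_meet _ _ L1 (Vv (comb_level (S j) - bv t) ltac:(lra))) as [y [[X _] Y]].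
        simpl in X. apply Rabs_def2 in Y. lra.
      - destruct (eventually_meet _ _ L1 (Vv (bv t - comb_level j) ltac:(lra))) as [y [[X _] Y]].
        simpl in X. apply Rabs_def2 in Y. lra. }
    rewrite Et, boundary_at_node in Bd by auto. rewrite Et.
    assert (D := comb_level_diff m Hm). assert (P := PI_RGT_0).
    assert (0 < comb_weight m * PI) by now apply Rmult_lt_0_compat.
    destruct (lt_eq_lt_dec m j) as [[Lt|Eq]|Lt]; [|now subst|].
    + assert (Z := comb_level_decr (S m) j ltac:(lia)). lra.
    + assert (Z := comb_level_decr (S j) m ltac:(lia)). lra.
  - assert (near : forall eps, 0 < eps -> exists d, 0 < d /\ forall y, 0 < y < d ->
      Rabs (cu t y) < eps /\ Rabs (cv t y - comb_level j) < eps).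
    { intros eps He. destruct (at_right_elim _ (to_point_elim _ _ eps He L)) as [d [Hd Hy]].
      exists d. split; auto. intros y Yd. specialize (Hy y Yd).
      assert (X1 := Rabs_re_le_Cmod (cw (t, y) - (0, comb_level j))).
      assert (X2 := Rabs_im_le_Cmod (cw (t, y) - (0, comb_level j))).
      simpl in X1, X2. rewrite Ropp_0, Rplus_0_r in X1. unfold Rminus. lra. }
    assert (R : reg t).
    { apply NNPP. intro N.
      destruct (eventually_meet _ _ (near 1 Rlt_0_1) (cu_vertical_node t (- 1) N)) as [y [[X _] Y]].
      apply Rabs_def2 in X. lra. }
    apply tip_at_closed_channel; auto; apply Rminus_diag_uniq, NNPP; intro N; apply Rabs_pos_lt in N.
    + rewrite Rminus_0_r in N.
      destruct (eventually_meet _ _ (near (Rabs (cu t 0) / 2) ltac:(lra))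
        (cu_vertical_regular t (Rabs (cu t 0) / 2) R ltac:(lra))) as [y [[X _] Y]].
      assert (T := Rabs_triang_inv (cu t 0) (cu t y)). rewrite Rabs_minus_sym in Y. lra.
    + set (A := Rabs (bv t - comb_level j)) in *.
      destruct (eventually_meet _ _ (near (A / 2) ltac:(lra)) (Vv (A / 2) ltac:(lra))) as [y [[_ X] Y]].
      rewrite Rabs_minus_sym in Y.
      assert (T := Rabs_triang (bv t - cv t y) (cv t y - comb_level j)).
      replace (bv t - cv t y + (cv t y - comb_level j)) with (bv t - comb_level j) in T by ring.
      fold A in T. lra.
Qed.

Lemma infinite_point_last :
  infinite_point n alpha beta (n + 2) = right_end (- beta) (alpha + INR n).
Proof.
  unfold infinite_point. destruct (Nat.eq_dec (n + 2) 0); [lia|].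
  destruct (le_dec (n + 2) n); [lia|]. destruct (Nat.eq_dec (n + 2) (n + 1)); [lia|]. reflexivity.
Qed.

(** On a vertical line u stays bounded above near the real axis: it has a finite limit at a regular
    point and tends to minus infinity at a node. *)
Lemma no_right_end_at_real (t : R) :
  ~ filterlim (fun y => cw (t, y)) (at_right 0) (infinite_point n alpha beta (n + 2)).
Proof.
  rewrite infinite_point_last. intro L.
  assert (Up : forall M, exists d, 0 < d /\ forall y, 0 < y < d -> M < cu t y).
  { intro M. apply at_right_elim. apply (L (fun z => M < Re z)). exists M. auto. }
  destruct (classic (reg t)) as [R|N].
  - destruct (eventually_meet _ _ (Up (cu t 0 + 1)) (cu_vertical_regular t 1 R Rlt_0_1)) as [y [X Y]].
    apply Rabs_def2 in Y. lra.
  - destruct (eventually_meet _ _ (Up 0) (cu_vertical_node t 0 N)) as [y [X Y]]. lra.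
Qed.

Lemma cu_large_at_infinity (M : R) : exists Y, 0 < Y /\ forall y, Y < y -> M < cu 0 y.
Proof.
  assert (A := weight_sum_pos (S n) comb_weight Wnn positive_weight).
  set (A0 := sum_f_R0 comb_weight (S n)) in *.
  exists (exp ((M + ln H / 2) / A0)). split; [apply exp_pos|]. intros y Hy.
  assert (P := exp_pos ((M + ln H / 2) / A0)).
  assert (L := ln_increasing _ _ P Hy). rewrite ln_exp in L.
  apply Rlt_div_l in L; [|auto].
  assert (G := lsu_ge (S n) comb_weight x (- ln H / 2) Wnn 0 y ltac:(lra)). fold A0 in G. lra.
Qed.

Lemma no_left_end_at_infinity (j : nat) : (j <= S n)%nat ->
  ~ filterlim (fun y => cw (0, y)) (Rbar_locally p_infty) (infinite_point n alpha beta j).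
Proof.
  intros Hj L.
  assert (Down : exists Y, forall y, Y < y -> cu 0 y < 1).
  { destruct (infinite_point_cases j Hj) as [(W & a & b & E & _)|(W & J & E)]; rewrite E in L.
    - destruct (left_end_elim _ _ _ 1 L) as [Y HY]. exists Y. intros y Hy. apply (HY y Hy).
    - destruct (to_point_elim _ _ 1 Rlt_0_1 L) as [Y HY]. exists Y. intros y Hy.
      specialize (HY y Hy).
      assert (X := Rabs_re_le_Cmod (cw (0%R, y) - (0, comb_level j))). simpl in X.
      rewrite Ropp_0, Rplus_0_r in X.
      assert (X2 : Rabs (cu 0 y) < 1) by lra. apply Rabs_def2 in X2. lra. }
  destruct Down as [Y1 D]. destruct (cu_large_at_infinity 1) as [Y2 [HY2 G]].
  assert (M1 := Rmax_l Y1 Y2). assert (M2 := Rmax_r Y1 Y2).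
  specialize (D (Rmax Y1 Y2 + 1) ltac:(lra)). specialize (G (Rmax Y1 Y2 + 1) ltac:(lra)). lra.
Qed.

(** * Uniqueness of the normalized comb map *)

Section CombMapUniqueness.

Variable w : C -> C.
Hypothesis w_comb : is_comb_map n alpha beta w.

Lemma vertical_approach (g : C -> C) (t r : R) :
  (forall y, 0 < y -> upper_half_plane (g (t, y))) -> tends_at_real g t (RtoC r) ->
  filterlim (fun y => g (t, y)) (at_right 0) (to_real_point r).
Proof.
  intros U T P [del HP]. destruct (T del (cond_pos del)) as [d [Hd H1]].
  exists (mkposreal d Hd). intros y By Hy.
  assert (Yd : 0 < y < d).
  { change (Rabs (y - 0) < d) in By. rewrite Rminus_0_r in By. apply Rabs_def2 in By. lra. }
  apply HP; [|apply U; lra].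
  apply (C_NormedModule_mixin_compat1 (RtoC r) (g (t, y))). now apply H1.
Qed.

(** phi is [cw] inverted after [w], and eta is its inverse. If eta tends to 0 along a vertical line
    at t, then [cw], being [w] after eta, tends to infty_0 there, and [end_at_real] gives t = 0. The
    points 1 and infinity are treated likewise. *)
Lemma comb_map_unique (z : C) : upper_half_plane z -> w z = cw z.
Proof.
  destruct w_comb as ((Dw & Iw & Jw & Sw) & L0 & L1 & L2).
  destruct (functional_choice (fun z u => upper_half_plane z -> upper_half_plane u /\ cw u = w z))
    as [phi Hphi].
  { intro u. destruct (classic (upper_half_plane u)) as [U|U]; [|exists u; tauto].
    destruct (comb_model_surjective (w u) (Iw u U)) as [v Hv]. exists v. auto. }
  destruct (functional_choice (fun u z => upper_half_plane u -> upper_half_plane z /\ w z = cw u))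
    as [eta Heta].
  { intro u. destruct (classic (upper_half_plane u)) as [U|U]; [|exists u; tauto].
    destruct (Sw (cw u) (comb_model_image u U)) as [v Hv]. exists v. auto. }
  assert (Dcw : forall z, upper_half_plane z -> exists d, cderiv cw z d).
  { intros u U. destruct (cderiv_logsum (S n) comb_weight x (- ln H / 2) (beta * PI) Wnn positive_weight u U)
      as [d [Hd _]]. eauto. }
  assert (Icw : forall z z', upper_half_plane z -> upper_half_plane z' -> cw z = cw z' -> z = z').
  { intros. apply (logsum_injective (S n) comb_weight x (- ln H / 2) (beta * PI)); auto. apply Wnn. }
  assert (eta_phi : forall z, upper_half_plane z -> eta (phi z) = z).
  { intros u U. destruct (Hphi u U) as [U1 E1]. destruct (Heta _ U1) as [U2 E2].
    apply Jw; auto. congruence. }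
  assert (phi_eta : forall z, upper_half_plane z -> phi (eta z) = z).
  { intros u U. destruct (Heta u U) as [U1 E1]. destruct (Hphi _ U1) as [U2 E2].
    apply Icw; auto. congruence. }
  assert (Dphi : forall z, upper_half_plane z -> exists d, cderiv phi z d).
  { intros u U. destruct (Hphi u U) as [U1 E1].
    destruct (is_derive_cderiv w u (Dw u U)) as [d1 D1].
    destruct (cderiv_logsum (S n) comb_weight x (- ln H / 2) (beta * PI) Wnn positive_weight _ U1)
      as [d2 [D2 N2]].
    assert (Nd2 : d2 <> 0%C) by (intros ->; simpl in N2; lra).
    (* The derivative of [cw] has negative imaginary part and so is nonzero; once phi is continuous,
       [cderiv_lift] applies. Continuity comes from that of [w] and of the inverse of [cw]. *)
    assert (Cphi : ccont phi u).
    { intros eps He.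
      destruct (injective_inverse_continuous cw (phi u) eps Dcw Icw U1 He) as [del [Hd HI]].
      destruct (cderiv_ccont _ _ _ D1 del Hd) as [del2 [Hd2 Hw]].
      exists (Rmin del2 (Im u)). split; [apply Rmin_pos; auto|]. intros h Hh.
      assert (Uh : upper_half_plane h).
      { apply (half_plane_open u). eapply Rlt_le_trans; [exact Hh|apply Rmin_r]. }
      destruct (Hphi h Uh) as [U3 E3]. apply HI; auto. rewrite E1, E3. apply Hw.
      eapply Rlt_le_trans; [exact Hh|apply Rmin_l]. }
    destruct (cderiv_lift cw phi u d2 d1 Nd2 D2 Cphi) as [d Hd]; [|exists d; exact Hd].
    apply (cderiv_ext_loc w _ u d1 (Im u)); auto. intros h Hh. symmetry. apply Hphi.
    now apply (half_plane_open u). }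
  assert (Ueta : forall t y, 0 < y -> upper_half_plane (t, y) /\ upper_half_plane (eta (t, y))).
  { intros t y Hy. assert (U : upper_half_plane (t, y)) by exact Hy. split; auto.
    now apply Heta. }
  assert (push : forall (t r : R) (G : (C -> Prop) -> Prop),
    filterlim w (to_real_point r) G -> tends_at_real eta t (RtoC r) ->
    filterlim (fun y => cw (t, y)) (at_right 0) G).
  { intros t r G LG T.
    apply (filterlim_ext_loc (fun y => w (eta (t, y)))).
    - exists (mkposreal 1 Rlt_0_1). intros y _ Hy. apply Heta. now apply Ueta.
    - apply (filterlim_comp _ _ _ (fun y => eta (t, y)) w _ (to_real_point r)); auto.
      apply vertical_approach; auto. intros. now apply Ueta. }
  assert (push_inf : forall (r : R) (G : (C -> Prop) -> Prop),
    filterlim w (to_real_point r) G -> tends_at_infinity eta (RtoC r) ->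
    filterlim (fun y => cw (0, y)) (Rbar_locally p_infty) G).
  { intros r G LG T.
    apply (filterlim_ext_loc (fun y => w (eta (0, y)))).
    - exists 0. intros y Hy. apply Heta. now apply Ueta.
    - apply (filterlim_comp _ _ _ (fun y => eta (0, y)) w _ (to_real_point r)); auto.
      intros P [del HP]. destruct (T del (cond_pos del)) as [Y [HY H1]].
      exists Y. intros y Hy. apply HP; [|apply Ueta; lra].
      apply (C_NormedModule_mixin_compat1 (RtoC r) (eta (0, y))). now apply H1. }
  intros Uz.
  assert (E : phi z = z).
  { apply (automorphism_identity phi eta); auto.
    - intros u U. now apply Hphi.
    - intros u U. now apply Heta.
    - intros t T. rewrite <- x_0. apply end_at_real; [lia|]. now apply (push t 0).
    - intros t T. rewrite <- x_Sn. apply end_at_real; [lia|]. apply (push t 1); auto.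
      now rewrite <- (Nat.add_1_r n).
    - intros T. apply (no_left_end_at_infinity 0); [lia|]. now apply (push_inf 0).
    - intros T. apply (no_left_end_at_infinity (S n)); [lia|]. apply (push_inf 1); auto.
      now rewrite <- (Nat.add_1_r n).
    - intros t T. apply (no_right_end_at_real t).
      apply (filterlim_ext_loc (fun y => w (eta (t, y)))).
      + exists (mkposreal 1 Rlt_0_1). intros y _ Hy. apply Heta. now apply Ueta.
      + apply (filterlim_comp _ _ _ (fun y => eta (t, y)) w _ to_infinity); auto.
        intros P [M HP]. destruct (T M) as [d [Hd H1]].
        exists (mkposreal d Hd). intros y By Hy.
        assert (Yd : 0 < y < d).
        { change (Rabs (y - 0) < d) in By. rewrite Rminus_0_r in By. apply Rabs_def2 in By. lra. }
        apply HP; [now apply Ueta|]. now apply H1. }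
  destruct (Hphi z Uz) as [_ E1]. rewrite <- E1, E. reflexivity.
Qed.

Lemma comb_preimage_unique (j : nat) (t : R) : (j <= S n)%nat ->
  is_preimage n alpha beta w j t -> t = x j.
Proof.
  intros Hj L. apply end_at_real; auto.
  apply (filterlim_ext_loc (fun y => w (t, y))).
  - exists (mkposreal 1 Rlt_0_1). intros y _ Hy. now apply comb_map_unique.
  - apply (filterlim_comp _ _ _ (fun y => (t, y) : C) w _ (to_real_point t)); auto.
    apply (vertical_approach (fun z => z)); [auto|]. intros eps He.
    exists eps. split; auto. intros y Hy.
    replace ((t, y) - RtoC t)%C with (RtoC y * Ci)%C
      by (unfold Cminus, Cplus, Copp, RtoC, Cmult, Ci; simpl; f_equal; ring).
    rewrite Cmod_mult, Cmod_Ci, Cmod_R, Rabs_pos_eq; lra.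
Qed.

(** On the imaginary axis the real part of [Cln] is ln y, and both c and - ln H / 2 differ from u -
    A ln y by O(1 / y). *)
Lemma comb_constant_unique (c : R) : is_comb_constant n alpha beta w c -> c = - ln H / 2.
Proof.
  intros [K [M HK]].
  set (A := alpha + beta + INR n).
  assert (HA : 0 < A).
  { unfold A. rewrite <- comb_weight_sum. apply weight_sum_pos; [apply Wnn|exact positive_weight]. }
  assert (key : forall y, Rabs M < y -> 1 < y -> Rabs (cu 0 y - A * ln y - c) <= Rabs K / y).
  { intros y HM Hy. assert (HM2 := Rle_abs M).
    assert (Cy : Cmod (0, y) = y).
    { replace ((0, y) : C) with (RtoC y * Ci)%C
        by (unfold RtoC, Cmult, Ci; simpl; f_equal; ring).
      rewrite Cmod_mult, Cmod_Ci, Cmod_R, Rabs_pos_eq; lra. }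
    assert (U : upper_half_plane (0, y)) by (unfold upper_half_plane; simpl; lra).
    specialize (HK (0, y) U ltac:(rewrite Cy; lra)).
    rewrite Cmod_inv, Cy in HK by (intro E; rewrite E, Cmod_0 in Cy; lra).
    rewrite comb_map_unique in HK by auto.
    apply Rle_trans with (K * / y).
    - eapply Rle_trans; [|exact HK].
      eapply Rle_trans; [|apply Rabs_re_le_Cmod]. right. f_equal.
      unfold Cln. rewrite Cy. unfold A. simpl. ring.
    - apply Rmult_le_compat_r; [left; apply Rinv_0_lt_compat; lra|apply Rle_abs]. }
  assert (key2 : forall y, 1 < y ->
    Rabs (cu 0 y - A * ln y - - ln H / 2) <= A * (1 / y)).
  { intros y Hy. unfold A. rewrite <- comb_weight_sum. unfold lsu.
    replace (wsum comb_weight (S n) (fun k => lnmod (0 - x k) y) + - ln H / 2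
      - sum_f_R0 comb_weight (S n) * ln y - - ln H / 2)
      with (wsum comb_weight (S n) (fun k => lnmod (0 - x k) y)
        - sum_f_R0 comb_weight (S n) * ln y) by field.
    assert (B : forall k, (k <= S n)%nat ->
      ln y <= lnmod (0 - x k) y <= ln y + 1 / y).
    { intros k Hk. split; [apply lnmod_ge; lra|]. assert (X := x_unit k Hk).
      (* As 0 <= x k <= 1, the sum of squares is at most (y + 1)^2, and y + 1 <= y exp (1 / y). *)
      unfold lnmod. assert (L : ln ((0 - x k) ^ 2 + y ^ 2) <= ln ((y * exp (1 / y)) ^ 2)).
      { assert (Ex := exp_ineq1_le (1 / y)).
        assert (P : 0 < 1 / y) by (apply Rdiv_lt_0_compat; lra).
        apply ln_le; [apply sum_squares_pos; right; lra|].
        assert (Z : y + 1 <= y * exp (1 / y)).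
        { replace (y + 1) with (y * (1 + 1 / y)) by (field; lra). apply Rmult_le_compat_l; lra. }
        assert (Z2 : (y + 1) ^ 2 <= (y * exp (1 / y)) ^ 2) by (apply pow_incr; lra).
        assert (Z3 : (0 - x k) ^ 2 <= 1) by (apply sqr_bounds; lra).
        assert (Z4 : (y + 1) ^ 2 = y ^ 2 + 2 * y + 1) by ring. lra. }
      rewrite ln_pow in L by (apply Rmult_lt_0_compat; [lra|apply exp_pos]).
      rewrite ln_mult, ln_exp in L by (try apply exp_pos; lra). simpl INR in L. lra. }
    apply Rabs_le. split.
    - assert (Z : wsum comb_weight (S n) (fun _ => ln y)
        <= wsum comb_weight (S n) (fun k => lnmod (0 - x k) y)).
      { apply wsum_le; [apply Wnn|]. intros k Hk _. now apply B. }
      rewrite wsum_const in Z.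
      assert (0 <= sum_f_R0 comb_weight (S n) * (1 / y)); [|lra].
      apply Rmult_le_pos; [rewrite comb_weight_sum; unfold A in HA; lra|].
      left; apply Rdiv_lt_0_compat; lra.
    - assert (Z : wsum comb_weight (S n) (fun k => lnmod (0 - x k) y)
        <= wsum comb_weight (S n) (fun _ => ln y + 1 / y)).
      { apply wsum_le; [apply Wnn|]. intros k Hk _. now apply B. }
      rewrite wsum_const in Z. lra. }
  apply NNPP. intro N. assert (P : 0 < Rabs (c - - ln H / 2)) by (apply Rabs_pos_lt; lra).
  set (D := Rabs (c - - ln H / 2)) in *.
  assert (B1 := Rabs_pos M). assert (B2 := Rabs_pos K).
  (* For this y, D y exceeds |K| + A, whereas the two estimates together give D <= (|K| + A) / y. *)
  set (y := Rabs M + 2 + (Rabs K + A) / D).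
  assert (B3 : 0 < (Rabs K + A) / D) by (apply Rdiv_lt_0_compat; lra).
  assert (Hy : Rabs M < y /\ 1 < y) by (unfold y; lra).
  specialize (key y ltac:(lra) ltac:(lra)). specialize (key2 y ltac:(lra)).
  assert (T : D <= Rabs K / y + A * (1 / y)).
  { unfold D. replace (c - - ln H / 2)
      with (- (cu 0 y - A * ln y - c) + (cu 0 y - A * ln y - - ln H / 2)) by ring.
    eapply Rle_trans; [apply Rabs_triang|]. rewrite Rabs_Ropp. lra. }
  replace (Rabs K / y + A * (1 / y)) with ((Rabs K + A) / y) in T by (field; lra).
  apply Rle_div_r in T; [|lra].
  assert (E : D * ((Rabs K + A) / D) = Rabs K + A) by (field; lra).
  assert (D * ((Rabs K + A) / D) < D * y) by (apply Rmult_lt_compat_l; unfold y; lra). lra.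
Qed.

End CombMapUniqueness.

End CombModel.

(** * Polynomials on the ball and averages over tori *)

(** Horner's form, stated for functions: no coefficients have to be compared, and continuity and
    division by t - r follow by induction. *)
Fixpoint degree_lt (n : nat) (f : R -> R) : Prop :=
  match n with
  | O => forall t, f t = 0
  | S n => exists c g, degree_lt n g /\ forall t, f t = c + t * g t
  end.

Lemma degree_lt_ext (n : nat) (f g : R -> R) :
  (forall t, f t = g t) -> degree_lt n f -> degree_lt n g.
Proof.
  destruct n; simpl; intros E H.
  - intros; rewrite <- E; auto.
  - destruct H as (c & h & Hh & Hf). exists c, h. split; auto. intros; rewrite <- E; auto.
Qed.

Lemma degree_lt_zero (n : nat) : degree_lt n (fun _ => 0).
Proof.
  induction n; simpl; [auto|]. exists 0, (fun _ => 0). split; auto. intros; ring.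
Qed.

Lemma degree_lt_plus (n : nat) (f g : R -> R) :
  degree_lt n f -> degree_lt n g -> degree_lt n (fun t => f t + g t).
Proof.
  revert f g. induction n; simpl; intros f g Hf Hg.
  - intros; rewrite Hf, Hg; ring.
  - destruct Hf as (c & h & Hh & Hf), Hg as (c' & h' & Hh' & Hg).
    exists (c + c'), (fun t => h t + h' t). split; auto. intros; rewrite Hf, Hg; ring.
Qed.

Lemma degree_lt_scal (n : nat) (a : R) (f : R -> R) :
  degree_lt n f -> degree_lt n (fun t => a * f t).
Proof.
  revert f. induction n; simpl; intros f Hf.
  - intros; rewrite Hf; ring.
  - destruct Hf as (c & h & Hh & Hf). exists (a * c), (fun t => a * h t). split; auto.
    intros; rewrite Hf; ring.
Qed.

Lemma degree_lt_S (n : nat) (f : R -> R) : degree_lt n f -> degree_lt (S n) f.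
Proof.
  revert f. induction n; intros f Hf.
  - exists 0, (fun _ => 0). split; [simpl; auto|]. intros; rewrite Hf; ring.
  - destruct Hf as (c & h & Hh & Hf). exists c, h. split; auto.
Qed.

Lemma degree_lt_le (n m : nat) (f : R -> R) : (n <= m)%nat -> degree_lt n f -> degree_lt m f.
Proof. induction 1; auto. intros. apply degree_lt_S; auto. Qed.

Lemma degree_lt_mult_affine (n : nat) (a b : R) (f : R -> R) :
  degree_lt n f -> degree_lt (S n) (fun t => (a + b * t) * f t).
Proof.
  intros Hf. apply (degree_lt_ext _ (fun t => a * f t + b * (t * f t))); [intros; ring|].
  apply degree_lt_plus; apply degree_lt_scal; [now apply degree_lt_S|].
  exists 0, f. split; auto. intros; ring.
Qed.

Lemma degree_lt_monomial (i j : nat) : degree_lt (S (i + j)) (fun t => t ^ i * (1 - t) ^ j).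
Proof.
  induction i as [|i IH]; simpl Nat.add.
  - induction j as [|j IH].
    + exists 1, (fun _ => 0). split; [apply (degree_lt_zero 0)|]. intros; simpl; ring.
    + apply (degree_lt_ext _ (fun t => (1 + (- 1) * t) * (t ^ 0 * (1 - t) ^ j))); [intros; simpl; ring|].
      now apply degree_lt_mult_affine.
  - apply (degree_lt_ext _ (fun t => (0 + 1 * t) * (t ^ i * (1 - t) ^ j))); [intros; simpl; ring|].
    now apply degree_lt_mult_affine.
Qed.

Lemma degree_lt_continuity (n : nat) (f : R -> R) : degree_lt n f -> continuity f.
Proof.
  revert f. induction n; intros f Hf.
  - intros t. apply (continuity_pt_ext (fun _ => 0)); [intros; symmetry; apply Hf|]. reg.
  - destruct Hf as (c & h & Hh & Hf). specialize (IHn h Hh). intros t.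
    apply (continuity_pt_ext (fun s => c + s * h s)); [intros; symmetry; apply Hf|].
    apply continuity_pt_plus; [reg|]. apply continuity_pt_mult; [reg|auto].
Qed.

Lemma degree_lt_divide (n : nat) (f : R -> R) (r : R) :
  degree_lt (S n) f -> exists g, degree_lt n g /\ forall t, f t = f r + (t - r) * g t.
Proof.
  revert f. induction n; intros f (c & h & Hh & Hf).
  - exists (fun _ => 0). split; [simpl; auto|]. intros. rewrite !Hf. simpl in Hh. rewrite !Hh. ring.
  - destruct (IHn h Hh) as [k [Hk Ek]]. exists (fun t => h r + t * k t). split.
    + exists (h r), k. auto.
    + intros. rewrite !Hf. rewrite (Ek t). ring.
Qed.

(** Between the first two points f has a zero r. Dividing by t - r, which is positive at the later
    points, leaves an alternating function of smaller degree with one point less. *)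
Lemma degree_lt_no_alternation (n : nat) (f : R -> R) (e : nat -> R) :
  degree_lt n f -> (forall i, (i < n)%nat -> e i < e (S i)) ->
  ~ (forall i, (i <= n)%nat -> 0 < (-1) ^ i * f (e i)).
Proof.
  revert f e. induction n as [|n IH]; intros f e Hf He Hs.
  - specialize (Hs 0%nat (le_n 0)). rewrite Hf in Hs. simpl in Hs. lra.
  - assert (S0 := Hs 0%nat ltac:(lia)). assert (S1 := Hs 1%nat ltac:(lia)). simpl in S0, S1.
    assert (L := He 0%nat ltac:(lia)).
    destruct (IVT_gen f (e 0%nat) (e 1%nat) 0 (degree_lt_continuity _ _ Hf)) as [r [Hr Er]].
    { rewrite Rmin_right, Rmax_left; lra. }
    rewrite Rmin_left, Rmax_right in Hr by lra.
    assert (Hr1 : r < e 1%nat).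
    { destruct (proj2 Hr) as [|E]; auto. subst r. lra. }
    destruct (degree_lt_divide n f r Hf) as [g [Hg Eg]].
    apply (IH (fun t => - 1 * g t) (fun i => e (S i))).
    + now apply degree_lt_scal.
    + intros i Hi. apply He. lia.
    + intros i Hi. assert (Z := Hs (S i) ltac:(lia)). rewrite Eg, Er in Z.
      assert (Pos : r < e (S i)).
      { clear - He Hi Hr1. induction i as [|i IHi]; auto.
        specialize (IHi ltac:(lia)). specialize (He (S i) ltac:(lia)). lra. }
      replace ((-1) ^ S i * (0 + (e (S i) - r) * g (e (S i))))
        with ((e (S i) - r) * ((-1) ^ i * (- 1 * g (e (S i))))) in Z by (simpl; ring).
      apply (Rmult_lt_reg_l (e (S i) - r)); [lra|]. rewrite Rmult_0_r. exact Z.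
Qed.

Definition monic_of_degree (n : nat) (f : R -> R) : Prop :=
  degree_lt n (fun t => f t - t ^ n).

Lemma monic_mult (n : nat) (f : R -> R) (r : R) :
  monic_of_degree n f -> monic_of_degree (S n) (fun t => f t * (t - r)).
Proof.
  intros Hf.
  apply (degree_lt_ext _ (fun t => (- r + 1 * t) * (f t - t ^ n) + - r * (t ^ n * (1 - t) ^ 0)));
    [intros; simpl; ring|].
  apply degree_lt_plus; [now apply degree_lt_mult_affine|]. apply degree_lt_scal.
  rewrite <- (Nat.add_0_r n) at 1. apply degree_lt_monomial.
Qed.

(** On the sphere |z1|^2 = t and |z2|^2 = 1 - t, so monomials restrict to t^i (1 - t)^j; this is the
    origin of the factor (-1)^l2 in the theorem. *)
Lemma monic_reflected_monomial (i j : nat) :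
  monic_of_degree (i + j) (fun t => (-1) ^ j * (t ^ i * (1 - t) ^ j)).
Proof.
  induction j as [|j IH].
  - rewrite Nat.add_0_r. apply (degree_lt_ext _ (fun _ => 0)); [intros; simpl; ring|].
    apply degree_lt_zero.
  - rewrite Nat.add_succ_r.
    apply (degree_lt_ext _ (fun t => ((-1) ^ j * (t ^ i * (1 - t) ^ j)) * (t - 1) - t ^ S (i + j)));
      [intros; simpl; ring|]. now apply monic_mult.
Qed.

Lemma monic_minus (n : nat) (f g : R -> R) :
  monic_of_degree n f -> monic_of_degree n g -> degree_lt n (fun t => f t - g t).
Proof.
  intros Hf Hg.
  apply (degree_lt_ext _ (fun t => (f t - t ^ n) + - 1 * (g t - t ^ n))); [intros; ring|].
  apply degree_lt_plus; auto. now apply degree_lt_scal.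
Qed.

(** * Degree and leading part of polynomials on C^2 *)

Lemma poly_degree_le_ext (m : Z) (P Q : C -> C -> C) :
  (forall z1 z2, P z1 z2 = Q z1 z2) -> poly_degree_le m P -> poly_degree_le m Q.
Proof. intros E [s [H1 H2]]. exists s. split; auto. intros. now rewrite <- E. Qed.

Lemma poly_degree_le_le (m m' : Z) (P : C -> C -> C) :
  (m <= m')%Z -> poly_degree_le m P -> poly_degree_le m' P.
Proof.
  intros L [s [H1 H2]]. exists s. split; auto.
  eapply Forall_impl; [|exact H1]. simpl. intros; lia.
Qed.

Lemma lin_comb_app (s s' : list monomial_term) (z1 z2 : C) :
  lin_comb (s ++ s') z1 z2 = (lin_comb s z1 z2 + lin_comb s' z1 z2)%C.
Proof. induction s as [|t s IH]; simpl; [ring|]. rewrite IH. ring. Qed.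

Lemma poly_degree_le_plus (m : Z) (P Q : C -> C -> C) :
  poly_degree_le m P -> poly_degree_le m Q ->
  poly_degree_le m (fun z1 z2 => P z1 z2 + Q z1 z2)%C.
Proof.
  intros [s [H1 H2]] [s' [H1' H2']]. exists (s ++ s'). split.
  - apply Forall_app. auto.
  - intros. now rewrite lin_comb_app, H2, H2'.
Qed.

Lemma poly_degree_le_zero (m : Z) : poly_degree_le m (fun _ _ => RtoC 0).
Proof. exists []. split; [constructor|auto]. Qed.

Lemma poly_degree_le_monomial (c : C) (a b d e : nat) :
  poly_degree_le (Z.of_nat (a + b + d + e)) (fun z1 z2 => c * monomial a b d e z1 z2)%C.
Proof.
  exists [MonomialTerm c a b d e]. split.
  - constructor; [|constructor]. unfold term_degree. simpl. lia.
  - intros. simpl. unfold term_eval. simpl. ring.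
Qed.

Lemma monomial_mult (a b d e a' b' d' e' : nat) (z1 z2 : C) :
  (monomial a b d e z1 z2 * monomial a' b' d' e' z1 z2
   = monomial (a + a') (b + b') (d + d') (e + e') z1 z2)%C.
Proof. unfold monomial. rewrite !Cpow_add_r. ring. Qed.

Lemma poly_degree_le_mult (m m' : Z) (P Q : C -> C -> C) :
  poly_degree_le m P -> poly_degree_le m' Q ->
  poly_degree_le (m + m') (fun z1 z2 => P z1 z2 * Q z1 z2)%C.
Proof.
  intros [s [H1 H2]] [s' [H1' H2']].
  apply (poly_degree_le_ext _ (fun z1 z2 => lin_comb s z1 z2 * lin_comb s' z1 z2)%C);
    [intros; now rewrite H2, H2'|].
  clear P Q H2 H2'. induction H1 as [|t s Ht H1 IH].
  - apply (poly_degree_le_ext _ (fun _ _ => RtoC 0)); [intros; simpl; ring|]. apply poly_degree_le_zero.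
  - apply (poly_degree_le_ext _ (fun z1 z2 => term_eval t z1 z2 * lin_comb s' z1 z2
      + lin_comb s z1 z2 * lin_comb s' z1 z2)%C); [intros; simpl; ring|].
    apply poly_degree_le_plus; auto. clear IH H1.
    induction H1' as [|t' s' Ht' H1' IH].
    + apply (poly_degree_le_ext _ (fun _ _ => RtoC 0)); [intros; simpl; ring|]. apply poly_degree_le_zero.
    + apply (poly_degree_le_ext _ (fun z1 z2 => term_eval t z1 z2 * term_eval t' z1 z2
        + term_eval t z1 z2 * lin_comb s' z1 z2)%C); [intros; simpl; ring|].
      apply poly_degree_le_plus; auto.
      apply (poly_degree_le_ext _ (fun z1 z2 => (coef t * coef t')
        * monomial (ez1 t + ez1 t') (ez1b t + ez1b t') (ez2 t + ez2 t') (ez2b t + ez2b t') z1 z2)%C).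
      { intros. unfold term_eval. rewrite <- monomial_mult. ring. }
      eapply poly_degree_le_le; [|apply poly_degree_le_monomial].
      unfold term_degree in *. lia.
Qed.

(** Equality with M modulo lower degree. The degree bound on M itself is what makes the relation
    multiplicative. *)
Definition has_leading (m : nat) (M f : C -> C -> C) : Prop :=
  poly_degree_le (Z.of_nat m) M /\
  poly_degree_le (Z.of_nat m - 1) (fun z1 z2 => f z1 z2 - M z1 z2)%C.

Lemma has_leading_mult (m m' : nat) (M M' f f' : C -> C -> C) :
  has_leading m M f -> has_leading m' M' f' ->
  has_leading (m + m') (fun z1 z2 => M z1 z2 * M' z1 z2)%C (fun z1 z2 => f z1 z2 * f' z1 z2)%C.
Proof.
  intros [H1 H2] [H1' H2']. split.
  - rewrite Nat2Z.inj_add. now apply poly_degree_le_mult.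
  - apply (poly_degree_le_ext _ (fun z1 z2 => (f z1 z2 - M z1 z2) * (f' z1 z2 - M' z1 z2)
      + (M z1 z2 * (f' z1 z2 - M' z1 z2) + (f z1 z2 - M z1 z2) * M' z1 z2))%C); [intros; ring|].
    apply poly_degree_le_plus; [|apply poly_degree_le_plus];
      (eapply poly_degree_le_le; [|apply poly_degree_le_mult; eauto]); lia.
Qed.

Lemma has_leading_monomial (a b d e : nat) :
  has_leading (a + b + d + e) (monomial a b d e) (monomial a b d e).
Proof.
  split.
  - apply (poly_degree_le_ext _ (fun z1 z2 => 1 * monomial a b d e z1 z2)%C); [intros; ring|].
    apply poly_degree_le_monomial.
  - apply (poly_degree_le_ext _ (fun _ _ => RtoC 0)); [intros; ring|]. apply poly_degree_le_zero.
Qed.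

Lemma has_leading_factor1 (r : R) :
  has_leading 2 (monomial 1 1 0 0) (fun z1 z2 => RtoC (Cmod z1 ^ 2 - r)).
Proof.
  split; [apply (has_leading_monomial 1 1 0 0)|].
  apply (poly_degree_le_ext _ (fun z1 z2 => RtoC (- r) * monomial 0 0 0 0 z1 z2)%C).
  - intros. rewrite RtoC_minus, Cmod2_conj, RtoC_opp. unfold monomial. simpl. ring.
  - eapply poly_degree_le_le; [|apply poly_degree_le_monomial]. simpl. lia.
Qed.

Lemma has_leading_factor2 (r : R) :
  has_leading 2 (monomial 0 0 1 1) (fun z1 z2 => RtoC (- 1 * (1 - Cmod z2 ^ 2 - r))).
Proof.
  split; [apply (has_leading_monomial 0 0 1 1)|].
  apply (poly_degree_le_ext _ (fun z1 z2 => RtoC (r - 1) * monomial 0 0 0 0 z1 z2)%C).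
  - intros. replace (- 1 * (1 - Cmod z2 ^ 2 - r)) with ((r - 1) + Cmod z2 ^ 2) by ring.
    rewrite RtoC_plus, Cmod2_conj. unfold monomial. simpl. ring.
  - eapply poly_degree_le_le; [|apply poly_degree_le_monomial]. simpl. lia.
Qed.

Lemma has_leading_ext (m : nat) (M M' f f' : C -> C -> C) :
  (forall z1 z2, M z1 z2 = M' z1 z2) -> (forall z1 z2, f z1 z2 = f' z1 z2) ->
  has_leading m M f -> has_leading m M' f'.
Proof.
  intros E E' [H1 H2]. split; [eapply poly_degree_le_ext; eauto|].
  eapply poly_degree_le_ext; [|exact H2]. intros. cbv beta. now rewrite E, E'.
Qed.

(** * Averages over roots of unity on tori *)

Fixpoint csum (f : nat -> C) (K : nat) : C :=
  match K with O => RtoC 0 | S K => (csum f K + f K)%C end.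

Lemma csum_plus (f g : nat -> C) (K : nat) :
  csum (fun k => f k + g k)%C K = (csum f K + csum g K)%C.
Proof. induction K; simpl; [ring|]. rewrite IHK. ring. Qed.

Lemma csum_mult_l (c : C) (f : nat -> C) (K : nat) : csum (fun k => c * f k)%C K = (c * csum f K)%C.
Proof. induction K; simpl; [ring|]. rewrite IHK. ring. Qed.

Lemma csum_ext (f g : nat -> C) (K : nat) : (forall k, f k = g k) -> csum f K = csum g K.
Proof. intros E. induction K; simpl; congruence. Qed.

Lemma Cmod_csum_le (f : nat -> C) (K : nat) (M : R) :
  (forall k, Cmod (f k) <= M) -> Cmod (csum f K) <= INR K * M.
Proof.
  intros H. induction K.
  - simpl. rewrite Cmod_0. lra.
  - rewrite S_INR. simpl csum. eapply Rle_trans; [apply Cmod_triangle|]. specialize (H K). lra.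
Qed.

Lemma csum_geometric (r : C) (K : nat) : (csum (fun k => r ^ k) K * (r - 1) = r ^ K - 1)%C.
Proof.
  induction K; simpl; [ring|].
  rewrite Cmult_plus_distr_r, IHK. ring.
Qed.

Lemma csum_roots_of_unity (r : C) (K : nat) :
  (r ^ K = 1)%C -> r <> 1%C -> csum (fun k => r ^ k)%C K = 0%C.
Proof.
  intros E N. assert (G := csum_geometric r K). rewrite E in G.
  assert (N1 : (r - 1)%C <> 0%C) by now apply Csub_neq_0.
  transitivity (csum (fun k => r ^ k)%C K * (r - 1) * / (r - 1))%C; [field; auto|].
  rewrite G. field. auto.
Qed.

Lemma csum_one (K : nat) : csum (fun k => 1 ^ k)%C K = RtoC (INR K).
Proof.
  induction K; [reflexivity|]. rewrite S_INR, RtoC_plus. simpl csum. now rewrite IHK, Cpow_1_l.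
Qed.

Definition cis (t : R) : C := (cos t, sin t).

Lemma cis_plus (s t : R) : cis (s + t) = (cis s * cis t)%C.
Proof. unfold cis, Cmult. simpl. rewrite cos_plus, sin_plus. f_equal; ring. Qed.

Lemma cis_pow (t : R) (k : nat) : (cis t ^ k)%C = cis (INR k * t).
Proof.
  induction k.
  - simpl. rewrite Rmult_0_l. unfold cis. now rewrite cos_0, sin_0.
  - rewrite Cpow_S, IHk, <- cis_plus, S_INR. f_equal. ring.
Qed.

Lemma cis_conj (t : R) : Cconj (cis t) = cis (- t).
Proof. unfold cis, Cconj. simpl. now rewrite cos_neg, sin_neg. Qed.

Lemma Cmod_cis_1 (t : R) : Cmod (cis t) = 1.
Proof.
  unfold cis, Cmod. simpl. assert (H := sin2_cos2 t). unfold Rsqr in H.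
  replace (cos t * (cos t * 1) + sin t * (sin t * 1)) with 1 by lra. apply sqrt_1.
Qed.

Lemma cis_neq_1 (t : R) : 0 < Rabs t < 2 * PI -> cis t <> 1%C.
Proof.
  intros Ht E. apply (f_equal fst) in E. simpl in E.
  replace (cos t) with (cos (Rabs t)) in E by (unfold Rabs; destruct Rcase_abs; auto using cos_neg).
  replace (Rabs t) with (2 * (Rabs t / 2)) in E by field. rewrite cos_2a_sin in E.
  assert (P := sin_gt_0 (Rabs t / 2) ltac:(lra) ltac:(lra)). nra.
Qed.

Lemma cis_2PI_nat (k : nat) : cis (INR k * (2 * PI)) = 1%C.
Proof.
  rewrite <- cis_pow. replace (cis (2 * PI)) with (RtoC 1).
  - apply Cpow_1_l.
  - unfold cis. now rewrite cos_2PI, sin_2PI.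
Qed.

Definition unit_root (K : nat) : C := cis (2 * PI / INR K).

Lemma unit_root_csum (K i j : nat) : (0 < K)%nat -> (i < j + K)%nat -> (j < i + K)%nat ->
  csum (fun k => (unit_root K ^ i * Cconj (unit_root K) ^ j) ^ k)%C K
  = if Nat.eq_dec i j then RtoC (INR K) else RtoC 0.
Proof.
  intros HK H1 H2. assert (P := PI_RGT_0).
  assert (PK : 0 < INR K) by (apply lt_0_INR; auto).
  assert (E : (unit_root K ^ i * Cconj (unit_root K) ^ j)%C
    = cis ((INR i - INR j) * (2 * PI / INR K))).
  { unfold unit_root. rewrite cis_conj, !cis_pow, <- cis_plus. f_equal. ring. }
  rewrite E. destruct (Nat.eq_dec i j) as [->|N].
  - rewrite Rminus_diag, Rmult_0_l. replace (cis 0) with (RtoC 1).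
    + apply csum_one.
    + unfold cis. now rewrite cos_0, sin_0.
  - apply csum_roots_of_unity.
    + rewrite cis_pow.
      replace (INR K * ((INR i - INR j) * (2 * PI / INR K)))
        with (INR i * (2 * PI) + - (INR j * (2 * PI))) by (field; lra).
      rewrite cis_plus, <- cis_conj, !cis_2PI_nat.
      unfold Cconj, Cmult, RtoC; simpl; f_equal; ring.
    + apply cis_neq_1. rewrite Rabs_mult, (Rabs_pos_eq (2 * PI / INR K))
        by (left; apply Rdiv_lt_0_compat; lra).
      assert (Q : 0 < 2 * PI / INR K) by (apply Rdiv_lt_0_compat; lra).
      assert (B : 0 < Rabs (INR i - INR j) < INR K).
      { apply lt_INR in H1, H2. rewrite plus_INR in H1, H2. split.
        - apply Rabs_pos_lt. intro Z. apply N. apply INR_eq. lra.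
        - apply Rabs_def1; lra. }
      split; [now apply Rmult_lt_0_compat|].
      replace (2 * PI) with (INR K * (2 * PI / INR K)) at 2 by (field; lra).
      apply Rmult_lt_compat_r; lra.
Qed.

(* K^2 times the mean of F (z1, z2) conj(z1)^a conj(z2)^b / (r1^a r2^b) over the
   K-th roots of unity on the torus |z1| = r1, |z2| = r2. *)
Definition torus_mean (K a b : nat) (F : C -> C -> C) (r1 r2 : R) : C :=
  csum (fun i => csum (fun j =>
    F (RtoC r1 * unit_root K ^ i) (RtoC r2 * unit_root K ^ j)
    * ((Cconj (unit_root K) ^ a) ^ i * (Cconj (unit_root K) ^ b) ^ j))%C K) K.

Lemma torus_mean_ext (K a b : nat) (F G : C -> C -> C) (r1 r2 : R) :
  (forall z1 z2, F z1 z2 = G z1 z2) -> torus_mean K a b F r1 r2 = torus_mean K a b G r1 r2.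
Proof. intros E. apply csum_ext. intro i. apply csum_ext. intro j. now rewrite E. Qed.

Lemma torus_mean_plus (K a b : nat) (F G : C -> C -> C) (r1 r2 : R) :
  torus_mean K a b (fun z1 z2 => F z1 z2 + G z1 z2)%C r1 r2
  = (torus_mean K a b F r1 r2 + torus_mean K a b G r1 r2)%C.
Proof.
  unfold torus_mean. rewrite <- csum_plus. apply csum_ext. intro i.
  rewrite <- csum_plus. apply csum_ext. intro j. ring.
Qed.

Lemma torus_mean_le (K a b : nat) (F : C -> C -> C) (r1 r2 M : R) :
  0 <= r1 -> 0 <= r2 -> r1 ^ 2 + r2 ^ 2 <= 1 ->
  (forall z1 z2, unit_ball z1 z2 -> Cmod (F z1 z2) <= M) ->
  Cmod (torus_mean K a b F r1 r2) <= INR K * (INR K * M).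
Proof.
  intros H1 H2 Hr HF. apply Cmod_csum_le. intro i. apply Cmod_csum_le. intro j.
  assert (U : forall k, Cmod (unit_root K ^ k) = 1)
    by (intro k; unfold unit_root; rewrite Cmod_pow, Cmod_cis_1; apply pow1).
  assert (V : forall c k, Cmod ((Cconj (unit_root K) ^ c) ^ k) = 1)
    by (intros c k; unfold unit_root; rewrite !Cmod_pow, Cmod_conj, Cmod_cis_1, !pow1; auto).
  rewrite !Cmod_mult, !V, !Rmult_1_r. apply HF.
  unfold unit_ball. rewrite !Cmod_mult, !U, !Rmult_1_r, !Cmod_R, !Rabs_pos_eq by auto. exact Hr.
Qed.

Lemma Cpow_swap (c : C) (i j : nat) : ((c ^ i) ^ j)%C = ((c ^ j) ^ i)%C.
Proof. now rewrite <- !Cpow_mult_r, Nat.mul_comm. Qed.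

(** The double sum is a product of two geometric sums. As K exceeds the exponents, a frequency
    divisible by K is zero, so only terms whose exponents differ by a in the first variable and by b
    in the second survive. *)
Lemma torus_mean_term (K a b : nat) (t : monomial_term) (r1 r2 : R) :
  (0 < K)%nat -> (ez1 t + ez1b t + a < K)%nat -> (ez2 t + ez2b t + b < K)%nat ->
  torus_mean K a b (term_eval t) r1 r2
  = (RtoC (INR K ^ 2) * (coef t *
      if Nat.eq_dec (ez1 t) (ez1b t + a) then
        if Nat.eq_dec (ez2 t) (ez2b t + b)
        then RtoC (r1 ^ (ez1 t + ez1b t) * r2 ^ (ez2 t + ez2b t)) else RtoC 0 else RtoC 0))%C.
Proof.
  intros HK H1 H2. set (u := unit_root K).
  set (R0 := RtoC (r1 ^ (ez1 t + ez1b t) * r2 ^ (ez2 t + ez2b t))).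
  assert (E : torus_mean K a b (term_eval t) r1 r2 =
    (coef t * R0 * csum (fun i => (u ^ ez1 t * Cconj u ^ (ez1b t + a)) ^ i) K
      * csum (fun j => (u ^ ez2 t * Cconj u ^ (ez2b t + b)) ^ j) K)%C).
  { transitivity (csum (fun i => coef t * R0 * (u ^ ez1 t * Cconj u ^ (ez1b t + a)) ^ i
        * csum (fun j => (u ^ ez2 t * Cconj u ^ (ez2b t + b)) ^ j) K)%C K).
    - apply csum_ext. intro i. rewrite <- csum_mult_l. apply csum_ext. intro j. fold u.
      unfold term_eval, monomial, R0. rewrite !Cmult_conj, !Cpow_conj.
      rewrite !Cpow_mult_l, !Cpow_add_r, RtoC_mult, !RtoC_pow, !Cpow_add_r.
      replace (Cconj (RtoC r1)) with (RtoC r1) by (unfold Cconj, RtoC; simpl; f_equal; ring).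
      replace (Cconj (RtoC r2)) with (RtoC r2) by (unfold Cconj, RtoC; simpl; f_equal; ring).
      rewrite !Cpow_mult_l.
      rewrite (Cpow_swap u i), (Cpow_swap u j), (Cpow_swap (Cconj u) i (ez1b t)),
        (Cpow_swap (Cconj u) j (ez2b t)).
      ring.
    - set (S2 := csum (fun j => (u ^ ez2 t * Cconj u ^ (ez2b t + b)) ^ j)%C K).
      transitivity (csum (fun i => (coef t * R0 * S2) * (u ^ ez1 t * Cconj u ^ (ez1b t + a)) ^ i)%C K).
      + apply csum_ext. intro i. ring.
      + rewrite (csum_mult_l _ (fun i => (u ^ ez1 t * Cconj u ^ (ez1b t + a)) ^ i)%C). ring. }
  rewrite E. unfold u. rewrite !unit_root_csum by lia.
  rewrite RtoC_pow. destruct (Nat.eq_dec (ez1 t) (ez1b t + a)), (Nat.eq_dec (ez2 t) (ez2b t + b));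
    try ring.
Qed.

(** The weight t^alpha (1 - t)^beta, with a = 2 alpha and b = 2 beta: it is |z1|^a |z2|^b on the
    part of the sphere with |z1|^2 = t. *)
Definition sphere_weight (a b : nat) (t : R) : R := sqrt t ^ a * sqrt (1 - t) ^ b.

Lemma sphere_weight_monomial (a b i j : nat) (t : R) : 0 <= t <= 1 ->
  sqrt t ^ ((i + a) + i) * sqrt (1 - t) ^ ((j + b) + j)
  = sphere_weight a b t * (t ^ i * (1 - t) ^ j).
Proof.
  intros Ht. unfold sphere_weight. rewrite !pow_add.
  assert (E : forall s k, 0 <= s -> s ^ k = sqrt s ^ k * sqrt s ^ k).
  { intros s k Hs. rewrite <- Rpow_mult_distr, sqrt_sqrt; auto. }
  rewrite (E t i), (E (1 - t) j) by lra. ring.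
Qed.

(** A surviving term has exponents i + a, i, j + b, j, so its degree a + b + 2 (i + j) is below a +
    b + 2 n only if i + j < n; it contributes a multiple of t^i (1 - t)^j. *)
Lemma torus_mean_lower (K a b n : nat) (s : list monomial_term) :
  (a + b + 2 * n + a + b < K)%nat ->
  List.Forall (fun t => (term_degree t < a + b + 2 * n)%nat) s ->
  exists m, degree_lt n m /\ forall t, 0 <= t <= 1 ->
    fst (torus_mean K a b (lin_comb s) (sqrt t) (sqrt (1 - t)))
    = INR K ^ 2 * (sphere_weight a b t * m t).
Proof.
  intros HK. induction 1 as [|t s Ht Hs IH].
  - exists (fun _ => 0). split; [apply degree_lt_zero|]. intros t _.
    rewrite (torus_mean_ext K a b _ (term_eval (MonomialTerm 0 0 0 0 0)))
      by (intros; unfold term_eval; simpl; ring).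
    rewrite torus_mean_term by (simpl; lia). simpl. ring.
  - destruct IH as [m [Hm Em]]. unfold term_degree in Ht.
    assert (T : exists m', degree_lt n m' /\ forall r, 0 <= r <= 1 ->
      fst (torus_mean K a b (term_eval t) (sqrt r) (sqrt (1 - r)))
      = INR K ^ 2 * (sphere_weight a b r * m' r)).
    { destruct (Nat.eq_dec (ez1 t) (ez1b t + a)) as [E1|N1];
        [destruct (Nat.eq_dec (ez2 t) (ez2b t + b)) as [E2|N2]|].
      - exists (fun r => fst (coef t) * (r ^ ez1b t * (1 - r) ^ ez2b t)). split.
        + apply degree_lt_scal. apply (degree_lt_le (S (ez1b t + ez2b t))); [lia|].
          apply degree_lt_monomial.
        + intros r Hr. rewrite torus_mean_term by lia.
          destruct (Nat.eq_dec (ez1 t) (ez1b t + a)); [|lia].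
          destruct (Nat.eq_dec (ez2 t) (ez2b t + b)); [|lia].
          rewrite E1, E2, sphere_weight_monomial by auto. destruct (coef t). simpl. ring.
      - exists (fun _ => 0). split; [apply degree_lt_zero|]. intros r _.
        rewrite torus_mean_term by lia.
        destruct (Nat.eq_dec (ez1 t) (ez1b t + a)); [|lia].
        destruct (Nat.eq_dec (ez2 t) (ez2b t + b)); [lia|]. simpl. ring.
      - exists (fun _ => 0). split; [apply degree_lt_zero|]. intros r _.
        rewrite torus_mean_term by lia.
        destruct (Nat.eq_dec (ez1 t) (ez1b t + a)); [lia|]. simpl. ring. }
    destruct T as [m' [Hm' Em']]. exists (fun r => m' r + m r).
    split; [now apply degree_lt_plus|]. intros r Hr.
    rewrite (torus_mean_ext K a b (lin_comb (t :: s))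
      (fun z1 z2 => term_eval t z1 z2 + lin_comb s z1 z2)%C) by reflexivity.
    rewrite torus_mean_plus.
    change (fst (?u + ?v)%C) with (fst u + fst v).
    rewrite Em, Em' by auto. ring.
Qed.

Lemma sphere_restriction (a b l1 l2 : nat) (P : C -> C -> C) (M : R) :
  lower_polynomial (a + l1) l1 (b + l2) l2 P ->
  (forall z1 z2, unit_ball z1 z2 -> Cmod (monomial_minus (a + l1) l1 (b + l2) l2 P z1 z2) <= M) ->
  exists m, degree_lt (l1 + l2) m /\ forall t, 0 <= t <= 1 ->
    sphere_weight a b t * Rabs (t ^ l1 * (1 - t) ^ l2 - m t) <= M.
Proof.
  intros [s [Hs EP]] HM. set (n := (l1 + l2)%nat).
  (* Larger than the degree a + b + 2 n plus the shifts a and b, so that distinct frequencies remain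
     distinct modulo K. *)
  set (K := S (a + b + 2 * n + a + b)).
  assert (HK : 0 < INR K ^ 2) by (apply pow_lt, lt_0_INR; unfold K; lia).
  destruct (torus_mean_lower K a b n s) as [m [Hm Em]].
  - unfold K. lia.
  - eapply Forall_impl; [|exact Hs]. simpl. intros; unfold n; lia.
  - exists m. split; auto. intros t Ht.
    assert (B := torus_mean_le K a b _ (sqrt t) (sqrt (1 - t)) M (sqrt_pos _) (sqrt_pos _)
      ltac:(rewrite !pow2_sqrt by lra; lra) HM).
    set (F := monomial_minus (a + l1) l1 (b + l2) l2 P) in *.
    set (top := MonomialTerm 1 (a + l1) l1 (b + l2) l2).
    assert (Etop : torus_mean K a b (term_eval top) (sqrt t) (sqrt (1 - t))
      = (torus_mean K a b F (sqrt t) (sqrt (1 - t))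
         + torus_mean K a b (lin_comb s) (sqrt t) (sqrt (1 - t)))%C).
    { rewrite <- torus_mean_plus. apply torus_mean_ext. intros z1 z2.
      unfold F, monomial_minus, term_eval. simpl. rewrite EP. ring. }
    rewrite torus_mean_term in Etop by (simpl; unfold K, n; lia).
    unfold top in Etop. cbn [ez1 ez1b ez2 ez2b coef] in Etop.
    destruct (Nat.eq_dec (a + l1) (l1 + a)) as [_|]; [|lia].
    destruct (Nat.eq_dec (b + l2) (l2 + b)) as [_|]; [|lia].
    rewrite (Nat.add_comm a), (Nat.add_comm b), sphere_weight_monomial in Etop by auto.
    apply (f_equal fst) in Etop.
    change (fst (torus_mean K a b F (sqrt t) (sqrt (1 - t))
      + torus_mean K a b (lin_comb s) (sqrt t) (sqrt (1 - t)))%C)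
      with (fst (torus_mean K a b F (sqrt t) (sqrt (1 - t)))
        + fst (torus_mean K a b (lin_comb s) (sqrt t) (sqrt (1 - t)))) in Etop.
    rewrite Em in Etop by auto.
    assert (X := Rabs_re_le_Cmod (torus_mean K a b F (sqrt t) (sqrt (1 - t)))).
    set (f := fst (torus_mean K a b F (sqrt t) (sqrt (1 - t)))) in *.
    set (w := sphere_weight a b t) in *.
    assert (Hw : 0 <= w) by (apply Rmult_le_pos; apply pow_le, sqrt_pos).
    assert (Ef : f = INR K ^ 2 * (w * (t ^ l1 * (1 - t) ^ l2 - m t))).
    { assert (E1 : forall r r', fst (RtoC r * (1 * RtoC r'))%C = r * r') by (intros; simpl; ring).
      rewrite E1 in Etop. rewrite Rmult_minus_distr_l, Rmult_minus_distr_l, Etop. ring. }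
    rewrite Ef, Rabs_mult, Rabs_mult, (Rabs_pos_eq (INR K ^ 2)), (Rabs_pos_eq w) in X by lra.
    apply (Rmult_le_reg_l (INR K ^ 2)); [auto|].
    eapply Rle_trans; [exact X|]. eapply Rle_trans; [exact B|]. right. ring.
Qed.

(** * The norm on the ball *)

Lemma ball_norm_attained (P : C -> C -> C) (M : R) (u1 u2 : C) :
  (forall z1 z2, unit_ball z1 z2 -> Cmod (P z1 z2) <= M) ->
  unit_ball u1 u2 -> Cmod (P u1 u2) = M -> Defs.ball_norm P = M.
Proof.
  intros HM HU HE. unfold Defs.ball_norm.
  rewrite (is_lub_Rbar_unique _ (Finite M)); [reflexivity|]. split.
  - intros r (z1 & z2 & Hz & ->). simpl. auto.
  - intros l Hl. apply Hl. exists u1, u2. auto.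
Qed.

(** The bound B serves to make the supremum finite: for an infinite one, [real] would return 0. *)
Lemma ball_norm_upper (P : C -> C -> C) (B : R) :
  (forall z1 z2, unit_ball z1 z2 -> Cmod (P z1 z2) <= B) ->
  forall z1 z2, unit_ball z1 z2 -> Cmod (P z1 z2) <= Defs.ball_norm P.
Proof.
  intros HB z1 z2 Hz. unfold Defs.ball_norm.
  destruct (Lub_Rbar_correct (fun r => exists z1 z2, unit_ball z1 z2 /\ r = Cmod (P z1 z2))) as [U L].
  set (l := Lub_Rbar _) in *.
  assert (U1 : Rbar_le (Cmod (P z1 z2)) l) by (apply U; exists z1, z2; auto).
  assert (L1 : Rbar_le l B) by (apply L; intros r (y1 & y2 & Hy & ->); simpl; auto).
  destruct l; simpl in *; tauto || auto.
Qed.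

Lemma unit_ball_Cmod (z1 z2 : C) : unit_ball z1 z2 -> Cmod z1 <= 1 /\ Cmod z2 <= 1.
Proof.
  unfold unit_ball. intros H. assert (P1 := Cmod_ge_0 z1). assert (P2 := Cmod_ge_0 z2).
  assert (Q1 := pow2_ge_0 (Cmod z1)). assert (Q2 := pow2_ge_0 (Cmod z2)). split; nra.
Qed.

Lemma monomial_le_1 (a b d e : nat) (z1 z2 : C) :
  unit_ball z1 z2 -> Cmod (monomial a b d e z1 z2) <= 1.
Proof.
  intros H. destruct (unit_ball_Cmod z1 z2 H) as [H1 H2].
  unfold monomial. rewrite !Cmod_mult, !Cmod_pow, !Cmod_conj.
  assert (P : forall r k, 0 <= r <= 1 -> 0 <= r ^ k <= 1).
  { intros r k Hr. split; [now apply pow_le|]. rewrite <- (pow1 k). now apply pow_incr. }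
  assert (A := P (Cmod z1) a (conj (Cmod_ge_0 z1) H1)). assert (B := P (Cmod z1) b (conj (Cmod_ge_0 z1) H1)).
  assert (D := P (Cmod z2) d (conj (Cmod_ge_0 z2) H2)). assert (E := P (Cmod z2) e (conj (Cmod_ge_0 z2) H2)).
  assert (X1 : 0 <= Cmod z1 ^ a * Cmod z1 ^ b <= 1) by nra.
  assert (X2 : 0 <= Cmod z1 ^ a * Cmod z1 ^ b * Cmod z2 ^ d <= 1) by nra. nra.
Qed.

Lemma lin_comb_bounded (s : list monomial_term) : exists B, forall z1 z2,
  unit_ball z1 z2 -> Cmod (lin_comb s z1 z2) <= B.
Proof.
  induction s as [|t s [B HB]].
  - exists 0. intros. simpl. rewrite Cmod_0. lra.
  - exists (Cmod (coef t) + B). intros z1 z2 H. simpl.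
    eapply Rle_trans; [apply Cmod_triangle|]. apply Rplus_le_compat; auto.
    unfold term_eval. rewrite Cmod_mult.
    assert (X := monomial_le_1 (ez1 t) (ez1b t) (ez2 t) (ez2b t) z1 z2 H).
    assert (Y := Cmod_ge_0 (coef t)). nra.
Qed.

Lemma root_product_sqr_le (x : nat -> R) (m l : nat) (s t : R) :
  (forall j, (m < j <= m + l)%nat -> Rabs (s - x j) <= Rabs (t - x j)) ->
  0 <= root_product x m l s ^ 2 <= root_product x m l t ^ 2.
Proof.
  induction l as [|l IH]; intros Hj.
  - unfold root_product. simpl. lra.
  - rewrite !root_product_S, !Rpow_mult_distr.
    assert (A := IH ltac:(intros; apply Hj; lia)). specialize (Hj (m + S l)%nat ltac:(lia)).
    assert (P := Rabs_pos (s - x (m + S l)%nat)).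
    rewrite <- (pow2_abs (s - x (m + S l)%nat)), <- (pow2_abs (t - x (m + S l)%nat)).
    assert (Q : 0 <= Rabs (s - x (m + S l)%nat) ^ 2 <= Rabs (t - x (m + S l)%nat) ^ 2)
      by (split; [apply pow2_ge_0|now apply pow_incr]).
    split; [apply Rmult_le_pos; lra|apply Rmult_le_compat; lra].
Qed.

Lemma root_product_pos (x : nat -> R) (m l : nat) (t : R) :
  (forall j, (m < j <= m + l)%nat -> x j < t) -> 0 < root_product x m l t.
Proof.
  induction l as [|l IH]; intros Hj.
  - unfold root_product. simpl. lra.
  - rewrite root_product_S. apply Rmult_lt_0_compat.
    + apply IH. intros; apply Hj; lia.
    + specialize (Hj (m + S l)%nat ltac:(lia)). lra.
Qed.

Lemma root_product_sign (x : nat -> R) (m l : nat) (t : R) :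
  (forall j, (m < j <= m + l)%nat -> t < x j) -> 0 < (-1) ^ l * root_product x m l t.
Proof.
  induction l as [|l IH]; intros Hj.
  - unfold root_product. simpl. lra.
  - rewrite root_product_S.
    replace ((-1) ^ S l * (root_product x m l t * (t - x (m + S l)%nat)))
      with (((-1) ^ l * root_product x m l t) * (x (m + S l)%nat - t)) by (simpl; ring).
    apply Rmult_lt_0_compat.
    + apply IH. intros; apply Hj; lia.
    + specialize (Hj (m + S l)%nat ltac:(lia)). lra.
Qed.

Lemma root_product_monic (x : nat -> R) (m l : nat) : monic_of_degree l (root_product x m l).
Proof.
  induction l as [|l IH].
  - apply (degree_lt_ext _ (fun _ => 0)); [|apply degree_lt_zero].
    intros; unfold root_product; simpl; ring.
  - apply (degree_lt_ext _ (fun t => root_product x m l t * (t - x (m + S l)%nat) - t ^ S l)).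
    + intros. now rewrite root_product_S.
    + now apply (monic_mult l (root_product x m l)).
Qed.

(** * The extremal polynomial and its norm *)

Section LeastDeviation.

Variables (a b l1 l2 : nat) (x e : nat -> R) (H : R).
Local Notation n := (l1 + l2)%nat.
Hypothesis H_pos : 0 < H.
Hypothesis x_0 : x 0%nat = 0.
Hypothesis x_Sn : x (S n) = 1.
Hypothesis x_incr : forall i, (i <= n)%nat -> x i < x (S i).
Hypothesis height_le :
  forall t, 0 <= t <= 1 -> t ^ a * (1 - t) ^ b * root_product x 0 n t ^ 2 <= H.
Hypothesis height_tip : forall i, (i <= n)%nat -> x i <= e i <= x (S i) /\
  e i ^ a * (1 - e i) ^ b * root_product x 0 n (e i) ^ 2 = H.

(** The polynomial of the theorem before normalization, with leading coefficient 1. *)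
Definition extremal_poly (z1 z2 : C) : C :=
  (z1 ^ a * z2 ^ b * RtoC (root_product x 0 l1 (Cmod z1 ^ 2))
   * RtoC ((-1) ^ l2 * root_product x l1 l2 (1 - Cmod z2 ^ 2)))%C.

Lemma extremal_poly_leading :
  has_leading ((a + l1) + l1 + (b + l2) + l2) (monomial (a + l1) l1 (b + l2) l2) extremal_poly.
Proof.
  assert (F1 : forall l, has_leading (2 * l) (monomial l l 0 0)
    (fun z1 _ => RtoC (root_product x 0 l (Cmod z1 ^ 2)))).
  { induction l as [|l IH].
    - eapply has_leading_ext; [| |apply (has_leading_monomial 0 0 0 0)]; [reflexivity|].
      intros. unfold monomial, root_product. simpl. ring.
    - replace (2 * S l)%nat with (2 * l + 2)%nat by lia.
      eapply has_leading_ext; [| |apply (has_leading_mult _ _ _ _ _ _ IH (has_leading_factor1 (x (S l))))].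
      + intros. cbv beta. rewrite monomial_mult. f_equal; lia.
      + intros. cbv beta. rewrite root_product_S, RtoC_mult. reflexivity. }
  assert (F2 : forall l, has_leading (2 * l) (monomial 0 0 l l)
    (fun _ z2 => RtoC ((-1) ^ l * root_product x l1 l (1 - Cmod z2 ^ 2)))).
  { induction l as [|l IH].
    - eapply has_leading_ext; [| |apply (has_leading_monomial 0 0 0 0)]; [reflexivity|].
      intros. unfold monomial, root_product. simpl. rewrite Rmult_1_r. ring.
    - replace (2 * S l)%nat with (2 * l + 2)%nat by lia.
      eapply has_leading_ext; [| |apply (has_leading_mult _ _ _ _ _ _ IH
        (has_leading_factor2 (x (l1 + S l)%nat)))].
      + intros. cbv beta. rewrite monomial_mult. f_equal; lia.
      + intros. cbv beta. rewrite root_product_S, <- RtoC_mult. f_equal. simpl pow. ring. }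
  replace ((a + l1) + l1 + (b + l2) + l2)%nat with ((a + 0 + b + 0) + (2 * l1) + (2 * l2))%nat by lia.
  eapply has_leading_ext; [| |apply (has_leading_mult _ _ _ _ _ _
    (has_leading_mult _ _ _ _ _ _ (has_leading_monomial a 0 b 0) (F1 l1)) (F2 l2))].
  - intros. cbv beta. rewrite !monomial_mult. f_equal; lia.
  - intros. unfold extremal_poly, monomial. simpl. ring.
Qed.

(* If s < t straddle both groups of roots, compare with the tip between them:
   F (s) G (t) H = F (s) G (t) F (e) G (e) <= (F (s) G (s)) (F (t) G (t)) <= H^2,
   where F and G denote the two factors. *)
Lemma two_point_height (s t : R) : 0 <= s -> s <= t -> t <= 1 ->
  (s ^ a * root_product x 0 l1 s ^ 2) * ((1 - t) ^ b * root_product x l1 l2 t ^ 2) <= H.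
Proof.
  intros Hs Hst Ht.
  set (F := fun r => r ^ a * root_product x 0 l1 r ^ 2).
  set (G := fun r => (1 - r) ^ b * root_product x l1 l2 r ^ 2).
  assert (FG : forall r, r ^ a * (1 - r) ^ b * root_product x 0 n r ^ 2 = F r * G r).
  { intro r. rewrite root_product_app. unfold F, G. rewrite Nat.add_0_l. ring. }
  assert (U := (node_unit x n x_incr x_0 x_Sn) l1 ltac:(lia)). assert (U' := (node_unit x n x_incr x_0 x_Sn) (S l1) ltac:(lia)).
  assert (Fnn : forall r, 0 <= r <= 1 -> 0 <= F r).
  { intros. apply Rmult_le_pos; [apply pow_le; lra|apply pow2_ge_0]. }
  assert (Gnn : forall r, 0 <= r <= 1 -> 0 <= G r).
  { intros. apply Rmult_le_pos; [apply pow_le; lra|apply pow2_ge_0]. }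
  assert (Fincr : forall r r', x l1 <= r -> r <= r' -> r' <= 1 -> F r <= F r').
  { intros r r' L1 L2 L3. apply Rmult_le_compat; [apply pow_le; lra|apply pow2_ge_0| |].
    - apply pow_incr; lra.
    - apply root_product_sqr_le. intros j Hj. assert (Z := (node_le x n x_incr) j l1 ltac:(lia)).
      rewrite !Rabs_pos_eq; lra. }
  assert (Gdecr : forall r r', 0 <= r -> r <= r' -> r' <= x (S l1) -> G r' <= G r).
  { intros r r' L1 L2 L3. apply Rmult_le_compat; [apply pow_le; lra|apply pow2_ge_0| |].
    - apply pow_incr; lra.
    - apply root_product_sqr_le. intros j Hj. assert (Z := (node_le x n x_incr) (S l1) j ltac:(lia)).
      rewrite (Rabs_minus_sym r'), (Rabs_minus_sym r), !Rabs_pos_eq; lra. }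
  assert (Hdiag : forall r, 0 <= r <= 1 -> F r * G r <= H) by (intros r Hr; rewrite <- FG; auto).
  change (F s * G t <= H).
  destruct (Rle_dec (x l1) s) as [C1|C1].
  { apply Rle_trans with (F t * G t); [|apply Hdiag; lra].
    apply Rmult_le_compat_r; [apply Gnn; lra|apply Fincr; lra]. }
  destruct (Rle_dec t (x (S l1))) as [C2|C2].
  { apply Rle_trans with (F s * G s); [|apply Hdiag; lra].
    apply Rmult_le_compat_l; [apply Fnn; lra|apply Gdecr; lra]. }
  destruct (height_tip l1 ltac:(lia)) as [Be Ee]. rewrite FG in Ee.
  set (r := e l1) in *.
  assert (A1 : F s * G r <= H).
  { apply Rle_trans with (F s * G s); [|apply Hdiag; lra].
    apply Rmult_le_compat_l; [apply Fnn; lra|apply Gdecr; lra]. }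
  assert (A2 : F r * G t <= H).
  { apply Rle_trans with (F t * G t); [|apply Hdiag; lra].
    apply Rmult_le_compat_r; [apply Gnn; lra|apply Fincr; lra]. }
  apply (Rmult_le_reg_r H); auto.
  replace (F s * G t * H) with ((F s * G r) * (F r * G t)) by (rewrite <- Ee; ring).
  apply Rmult_le_compat; auto; apply Rmult_le_pos; (apply Fnn || apply Gnn); lra.
Qed.

Lemma Cmod_extremal_poly_sqr (z1 z2 : C) :
  Cmod (extremal_poly z1 z2) ^ 2 =
  ((Cmod z1 ^ 2) ^ a * root_product x 0 l1 (Cmod z1 ^ 2) ^ 2)
  * ((Cmod z2 ^ 2) ^ b * root_product x l1 l2 (1 - Cmod z2 ^ 2) ^ 2).
Proof.
  unfold extremal_poly. rewrite !Cmod_mult, !Cmod_pow, !Cmod_R.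
  rewrite Rabs_mult, <- RPow_abs, Rabs_m1, pow1, Rmult_1_l.
  rewrite !Rpow_mult_distr, !pow2_abs, <- !pow_mult, (Nat.mul_comm a), (Nat.mul_comm b). ring.
Qed.

Lemma extremal_poly_le (z1 z2 : C) : unit_ball z1 z2 -> Cmod (extremal_poly z1 z2) <= sqrt H.
Proof.
  intros Hb. assert (P := Cmod_ge_0 (extremal_poly z1 z2)).
  rewrite <- (sqrt_pow2 _ P). apply sqrt_le_1_alt.
  rewrite Cmod_extremal_poly_sqr.
  assert (Q1 := pow2_ge_0 (Cmod z1)). assert (Q2 := pow2_ge_0 (Cmod z2)). unfold unit_ball in Hb.
  assert (T := two_point_height (Cmod z1 ^ 2) (1 - Cmod z2 ^ 2) Q1 ltac:(lra) ltac:(lra)).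
  replace (1 - (1 - Cmod z2 ^ 2)) with (Cmod z2 ^ 2) in T by ring. exact T.
Qed.

Lemma extremal_poly_norm : Defs.ball_norm extremal_poly = sqrt H.
Proof.
  destruct (height_tip 0 ltac:(lia)) as [B E].
  assert (U := (node_unit x n x_incr x_0 x_Sn) 0 ltac:(lia)). assert (U' := (node_unit x n x_incr x_0 x_Sn) 1 ltac:(lia)).
  (* A point of the sphere with |z1|^2 = e 0: both root products are taken at the same argument, and
     the squared modulus is the height H of the tip. *)
  apply (ball_norm_attained _ _ (RtoC (sqrt (e 0%nat))) (RtoC (sqrt (1 - e 0%nat)))).
  - exact extremal_poly_le.
  - unfold unit_ball. rewrite !Cmod_R, !pow2_abs, !pow2_sqrt by lra. lra.
  - rewrite <- (sqrt_pow2 _ (Cmod_ge_0 _)). f_equal. rewrite Cmod_extremal_poly_sqr.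
    rewrite !Cmod_R, !pow2_abs, !pow2_sqrt by lra.
    replace (1 - (1 - e 0%nat)) with (e 0%nat) by ring.
    rewrite <- E, root_product_app, Nat.add_0_l. ring.
Qed.

Lemma tip_strict (i : nat) : (i <= n)%nat ->
  (forall j, (0 < j <= i)%nat -> x j < e i) /\ (forall j, (i < j <= n)%nat -> e i < x j).
Proof.
  intros Hi. destruct (height_tip i Hi) as [B E].
  assert (N : forall j, (0 < j <= n)%nat -> e i <> x j).
  { intros j Hj Z. rewrite Z, root_product_eq_0 in E by lia. rewrite (pow_ne_zero 2) in E by lia. lra. }
  split; intros j Hj; specialize (N j ltac:(lia)).
  - assert (Z := (node_le x n x_incr) j i ltac:(lia)). lra.
  - assert (Z := (node_le x n x_incr) (S i) j ltac:(lia)). lra.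
Qed.

(** If M < sqrt H, the averaged competitor is strictly smaller in modulus than the root product at
    each tip. The difference D then has the sign of the root product at n + 1 points, one sign
    change too many for its degree. *)
Lemma deviation_lower_bound (P : C -> C -> C) (M : R) :
  lower_polynomial (a + l1) l1 (b + l2) l2 P ->
  (forall z1 z2, unit_ball z1 z2 -> Cmod (monomial_minus (a + l1) l1 (b + l2) l2 P z1 z2) <= M) ->
  sqrt H <= M.
Proof.
  intros HP HM. apply Rnot_lt_le. intro Lt.
  destruct (sphere_restriction a b l1 l2 P M HP HM) as [m [Hm Em]].
  (* The sign (-1)^l2 makes the competitor monic, so the powers t^n cancel in D. *)
  set (D := fun t => root_product x 0 n t - (-1) ^ l2 * (t ^ l1 * (1 - t) ^ l2 - m t)).
  assert (HD : degree_lt n D).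
  { apply (degree_lt_ext _ (fun t => (root_product x 0 n t - (-1) ^ l2 * (t ^ l1 * (1 - t) ^ l2))
      + (-1) ^ l2 * m t)); [intros; unfold D; ring|].
    apply degree_lt_plus; [|now apply degree_lt_scal].
    apply (monic_minus n (root_product x 0 n) (fun t => (-1) ^ l2 * (t ^ l1 * (1 - t) ^ l2))).
    - apply root_product_monic.
    - apply monic_reflected_monomial. }
  apply (degree_lt_no_alternation n (fun t => (-1) ^ n * D t) e).
  - now apply degree_lt_scal.
  - intros i Hi. assert (A := proj2 (tip_strict i ltac:(lia)) (S i) ltac:(lia)).
    destruct (height_tip (S i) ltac:(lia)) as [B _]. lra.
  - intros i Hi. destruct (tip_strict i Hi) as [T1 T2].
    destruct (height_tip i Hi) as [B E].
    assert (U := (node_unit x n x_incr x_0 x_Sn) i ltac:(lia)). assert (U' := (node_unit x n x_incr x_0 x_Sn) (S i) ltac:(lia)).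
    set (t := e i) in *. assert (Ht : 0 <= t <= 1) by lra.
    specialize (Em t Ht). set (v := t ^ l1 * (1 - t) ^ l2 - m t) in *.
    set (w := sphere_weight a b t) in *.
    assert (Hw : 0 <= w) by (apply Rmult_le_pos; apply pow_le, sqrt_pos).
    assert (Hw2 : w ^ 2 = t ^ a * (1 - t) ^ b).
    { unfold w, sphere_weight. rewrite Rpow_mult_distr, <- !pow_mult, !(Nat.mul_comm _ 2), !pow_mult.
      now rewrite !pow2_sqrt by lra. }
    set (rp := root_product x 0 n t) in *.
    (* The first i roots lie to the left of the tip and give positive factors, the other n - i
       negative ones. *)
    assert (Sg : 0 < (-1) ^ (n - i) * rp).
    { unfold rp. replace n with (i + (n - i))%nat at 2 by lia. rewrite root_product_app, Nat.add_0_l.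
      replace ((-1) ^ (n - i) * (root_product x 0 i t * root_product x i (n - i) t))
        with (root_product x 0 i t * ((-1) ^ (n - i) * root_product x i (n - i) t)) by ring.
      apply Rmult_lt_0_compat.
      - apply root_product_pos. intros j Hj. apply T1. lia.
      - apply root_product_sign. intros j Hj. apply T2. lia. }
    assert (Es : forall k, (-1) ^ k = 1 \/ (-1) ^ k = -1).
    { induction k as [|k [IH|IH]]; simpl; rewrite ?IH; [left|right|left]; ring. }
    assert (Esgn : (-1) ^ i * (-1) ^ n = (-1) ^ (n - i)).
    { replace n with (i + (n - i))%nat at 1 by lia. rewrite pow_add.
      destruct (Es i) as [-> | ->]; ring. }
    assert (Hrp : w * Rabs rp = sqrt H).
    { rewrite <- (Rabs_pos_eq w) by auto. rewrite <- Rabs_mult, <- sqrt_Rsqr_abs. f_equal.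
      unfold Rsqr. replace (w * rp * (w * rp)) with (w ^ 2 * rp ^ 2) by ring. rewrite Hw2. exact E. }
    assert (Hlt : Rabs v < Rabs rp).
    { apply Rnot_le_lt. intro L. assert (w * Rabs rp <= w * Rabs v) by now apply Rmult_le_compat_l. lra. }
    replace ((-1) ^ i * ((-1) ^ n * D t)) with ((-1) ^ (n - i) * D t) by (rewrite <- Esgn; ring).
    unfold D. fold rp v.
    assert (Ev : Rabs ((-1) ^ l2 * v) = Rabs v).
    { rewrite Rabs_mult, <- RPow_abs, Rabs_m1, pow1. ring. }
    set (v' := (-1) ^ l2 * v) in *.
    assert (B1 : v' < Rabs rp /\ - Rabs rp < v') by (apply Rabs_def2; lra).
    destruct (Es (n - i)%nat) as [S1|S1]; rewrite S1 in *.
    + rewrite (Rabs_pos_eq rp) in B1 by lra. lra.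
    + rewrite (Rabs_left rp) in B1 by lra. lra.
Qed.

Lemma extremal_poly_least_deviation :
  is_least_deviation_poly (a + l1) l1 (b + l2) l2 extremal_poly.
Proof.
  destruct extremal_poly_leading as [_ L].
  set (P := fun z1 z2 => (RtoC (-1) * (extremal_poly z1 z2 - monomial (a + l1) l1 (b + l2) l2 z1 z2))%C).
  assert (HP : lower_polynomial (a + l1) l1 (b + l2) l2 P).
  { unfold lower_polynomial.
    eapply poly_degree_le_ext; [|apply (poly_degree_le_mult _ _ _ _
      (poly_degree_le_monomial (RtoC (-1)) 0 0 0 0) L)].
    intros. unfold P, monomial. simpl. ring. }
  assert (EP : forall z1 z2, extremal_poly z1 z2 = monomial_minus (a + l1) l1 (b + l2) l2 P z1 z2).
  { intros. unfold monomial_minus, P. ring. }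
  exists P. split; [auto|]. split; [exact EP|]. rewrite extremal_poly_norm.
  unfold least_deviation. rewrite (is_glb_Rbar_unique _ (Finite (sqrt H))); [reflexivity|]. split.
  - intros r (Q & HQ & ->). simpl.
    apply (deviation_lower_bound Q); auto.
    destruct HQ as [s [_ EQ]]. destruct (lin_comb_bounded s) as [B HB].
    apply (ball_norm_upper _ (1 + B)). intros z1 z2 Hz. unfold monomial_minus.
    unfold Cminus. eapply Rle_trans; [apply Cmod_triangle|]. rewrite Cmod_opp, EQ.
    apply Rplus_le_compat; [now apply monomial_le_1|auto].
  - intros l Hl. apply Hl. exists P. split; auto.
    replace (Defs.ball_norm (monomial_minus (a + l1) l1 (b + l2) l2 P)) with (Defs.ball_norm extremal_poly).
    + symmetry. apply extremal_poly_norm.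
    + unfold Defs.ball_norm. f_equal. apply Lub_Rbar_eqset. intro r.
      split; intros (z1 & z2 & Hz & ->); exists z1, z2; rewrite EP; auto.
Qed.

End LeastDeviation.

(** * Least deviation *)

Lemma root_product_ext (x y : nat -> R) (m l : nat) (t : R) :
  (forall j, (m < j <= m + l)%nat -> x j = y j) -> root_product x m l t = root_product y m l t.
Proof.
  induction l as [|l IH]; intros Hj; [reflexivity|].
  rewrite !root_product_S, IH, Hj by (intros; try apply Hj; lia). reflexivity.
Qed.

Lemma exp_minus_half_ln (H : R) : 0 < H -> exp (- ln H / 2) * sqrt H = 1.
Proof.
  intros P. assert (E : sqrt H = exp (ln H / 2)).
  { rewrite <- (sqrt_pow2 (exp (ln H / 2))) by (left; apply exp_pos). f_equal.
    simpl. rewrite Rmult_1_r, <- exp_plus. replace (ln H / 2 + ln H / 2) with (ln H) by field.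
    now rewrite exp_ln. }
  rewrite E, <- exp_plus. replace (- ln H / 2 + ln H / 2) with 0 by field. apply exp_0.
Qed.

Theorem theorem1p3 (k1 l1 k2 l2 : nat) (alpha beta : R)
    (w : C -> C) (c : R) (xi : nat -> R)
    (Halpha : alpha = (INR k1 - INR l1) / 2) (Halpha0 : 0 <= alpha)
    (Hbeta : beta = (INR k2 - INR l2) / 2) (Hbeta0 : 0 <= beta)
    (Hw : is_comb_map (l1 + l2) alpha beta w)
    (Hc : is_comb_constant (l1 + l2) alpha beta w c)
    (Hxi : forall j : nat, (1 <= j <= l1 + l2)%nat ->
             is_preimage (l1 + l2) alpha beta w j (xi j)) :
  let J1 := root_product xi 0 l1 in
  let J2 := root_product xi l1 l2 in
  is_normalized_least_deviation_poly k1 l1 k2 l2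
    (fun z1 z2 : C =>
       (RtoC (exp c) * z1 ^ (k1 - l1) * z2 ^ (k2 - l2)
        * RtoC (J1 (Cmod z1 ^ 2)%R)
        * RtoC (-1) ^ l2 * RtoC (J2 (1 - Cmod z2 ^ 2)%R))%C).
Proof.
  intros J1 J2. unfold J1, J2. clear J1 J2.
  (* The truncated differences k1 - l1 and k2 - l2 in the statement are true ones, as alpha and beta
     are nonnegative. *)
  assert (Hk1 : (l1 <= k1)%nat) by (apply INR_le; lra).
  assert (Hk2 : (l2 <= k2)%nat) by (apply INR_le; lra).
  rewrite <- minus_INR in Halpha by auto. rewrite <- minus_INR in Hbeta by auto.
  set (p := (k1 - l1)%nat) in *. set (q := (k2 - l2)%nat) in *. subst alpha beta.
  replace k1 with (p + l1)%nat by (unfold p; lia). replace k2 with (q + l2)%nat by (unfold q; lia).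
  destruct (extremal_nodes p q (l1 + l2)) as (x & e & H & HH & x0 & x1 & xlt & Hle & Htip).
  assert (Hpos : exists k, (k <= S (l1 + l2))%nat /\ 0 < comb_weight (l1 + l2) p q k).
  { destruct (Nat.eq_dec (l1 + l2) 0) as [N0|N0].
    - destruct (Rlt_dec 0 (INR p / 2)) as [Pp|Pp].
      { exists 0%nat. split; [lia|]. now rewrite comb_weight_0. }
      destruct (Rlt_dec 0 (INR q / 2)) as [Pq|Pq].
      { exists (S (l1 + l2)). split; [lia|]. now rewrite comb_weight_Sn. }
      (* For n = 0 and alpha = beta = 0 the domain is empty, so there is no map [w]. *)
      exfalso. destruct Hw as ((_ & Iw & _) & _).
      assert (Ui : upper_half_plane Ci) by (unfold upper_half_plane; simpl; lra).
      destruct (Iw Ci Ui) as [B _]. rewrite N0 in B. simpl in B. lra.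
    - exists 1%nat. split; [lia|]. rewrite comb_weight_mid by lia. lra. }
  assert (Ec : c = - ln H / 2).
  { apply (comb_constant_unique (l1 + l2) p q x e H HH x0 x1 xlt Hle Htip Hpos w Hw c Hc). }
  assert (Ex : forall j, (1 <= j <= l1 + l2)%nat -> xi j = x j).
  { intros j Hj.
    apply (comb_preimage_unique (l1 + l2) p q x e H HH x0 x1 xlt Hle Htip Hpos w Hw j); [lia|].
    now apply Hxi. }
  exists (extremal_poly p q l1 l2 x). split.
  - apply (extremal_poly_least_deviation p q l1 l2 x e H); auto.
  - intros z1 z2. rewrite (extremal_poly_norm p q l1 l2 x e H) by auto.
    rewrite (root_product_ext xi x 0 l1), (root_product_ext xi x l1 l2) by (intros; apply Ex; lia).
    assert (Es := exp_minus_half_ln H HH). rewrite <- Ec in Es.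
    assert (Hs : RtoC (sqrt H) <> 0%C).
    { intro Z. apply (f_equal fst) in Z. simpl in Z. rewrite Z in Es. lra. }
    (* Since c = - ln H / 2, multiplying by e^c is the same as dividing by the norm sqrt H. *)
    assert (Ei : RtoC (exp c) = (/ RtoC (sqrt H))%C).
    { apply (f_equal RtoC) in Es. rewrite RtoC_mult in Es.
      transitivity (RtoC (exp c) * RtoC (sqrt H) * / RtoC (sqrt H))%C; [field; auto|].
      rewrite Es. ring. }
    unfold extremal_poly, Cdiv. rewrite Ei, RtoC_mult, RtoC_pow. ring.
Qed.
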